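(* Let $\gamma>2$, $n\in\mathbb{N}$ with $n\ge\gamma$, and let $(u,\mu)$ be a weak conservative solution of the Hunter--Saxton equation with $\int_{\mathbb{R}}(1+|x|^\gamma)d\mu(0,x)<\infty$; let $T>0$. Then the function $\chi(t,\cdot)$ satisfies, for almost all $t\in[0,T]$, the differential equation $$\chi_t(t,\eta)+h(t,\eta)\chi_\eta(t,\eta)=\mathcal{U}(t,\eta)$$ in $L^\gamma([0,B+C])$, where $h(t,\eta)=\mathcal{U}\mathcal{P}(t,\eta)-\int_0^{B+C}\mathcal{U}(t,\tilde\eta)K(\chi(t,\eta)-\chi(t,\tilde\eta))(1-\mathcal{P}\chi_\eta(t,\tilde\eta))d\tilde\eta$. Furthermore, the map $t\mapsto\chi(t,\cdot)$ is continuous from $[0,T]$ into $L^\gamma([0,B+C])$.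
   Context: The Hunter--Saxton equation is $u_t+uu_x=\tfrac14\big(\int_{-\infty}^x d\mu(t,z)-\int_x^{\infty}d\mu(t,z)\big)$, $\mu_t+(u\mu)_x=0$. Fix $\psi^\pm\in C^\infty(\mathbb{R})$ with $\psi^++\psi^-\equiv1$, $0\le\psi^\pm\le1$, $\operatorname{supp}\psi^-\subset(-\infty,1)$, $\operatorname{supp}\psi^+\subset(-1,\infty)$. $E_1=\{\bar f+a\psi^+:\bar f\in H^1,a\in\mathbb{R}\}$, $E_2=\{\bar f+a\psi^++b\psi^-:\bar f\in H^1,a,b\in\mathbb{R}\}$; $E_1^0,E_2^0$ analogously with $\bar f\in L^2$, normed by $(\|\bar f\|_{L^2}^2+a^2)^{1/2}$ resp. $(\|\bar f\|_{L^2}^2+a^2+b^2)^{1/2}$. $\mathcal{D}$: pairs $(u,\mu)$, $u\in E_2$, $\mu$ positive finite Radon measure, $\mu((-\infty,\cdot))\in E_1^0$, $d\mu_{\rm ac}=u_x^2dx$. A weak conservative solution with initial data in $\mathcal{D}$ is a pair $(u,\mu)$ with: (i) $u(t,\cdot)\in E_2$; (ii) $\mu(t,(-\infty,\cdot))\in E_1^0$, $d\mu_{\rm ac}(t)=u_x^2(t,\cdot)dx$; (iii) for all $\phi\in C_c^\infty([0,\infty)\times\mathbb{R})$: $\int_0^\infty\!\int[u\phi_t+\tfrac12u^2\phi_x+\tfrac14(\int_{-\infty}^xd\mu(t)-\int_x^\infty d\mu(t))\phi]dxdt=-\int u\phi|_{t=0}dx$ and $\int_0^\infty\!\int(\phi_t+u\phi_x)d\mu(t)dt=-\int\phi|_{t=0}d\mu(0)$;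 (iv) for every $T>0$, $u$ Hölder continuous on $[0,T]\times\mathbb{R}$ and $t\mapsto u(t,\cdot)$ Lipschitz $[0,T]\to E_2^0$; (v) for a.e. $t$, $\mu(t)$ absolutely continuous with density $u_x^2(t,\cdot)$; (vi) $t\mapsto\mu(t)$ weakly continuous. $C=\mu(t,\mathbb{R})$ (independent of $t$). $K(x)=(1+x^2)^{-n}$, $p(t,x)=\int K(x-y)d\mu(t,y)$, $B=\int_{\mathbb{R}}p(t,x)dx$ (independent of $t$), $G(t,x)=\int_{-\infty}^xp(t,y)dy+\mu(t,(-\infty,x))$, $\chi(t,\eta)=\sup\{x\mid G(t,x)<\eta\}$ for $\eta\in[0,B+C]$, $\mathcal{U}(t,\eta)=u(t,\chi(t,\eta))$, $\mathcal{P}(t,\eta)=p(t,\chi(t,\eta))$; $\chi_\eta$ is the a.e. derivative of the nondecreasing function $\chi(t,\cdot)$. *)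

(* Defs.v *)
From HB Require Import structures.
From mathcomp Require Import all_boot all_order all_algebra.
From mathcomp Require Import all_classical all_reals all_analysis.
Set Implicit Arguments. Unset Strict Implicit. Unset Printing Implicit Defensive.
Import Order.TTheory GRing.Theory Num.Theory.
Import numFieldNormedType.Exports.
Local Open Scope classical_set_scope.
Local Open Scope ring_scope.

Section HS.
Context {R : realType}.
Local Notation lam := (@lebesgue_measure R).
Local Notation meas := {measure set (measurableTypeR R) -> \bar R}.

Definition smooth_fam (F : nat -> R -> R) : Prop :=
  forall (k : nat) (x : R), is_derive x 1 (F k) (F k.+1 x).

Definition smooth (f : R -> R) : Prop :=
  exists F : nat -> R -> R, F 0%N = f /\ smooth_fam F.

Definition testfun1 (F : nat -> R -> R) : Prop :=
  smooth_fam F /\ exists M : R, forall x, M < `|x| -> F 0%N x = 0.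

(** Test functions C_c^infty([0,oo) x R): smooth functions on R^2 with bounded
    support (restricted to t >= 0 in the integrals); F i j = d_t^i d_x^j phi,
    all partial derivatives exist and are jointly continuous. *)
Definition testfun2 (F : nat -> nat -> R -> R -> R) : Prop :=
  (forall (i j : nat) (t x : R), is_derive t 1 (fun s => F i j s x) (F i.+1 j t x)) /\
  (forall (i j : nat) (t x : R), is_derive x 1 (F i j t) (F i j.+1 t x)) /\
  (forall i j, continuous (fun z : R * R => F i j z.1 z.2)) /\
  exists M : R, forall t x, M < `|t| + `|x| -> F 0%N 0%N t x = 0.

Definition L2 (f : R -> R) : Prop :=
  measurable_fun setT f /\ (\int[lam]_x ((f x) ^+ 2)%:E < +oo)%E.

Definition L2norm2 (f : R -> R) : \bar R := (\int[lam]_x ((f x) ^+ 2)%:E)%E.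

Definition weak_deriv (f g : R -> R) : Prop :=
  forall F, testfun1 F ->
    (\int[lam]_x (f x * F 1%N x)%:E = - \int[lam]_x (g x * F 0%N x)%:E)%E.

Definition H1 (f : R -> R) : Prop := L2 f /\ exists g, L2 g /\ weak_deriv f g.

Definition psi_pair (psip psim : R -> R) : Prop :=
  smooth psip /\ smooth psim /\ (forall x, psip x + psim x = 1) /\
  (forall x, 0 <= psip x <= 1) /\ (forall x, 0 <= psim x <= 1) /\
  (exists c, c < 1 /\ forall x, c <= x -> psim x = 0) /\
  (exists c, -1 < c /\ forall x, x <= c -> psip x = 0).

Definition inE1 (psip : R -> R) (v : R -> R) : Prop :=
  exists fb a, H1 fb /\ forall x, v x = fb x + a * psip x.
Definition inE2 (psip psim : R -> R) (v : R -> R) : Prop :=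
  exists fb a b, H1 fb /\ forall x, v x = fb x + a * psip x + b * psim x.
Definition inE1_0 (psip : R -> R) (v : R -> R) : Prop :=
  exists fb a, L2 fb /\ forall x, v x = fb x + a * psip x.

Definition cdf (m : meas) (x : R) : R := fine (m `]-oo, x[%classic).

Definition ac_part_density (m : meas) (g : R -> R) : Prop :=
  exists nu : meas,
    (exists N, measurable N /\ lam N = 0%E /\ nu (~` N) = 0%E) /\
    forall A, measurable A -> m A = (\int[lam]_(x in A) ((g x) ^+ 2)%:E + nu A)%E.

Definition weak_conservative_solution (psip psim : R -> R)
    (u : R -> R -> R) (ux : R -> R -> R) (mu : R -> meas) : Prop :=
  (forall t, 0 <= t -> inE2 psip psim (u t)) /\
  (forall t, 0 <= t -> measurable_fun setT (ux t) /\
     (forall M : R, lam.-integrable `[-M, M]%classic (EFin \o ux t)) /\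
     weak_deriv (u t) (ux t)) /\
  (forall t, 0 <= t -> (mu t setT < +oo)%E /\ inE1_0 psip (cdf (mu t)) /\
     ac_part_density (mu t) (ux t)) /\
  (forall F, testfun2 F ->
     (\int[lam]_(t in `[0%R, +oo[%classic) \int[lam]_x
        (u t x * F 1%N 0%N t x + 2^-1 * (u t x) ^+ 2 * F 0%N 1%N t x
         + 4^-1 * (fine (mu t `]-oo, x[%classic) - fine (mu t `]x, +oo[%classic)) * F 0%N 0%N t x)%:E
      = - \int[lam]_x (u 0%R x * F 0%N 0%N 0%R x)%:E)%E /\
     (\int[lam]_(t in `[0%R, +oo[%classic) \int[mu t]_x
        (F 1%N 0%N t x + u t x * F 0%N 1%N t x)%:E
      = - \int[mu 0%R]_x (F 0%N 0%N 0%R x)%:E)%E) /\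
  (forall T, 0 < T ->
     (exists alpha L : R, 0 < alpha <= 1 /\ 0 <= L /\
        forall s t x y, 0 <= s <= T -> 0 <= t <= T ->
          `|u t x - u s y| <= L * (`|t - s| + `|x - y|) `^ alpha) /\
     (exists L : R, forall s t, 0 <= s <= T -> 0 <= t <= T ->
        exists fb a b, L2 fb /\
          (forall x, u t x - u s x = fb x + a * psip x + b * psim x) /\
          (L2norm2 fb + (a ^+ 2 + b ^+ 2)%:E <= ((L * `|t - s|) ^+ 2)%:E)%E)) /\
  {ae lam, forall t, 0 <= t -> forall A, measurable A ->
     mu t A = (\int[lam]_(x in A) ((ux t x) ^+ 2)%:E)%E} /\
  (forall f : R -> R, continuous f -> (exists M, forall x, `|f x| <= M) ->
     {within `[0%R, +oo[%classic, continuous (fun t => fine (\int[mu t]_x (f x)%:E))}).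

Definition Kn (n : nat) (x : R) : R := (1 + x ^+ 2) ^- n.

Definition pfun (n : nat) (mu : R -> meas) (t x : R) : R :=
  fine (\int[mu t]_y (Kn n (x - y))%:E).

(** B and C (independent of t; taken at t = 0) *)
Definition Cconst (mu : R -> meas) : R := fine (mu 0 setT).
Definition Bconst (n : nat) (mu : R -> meas) : R :=
  fine (\int[lam]_x (pfun n mu 0 x)%:E).

Definition BCconst (n : nat) (mu : R -> meas) : R := Bconst n mu + Cconst mu.

Definition Gfun (n : nat) (mu : R -> meas) (t x : R) : R :=
  fine (\int[lam]_(y in `]-oo, x[%classic) (pfun n mu t y)%:E) + fine (mu t `]-oo, x[%classic).

Definition chi (n : nat) (mu : R -> meas) (t eta : R) : R :=
  sup [set x | Gfun n mu t x < eta].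

Definition Ufun (n : nat) (u : R -> R -> R) (mu : R -> meas) (t eta : R) : R :=
  u t (chi n mu t eta).
Definition Pfun (n : nat) (mu : R -> meas) (t eta : R) : R :=
  pfun n mu t (chi n mu t eta).

(** h, for a given version chie of the a.e. derivative chi_eta *)
Definition hfun (n : nat) (u : R -> R -> R) (mu : R -> meas)
    (chie : R -> R -> R) (t eta : R) : R :=
  Ufun n u mu t eta * Pfun n mu t eta -
  fine (\int[lam]_(e in `[0%R, BCconst n mu]%classic)
     (Ufun n u mu t e * Kn n (chi n mu t eta - chi n mu t e)
        * (1 - Pfun n mu t e * chie t e))%:E).

End HS.

(* Main.v *)
(* A solution transports its energy along characteristics: testing the second
   weak equation against rho(t) theta(x - v t) shows that the distribution
   functions F(t,.) of mu(t) satisfy F(s, y) <= F(t, y + v (t - s)) whenever the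
   speed u is below v next to the line through y (and conversely), so that their
   quantiles X(t, m) satisfy X(t) - X(s) = u(s, X(s)) (t - s) + o(t - s) uniformly
   in m.  Since p and its primitive P are integrals over m of K(x - X) and
   W(x - X) with W' = K, the function G = P + F satisfies
     G(t + k, y + u k +- o(k)) >=, <= G(t, y) + k h +- o(k),
   h = u p - int u K dmu, and comparing quantiles yields
   chi_t = u - h chi_eta at every point where chi(t,.) is differentiable, together
   with the bound |chi(t, .) - chi(s, .)| <= |u|_oo |t - s|.  The function
   P(chi) is nondecreasing and 1-Lipschitz in eta, hence is the integral of its
   derivative p(chi) chi_eta; therefore mu(t) is the image by chi(t,.) of
   (1 - p(chi) chi_eta) d eta, which is the formula for h of the statement.
   Finally |x|^gamma is integrable for mu(0) + p(0, x) dx, whose quantile function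
   is chi(0,.), and dominated convergence gives the L^gamma statements. *)
Require Import Defs.
From HB Require Import structures.
From mathcomp Require Import all_boot all_order all_algebra.
From mathcomp Require Import all_classical all_reals all_analysis.
From mathcomp Require Import measurable_realfun ring lra.
Set Implicit Arguments. Unset Strict Implicit. Unset Printing Implicit Defensive.
Import Order.TTheory GRing.Theory Num.Theory.
Import numFieldNormedType.Exports.
Import HBNNSimple.
Local Open Scope classical_set_scope.
Local Open Scope ring_scope.
Local Notation cdf := Defs.cdf.

(** * Integrals and derivatives on the line *)

(** Two obstacles shape the argument. The speed [u] is only Hölder continuous, so the equation x' =
    u(t, x) may have several solutions through one point; the quantiles of [mu t] single out one
    curve for each mass level, without solving that equation. Moreover, measurability in t of the
    inner integrals of the weak equation is never established: these integrals are only compared,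
    for each t, with an explicit continuous function of t, which is why the integral lemmas just
    below carry no measurability assumption on the integrand. All estimates are pairs of one-sided
    inequalities between nondecreasing functions with a small shift of the argument. Such
    inequalities pass to quantiles even where [mu t] has atoms, and a sign [sg] or the sign of t - s
    lets one proof serve both directions. The remainder o(t - s) has to be uniform in the mass
    level, because P integrates over all levels; the uniformity comes from the uniform continuity of
    [u] on the strip [0, T] x R together with its boundedness. *)

Lemma le_integral_nomeas d (T : measurableType d) (R : realType)
    (m : {measure set T -> \bar R}) (D : set T) (f g : T -> \bar R) :
  (forall x, D x -> (f x <= g x)%E) ->
  (\int[m]_(x in D) f x <= \int[m]_(x in D) g x)%E.
Proof.
move=> fg.
have fgD x : ((f \_ D) x <= (g \_ D) x)%E.
  by rewrite !patchE; case: ifPn => // /set_mem /fg.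
rewrite /integral; apply: leeB; apply: ereal_sup_le => _ [h /= hf <-];
  exists h => //= x; apply: (le_trans (hf x)).
  by rewrite !funeposE ge_max !le_max lexx orbT fgD.
by rewrite !funenegE ge_max !le_max lexx orbT leeN2 fgD.
Qed.

(** The integral is a supremum over simple functions below the integrand. Cutting such a function
    off on the null set [N] keeps its integral and leaves it below the integrand restricted to the
    complement of [N]. *)
Lemma ge0_integral_setD_null_nomeas d (T : measurableType d) (R : realType)
    (m : {measure set T -> \bar R}) (D N : set T) (f : T -> \bar R) :
  measurable N -> m N = 0%E -> (forall x, D x -> (0 <= f x)%E) ->
  (\int[m]_(x in D) f x = \int[m]_(x in D `\` N) f x)%E.
Proof.
move=> mN N0 f0; rewrite !ge0_integralE//; last by move=> x [Dx _]; exact: f0.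
apply/eqP; rewrite eq_le; apply/andP; split; last first.
  apply: ereal_sup_le => _ [h /= hf <-]; exists h => //= x; apply: (le_trans (hf x)); rewrite !patchE.
  case: ifPn => [/set_mem[Dx _]|_]; first by rewrite (mem_set Dx).
  by case: ifPn => // /set_mem /f0.
apply: ge_ereal_sup => _ [h /= hf <-].
have mNC : measurable (~` N) by exact: measurableC.
rewrite -integralT_nnsfun.
rewrite (@ge0_negligible_integral _ _ _ m setT N)//; last 2 first.
- exact/measurable_EFinP.
- by move=> x _; rewrite lee_fin.
rewrite setTD integral_nnsfun//.
apply: ereal_sup_ubound; exists (proj_nnsfun h mNC) => //=; last first.
  by congr sintegral; apply/funext => x; rewrite mrestrict.
move=> x; have := hf x; rewrite !patchE mindicE in_setD in_setC.
case: (x \in N) => /=; rewrite ?andbF ?mulr0// ?andbT ?mulr1//.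
Qed.

Lemma ae_eq_integral_nomeas d (T : measurableType d) (R : realType)
    (m : {measure set T -> \bar R}) (D N : set T) (f g : T -> \bar R) :
  measurable N -> m N = 0%E ->
  (forall x, D x -> ~ N x -> f x = g x) ->
  (\int[m]_(x in D) f x = \int[m]_(x in D) g x)%E.
Proof.
move=> mN N0 fg; rewrite integralE [RHS]integralE.
have H (F G : T -> \bar R) : (forall x, (0 <= F x)%E) ->
    (forall x, (0 <= G x)%E) -> (forall x, D x -> ~ N x -> F x = G x) ->
    (\int[m]_(x in D) F x = \int[m]_(x in D) G x)%E.
  move=> F0 G0 FG; rewrite (@ge0_integral_setD_null_nomeas _ _ _ m D N)//.
  rewrite [RHS](@ge0_integral_setD_null_nomeas _ _ _ m D N)//.
  by apply: eq_integral => x /set_mem[Dx Nx]; exact: FG.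
congr (_ - _)%E; apply: H => // x Dx Nx.
  by rewrite !funeposE fg.
by rewrite !funenegE fg.
Qed.

(** * Translation invariance of Lebesgue measure *)

Section lebesgue_translation.
Context {R : realType}.
Local Notation lam := (@lebesgue_measure R).

Lemma measurable_addr (c : R) :
  measurable_fun setT ((fun x : R => x + c) : measurableTypeR R -> measurableTypeR R).
Proof. by apply: measurable_funD => //; exact: measurable_cst. Qed.

Lemma lebesgue_measure_shift (c : R) (A : set R) : measurable A ->
  pushforward lam ((fun x : R => x + c) : measurableTypeR R -> measurableTypeR R) A
  = lam A.
Proof.
move=> mA; apply/esym.
pose m' := pushforward lam
  ((fun x : R => x + c) : measurableTypeR R -> measurableTypeR R).
have mm := measurable_addr c.
apply: (@lebesgue_measure_unique R m') => //= _ [[a b]] _ <-.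
rewrite /m' /pushforward.
rewrite (_ : _ @^-1` _ = `](a - c), (b - c)]%classic); last first.
  by apply/seteqP; split => x /=; rewrite !in_itv /= ltrBlDr lerBrDr.
rewrite !lebesgue_measure_itv/= !lte_fin ltrD2r; case: ifP => // _.
by rewrite -EFinB; congr EFin; ring.
Qed.

Lemma ge0_integral_shift (c : R) (f : R -> \bar R) (A : set R) :
  measurable A -> measurable_fun A f -> (forall x, A x -> (0 <= f x)%E) ->
  (\int[lam]_(x in A) f x = \int[lam]_(x in [set x | A (x + c)%R]) f (x + c)%R)%E.
Proof.
move=> mA mf f0.
have := @ge0_integral_pushforward _ _ _ _ R _ (measurable_addr c) lam A f mA mf.
move=> <-; last by move=> y /set_mem; exact: f0.
apply: eq_measure_integral => [|mm B mB _]; first exact: measurable_addr.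
by have := @lebesgue_measure_shift c B mB; rewrite /= /pushforward => ->.
Qed.
End lebesgue_translation.

(** * Measures determined by rays and weighted image measures *)

Section measures_on_the_line.
Context {R : realType}.
Local Notation lam := (@lebesgue_measure R).
Local Notation meas := {measure set (measurableTypeR R) -> \bar R}.

Lemma measure_eq_rays (m1 m2 : meas) :
  (forall x : R, m1 `]-oo, x[%classic = m2 `]-oo, x[%classic) ->
  (forall x : R, (m1 `]-oo, x[%classic < +oo)%E) ->
  forall A, measurable A -> m1 A = m2 A.
Proof.
move=> m12 m1oo A mA.
apply: (@measure_unique _ R (measurableTypeR R) (@RGenInftyO.G R)
  (fun k => `]-oo, k%:R[%classic) _ _ _ _ m1 m2) => //.
- exact: RGenInftyO.measurableE.
- move=> _ _ [x ->] [y ->]; exists (Num.min x y).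
  by apply/seteqP; split => z /=; rewrite !in_itv /= lt_min => /andP.
- by move=> k; exists k%:R.
- apply/seteqP; split => // x _.
  by exists (Num.truncn x).+1 => //=; rewrite in_itv /= truncnS_gt.
- by move=> B [x ->]; exact: m12.
Qed.

End measures_on_the_line.

Section weighted_pushforward.
Context d d' (T : measurableType d) (U : measurableType d') (R : realType).
Variables (lam : {measure set T -> \bar R}) (w : T -> R) (g : T -> U).

(** The measure is the image under [g] of the measure with density [w]. The change of variables is
    checked on simple functions and extended by monotone convergence. *)
Lemma weighted_pushforward :
  measurable_fun setT w -> measurable_fun setT g -> (forall x, 0 <= w x) ->
  exists m : {measure set U -> \bar R},
    (forall A, measurable A ->
      (m A = \int[lam]_(x in g @^-1` A) (w x)%:E)%E) /\
    (forall f : U -> \bar R, measurable_fun setT f -> (forall x, 0 <= f x)%E ->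
      (\int[m]_x f x = \int[lam]_x (f (g x) * (w x)%:E))%E).
Proof.
move=> mw mg w0.
have mgA (A : set U) : measurable A -> measurable (g @^-1` A).
  by move=> mA; rewrite -[X in measurable X]setTI; exact: mg.
pose m0 : set U -> \bar R :=
  fun A => (\int[lam]_(x in g @^-1` A) (w x)%:E)%E.
have m00 : m0 set0 = 0%E by rewrite /m0 preimage_set0 integral_set0.
have m0_ge0 A : (0 <= m0 A)%E.
  by apply: integral_ge0 => x _; rewrite lee_fin.
have m0_sigma : semi_sigma_additive m0.
  move=> /= F mF tF mUF; rewrite /m0; apply: cvg_toP.
    apply: ereal_nondecreasing_is_cvgn => i j ij.
    apply: lee_sum_nneg_natr => // k _ _; apply: integral_ge0 => /= x Fkx.
    by rewrite lee_fin.
  rewrite preimage_bigcup ge0_integral_bigcup//=.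
  - by move=> i; exact/mgA/mF.
  - exact/measurable_funTS/measurable_EFinP.
  - by move=> x _; rewrite lee_fin.
  - apply/trivIsetP => /= i j _ _ ij; rewrite -preimage_setI.
    by move/trivIsetP : tF => /(_ _ _ _ _ ij) ->//; rewrite preimage_set0.
have [m mE] : exists m : {measure set U -> \bar R}, forall A, m A = m0 A.
  pose m1 : {measure set U -> \bar R} :=
    HB.pack m0 (isMeasure.Build _ _ _ m0 m00 m0_ge0 m0_sigma).
  by exists m1.
exists m; split => [A _|f mf f0]; first exact: mE.
pose f_ := nnsfun_approx measurableT mf.
have f_f x : EFin \o f_ ^~ x @ \oo --> f x.
  by apply: cvg_nnsfun_approx => // *; apply: f0.
transitivity (limn (fun n => \int[m]_x (f_ n x)%:E)%E).
  rewrite -monotone_convergence//.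
  - by apply: eq_integral => y _; apply/esym/cvg_lim => //; exact: f_f.
  - by move=> n; exact/measurable_EFinP/measurable_funP.
  - by move=> n y _; rewrite lee_fin.
  - by move=> y _ i j ij; rewrite lee_fin; exact/lefP/nd_nnsfun_approx.
transitivity (limn (fun n => \int[lam]_x ((f_ n (g x))%:E * (w x)%:E))%E); last first.
  rewrite -monotone_convergence//.
  - apply: eq_integral => y _; apply/cvg_lim => //.
    by apply: cvgeZr => //; exact: f_f.
  - move=> n; apply/measurable_EFinP/measurable_funM => //.
    by apply: measurableT_comp.
  - by move=> n y _; rewrite -EFinM lee_fin mulr_ge0.
  - move=> y _ i j ij; rewrite -!EFinM lee_fin ler_wpM2r//.
    exact/lefP/nd_nnsfun_approx.
congr (limn _); apply/funext => n.
rewrite integralT_nnsfun sintegralE.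
transitivity (\int[lam]_x (\sum_(k \in range (f_ n))
    ((k * \1_(f_ n @^-1` [set k]) (g x)) * w x)%:E)%E)%E; last first.
  apply: eq_integral => x _; rewrite -EFinM fimfunE.
  by rewrite fsumEFin// mulr_fsuml.
rewrite ge0_integral_fsum//.
- apply: eq_fsbigr => r _; rewrite mE /m0.
  rewrite integral_mkcond.
  (* A scalar leaves the integral only when it is nonnegative; a negative value has an empty
     preimage under a nonnegative simple function, so both sides are 0. *)
  have [r0|r0] := ltP r 0.
    rewrite preimage_nnfun0// preimage_set0 /= ?mule0.
    rewrite [in X in (r%:E * X)%E]/patch.
    rewrite (eq_integral (fun=> 0%E)); last first.
      by move=> x _; case: ifPn => // /set_mem.
    rewrite integral0 mule0 integral0_eq// => x _.
    by rewrite indicE in_set0 mulr0 mul0r.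
  rewrite -ge0_integralZl//.
  + apply: eq_integral => x _; rewrite patchE indicE.
    rewrite [in RHS]EFinM -/(preimage _ _).
    have -> : (x \in g @^-1` (f_ n @^-1` [set r])) = (g x \in f_ n @^-1` [set r]).
      by apply/idP/idP => /set_mem h; apply/mem_set.
    by case: ifPn => _; rewrite ?mulr1// mulr0 mul0e mule0.
  + apply/(measurable_restrictT _ _).1 => //.
      exact: mgA.
    exact/measurable_funTS/measurable_EFinP.
  + by move=> x _; rewrite patchE; case: ifPn => // _; rewrite lee_fin.
- move=> k; apply/measurable_EFinP; apply: measurable_funM => //.
  apply: measurable_funM => //.
  by apply: (measurableT_comp (measurable_indic _)).
- move=> k x _; rewrite lee_fin mulr_ge0//.
  by have := nnfun_muleindic_ge0 (f_ n) k (g x); rewrite -EFinM lee_fin.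
Qed.
End weighted_pushforward.

(** Rays determine a finite measure, so it suffices to test the image on the sets where [g] is below
    x. This serves two parametrisations of the same measure: by its quantiles, with weight 1, and by
    the energy coordinate, with weight 1 - p(chi) chi_eta. *)
Lemma finite_measure_weighted_image (R : realType)
    (nu : {measure set (measurableTypeR R) -> \bar R}) (w g : R -> R) :
  measurable_fun setT w -> measurable_fun setT g -> (forall x, 0 <= w x) ->
  (nu setT < +oo)%E ->
  (forall x : R, (\int[@lebesgue_measure R]_(e in [set e | (g e < x)%R]) (w e)%:E
                  = nu `]-oo, x[%classic)%E) ->
  forall f : R -> \bar R, measurable_fun setT f ->
    (\int[nu]_x f x = \int[@lebesgue_measure R]_x (f (g x) * (w x)%:E))%E.
Proof.
move=> mw mg w0 nuoo nuE.
have [m [mE mint]] := @weighted_pushforward _ _ _ (measurableTypeR R) R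
  (@lebesgue_measure R) w g mw mg w0.
have mnu : forall A, measurable A -> m A = nu A.
  apply: measure_eq_rays => x; rewrite mE//.
    by rewrite -nuE; congr integral; apply/seteqP; split => e /=; rewrite in_itv.
  rewrite (_ : _ @^-1` _ = [set e | g e < x]); last first.
    by apply/seteqP; split => e /=; rewrite in_itv.
  by rewrite nuE; apply: le_lt_trans nuoo; apply: le_measure; rewrite ?inE.
have H f : measurable_fun setT f -> (forall x, 0 <= f x)%E ->
    (\int[nu]_x f x = \int[@lebesgue_measure R]_x (f (g x) * (w x)%:E))%E.
  move=> mf f0; rewrite -mint//.
  by apply: eq_measure_integral => A mA _; rewrite mnu.
move=> f mf; rewrite integralE H//; last exact: measurable_funepos.
rewrite H//; last exact: measurable_funeneg.
rewrite [RHS]integralE; congr (_ - _)%E; apply: eq_integral => x _.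
  by rewrite funeposE [RHS]funeposE maxe_pMl ?lee_fin// mul0e.
by rewrite funenegE [RHS]funenegE maxe_pMl ?lee_fin// mul0e mulNe.
Qed.

Lemma bounded_fun_integrable d (T : measurableType d) (R : realType)
    (m : {measure set T -> \bar R}) (D : set T) (f : T -> R) (M : R) :
  measurable D -> (m D < +oo)%E -> measurable_fun D f ->
  (forall x, D x -> `|f x| <= M) -> m.-integrable D (EFin \o f).
Proof.
move=> mD mDoo mf fM; apply: measurable_bounded_integrable => //.
exists M; split; [exact: num_real|move=> N MN x Dx].
by apply: (le_trans (fM x Dx)); exact: ltW.
Qed.

(** * Pointwise derivatives and primitives *)

Section derivatives.
Context {R : realType}.

(** Clearing the denominator gives a bound that also holds at h = 0; derivatives are used and proved
    in this form below. *)
Lemma is_derive_epsP (f : R -> R) (x l : R) :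
  is_derive x 1 f l <->
  forall e : R, 0 < e -> exists2 d : R, 0 < d & forall h : R, `|h| < d ->
    `|f (x + h) - f x - l * h| <= e * `|h|.
Proof.
have qE (h : R) : h != 0 ->
    f (x + h) - f x - l * h = h * (h^-1 * (f (h + x) - f x) - l).
  by move=> h0; rewrite [h + x]addrC mulrBr mulrA divff// mul1r [h * l]mulrC.
split=> [[df dfl] e e0|H].
  have : h^-1 *: (f (h *: 1 + x) - f x) @[h --> 0^'] --> l.
    by move: df => /cvg_ex[l' dl']; rewrite -dfl /derive (cvg_lim _ dl').
  move=> /cvgrPdist_le /(_ _ e0) /nbhs_ballP[d /= d0 dP].
  exists d => // h hd; have [->|h0] := eqVneq h 0.
    by rewrite addr0 subrr mulr0 subrr normr0 mulr0.
  rewrite qE// normrM mulrC ler_wpM2r//.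
  have := dP h; rewrite /ball /= sub0r normrN => /(_ hd h0).
  by rewrite distrC /= [_ *: 1]mulr1.
have cl : h^-1 *: (f (h *: 1 + x) - f x) @[h --> 0^'] --> l.
  apply/cvgrPdist_le => e e0; have [d d0 dP] := H e e0.
  apply/nbhs_ballP; exists d => //= h; rewrite /ball /= sub0r normrN => hd h0.
  have := dP h hd; rewrite qE// normrM mulrC ler_pM2r ?normr_gt0//.
  by rewrite distrC [_ *: 1]mulr1.
by apply: DeriveDef; [apply/cvg_ex; exists l|exact: cvg_lim].
Qed.

Lemma is_derive_continuous (f : R -> R) (x l : R) :
  is_derive x 1 f l -> {for x, continuous f}.
Proof. by case=> d _; exact/differentiable_continuous/derivable1_diffP. Qed.

Lemma is_derive_shift_arg (f : R -> R) (x c l : R) :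
  is_derive (x + c) 1 f l -> is_derive x 1 (fun y => f (y + c)) l.
Proof.
move=> /is_derive_epsP H; apply/is_derive_epsP => e /H[d d0 dP].
by exists d => // h /dP; rewrite (addrAC x c h).
Qed.

Lemma MVT_is_derive (f df : R -> R) (a b : R) : a < b ->
  (forall x : R, a <= x <= b -> is_derive x 1 f (df x)) ->
  exists2 c : R, a < c < b & f b - f a = df c * (b - a).
Proof.
move=> ab fdf.
have [x||c] := @MVT R f df a b ab.
- by rewrite in_itv /= => /andP[/ltW ax /ltW xb]; apply: fdf; rewrite ax.
- apply: continuous_in_subspaceT => x; rewrite inE /= in_itv /= => axb.
  exact: is_derive_continuous (fdf x axb).
by rewrite in_itv /= => cab ?; exists c.
Qed.

Lemma is_derive_primitive (f : R -> R) :
  (@lebesgue_measure R).-integrable setT (EFin \o f) -> continuous f ->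
  forall x : R, is_derive x 1
    (fun x => \int[@lebesgue_measure R]_(t in `]-oo, x]%classic) f t) (f x).
Proof.
move=> intf cf x.
have x1 : x < x + 1 by rewrite ltrDl.
have intfx : (@lebesgue_measure R).-integrable
  [set` Interval -oo%O (BRight (x + 1))] (EFin \o f) by exact: integrableS intf.
have [d dE] := continuous_FTC1 x1 intfx (ltNyr _) (cf x).
by apply: DeriveDef; [exact: d|rewrite -derive1E; exact: dE].
Qed.

Lemma integral_is_derive (f F : R -> R) (a b : R) : a < b -> continuous f ->
  (forall x, a <= x <= b -> is_derive x 1 F (f x)) ->
  (\int[@lebesgue_measure R]_(x in `[a, b]) (f x)%:E = (F b - F a)%:E)%E.
Proof.
move=> ab cf dF; rewrite EFinB; apply: continuous_FTC2 => //.
- exact: continuous_subspaceT.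
- split.
  + by move=> x; rewrite in_itv /= => /andP[/ltW ax /ltW xb];
      have [] := dF x _; rewrite ?ax.
  + apply: cvg_at_right_filter.
    by apply: is_derive_continuous (f a) _; apply: dF; rewrite lexx ltW.
  + apply: cvg_at_left_filter.
    by apply: is_derive_continuous (f b) _; apply: dF; rewrite lexx ltW.
- move=> x; rewrite in_itv /= => /andP[/ltW ax /ltW xb].
  by have [_ dE] : is_derive x 1 F (f x) by [apply: dF; rewrite ax]; rewrite derive1E.
Qed.
End derivatives.

(* Difference quotients of a 1-Lipschitz function converge boundedly, which
   replaces the theory of absolutely continuous functions. *)
Lemma lipschitz_FTC (R : realType) (f g : R -> R) (a b : R) (N : set R) :
  a <= b -> (forall x y, x <= y -> 0 <= f y - f x <= y - x) ->
  measurable N -> @lebesgue_measure R N = 0%E ->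
  (forall x, a < x < b -> ~ N x -> is_derive x 1 f (g x)) ->
  (\int[@lebesgue_measure R]_(x in `]a, b[%classic) (g x)%:E = (f b - f a)%:E)%E.
Proof.
rewrite le_eqVlt => /orP[/eqP <-|ab] flip mN N0 dfg.
  by rewrite set_itvoo0 integral_set0 subrr.
have fnd : {homo f : x y / x <= y}.
  by move=> x y /flip /andP[]; rewrite subr_ge0.
have flipn x y : `|f x - f y| <= `|x - y|.
  have [xy|/ltW xy] := leP x y; have /andP[h1 h2] := flip _ _ xy.
    by rewrite distrC ger0_norm// distrC ger0_norm// subr_ge0.
  by rewrite ger0_norm// ger0_norm// subr_ge0.
have cf : continuous f.
  move=> x; apply/cvgrPdist_le => e e0; apply/nbhs_ballP; exists e => //= y xy.
  by rewrite (le_trans (flipn _ _))// ltW.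
pose h j : R := j.+1%:R^-1.
have h0 j : 0 < h j by rewrite invr_gt0.
have h1 j : h j <= 1 by rewrite invf_le1// ler1n.
pose q j x := (f (x + h j) - f x) / h j.
have q01 j x : 0 <= q j x <= 1.
  have xh : x <= x + h j by rewrite lerDl ltW.
  have /andP[f1 f2] := flip _ _ xh.
  rewrite /q divr_ge0 ?(ltW (h0 j))//= ler_pdivrMr// mul1r (le_trans f2)//.
  by rewrite addrAC subrr add0r.
have cq j : continuous (q j).
  move=> x; apply: cvgM; last exact: cvg_cst.
  apply: cvgB; last exact: cf.
  apply: (@continuous_comp _ _ _ (fun x => x + h j) f); last exact: cf.
  by apply: cvgD; [exact: cvg_id|exact: cvg_cst].
have h_cvg : h @ \oo --> (0 : R) by exact: cvg_harmonic.
(* The values of [g] on [N] are arbitrary. Off [N] it is a limit of continuous difference quotients,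
   so this modification is measurable on the interval. *)
pose g' := g \_ (~` N).
have q_cvg x : a < x < b -> ~ N x -> q ^~ x @ \oo --> g' x.
  move=> axb Nx; rewrite /g' patchE mem_set//.
  have /is_derive_epsP dx := dfg x axb Nx.
  apply/cvgrPdist_le => e e0; have [d d0 dP] := dx e e0.
  near=> j; have hd : `|h j| < d.
    near: j; apply: (cvgr0_norm_lt h); first exact: h_cvg.
    by [].
  have := dP _ hd; rewrite distrC /q -ler_pdivrMr ?normr_gt0 ?gt_eqF//.
  rewrite -normf_div mulrBl mulfK ?gt_eqF//.
have mab : measurable `]a, b[%classic by [].
pose lam := @lebesgue_measure R.
have labfin : (lam `]a, b[%classic < +oo)%E.
  by rewrite /lam lebesgue_measure_itv /= lte_fin ab -EFinB ltry.
have mq j : measurable_fun `]a, b[%classic (q j).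
  by apply: measurable_funTS; exact: continuous_measurable_fun.
have mg' : measurable_fun `]a, b[%classic g'.
  apply/measurable_restrict => //; first exact: measurableC.
  apply: (@measurable_fun_cvg _ _ _ _ q).
    by move=> m; apply: measurable_funS (mq m) => // x [].
  move=> x [axb Nx]; have {}axb : a < x < b by move: axb; rewrite /= in_itv.
  by have := q_cvg x axb Nx; rewrite /g' patchE mem_set.
have [|||||_ _] := @dominated_convergence _ _ _ lam `]a, b[%classic mab
  (fun j x => (q j x)%:E) (fun x => (g' x)%:E) (fun=> 1%:E).
- by move=> j; apply/measurable_EFinP; exact: mq.
- by apply/measurable_EFinP; exact: mg'.
- exists N; split => // x /= xq; apply: contrapT => Nx; apply: xq => axb.
  have {}axb : a < x < b by move: axb; rewrite /= in_itv.
  by apply: cvg_EFin; [near=> j|exact: q_cvg].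
- apply: (@bounded_fun_integrable _ (measurableTypeR R) R lam _ (cst 1) 1) => //.
  by move=> x _; rewrite normr1.
- apply: aeW => x j _ /=; rewrite lee_fin ger0_norm; have /andP[] := q01 j x => //.
move=> icvg.
rewrite (@ae_eq_integral_nomeas _ _ _ lam _ N _ (fun x => (g' x)%:E))//; last first.
  by move=> x _ Nx; rewrite /g' patchE mem_set.
apply/esym/(cvg_unique _ _ icvg) => //.
(* Through a primitive of [f], the integral of a difference quotient telescopes to the mean of [f]
   over [b, b + h] minus its mean over [a, a + h]. Starting the primitive at a - 1 makes it
   differentiable at a itself. *)
pose F x := \int[lam]_(t in `[a - 1, x]) f t.
have dF x : a <= x <= b + 1 -> is_derive x 1 F (f x).
  move=> /andP[ax xb].
  have xu : x < b + 2 by lra.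
  have a1x : a - 1 < x by lra.
  have fint : lam.-integrable `[a - 1, b + 2] (EFin \o f).
    apply: continuous_compact_integrable; first exact: segment_compact.
    exact: continuous_subspaceT.
  have [d dE] := continuous_FTC1_closed xu fint a1x (cf x).
  by apply: DeriveDef; [exact: d|rewrite -derive1E; exact: dE].
have dq j : (\int[lam]_(x in `]a, b[) (q j x)%:E =
    (((F (b + h j) - F b) - (F (a + h j) - F a)) / h j)%:E)%E.
  have mqT : measurable_fun setT (EFin \o q j).
    by apply/measurable_EFinP; apply: continuous_measurable_fun; exact: cq.
  rewrite integral_itv_obnd_cbnd; last exact: measurable_funS mqT.
  rewrite integral_itv_bndo_bndc; last exact: measurable_funS mqT.
  have dFh x : a <= x <= b ->
      is_derive x 1 (fun x => (F (x + h j) - F x) / h j) (q j x).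
    move=> /andP[ax xb]; have xh : a <= x + h j <= b + 1.
      by have := h0 j; have := h1 j; lra.
    have hx : a <= x <= b + 1 by lra.
    have d1 := dF _ hx; have d2 := is_derive_shift_arg (dF _ xh).
    have -> : (fun x => (F (x + h j) - F x) / h j) =
      (h j)^-1 \*: ((fun x => F (x + h j)) \- F) :> (R -> R).
      by apply/funext => y /=; rewrite mulrC.
    by apply: is_derive_eq; rewrite /q mulrC.
  rewrite (integral_is_derive ab (cq j) dFh).
  by congr EFin; rewrite -mulrBl; congr (_ / _); ring.
have F_bounds c j : a <= c <= b ->
    f c <= (F (c + h j) - F c) / h j <= f c + h j.
  move=> /andP[ac cb]; have ch : c < c + h j by rewrite ltrDl.
  have [|z /andP[cz zc] ->] := @MVT_is_derive _ F f _ _ ch.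
    by move=> x /andP[cx xc]; apply: dF; have := h1 j; lra.
  rewrite addrAC subrr add0r mulfK ?gt_eqF// fnd ?(ltW cz)//=.
  by have := flip c z (ltW cz); lra.
have dq' : (fun j => \int[lam]_(x in `]a, b[) (q j x)%:E)%E =
    (fun j => (((F (b + h j) - F b) / h j) - ((F (a + h j) - F a) / h j))%:E).
  by apply/funext => j; rewrite dq mulrBl.
rewrite dq'; apply: cvg_EFin; first by near=> j.
apply/cvgrPdist_le => e e0; near=> j.
have ha : a <= a <= b by lra.
have hb : a <= b <= b by lra.
have := F_bounds a j ha; have := F_bounds b j hb.
have he : h j <= e.
  near: j; have /cvgr0Pnorm_le := h_cvg => /(_ _ e0).
  by apply: filterS => j; rewrite ger0_norm// ltW.
by rewrite /= ler_norml; lra.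
Unshelve. all: by end_near. Qed.

(** * Smooth cut-off functions *)

Section smooth_families.
Context {R : realType}.
Implicit Types (x : R) (F G : nat -> R -> R).

Lemma smooth_fam_continuous F k : smooth_fam F -> continuous (F k).
Proof. by move=> sF x; exact: is_derive_continuous (sF k x). Qed.

Lemma is_derive_affine (f df : R -> R) (a b x : R) :
  is_derive (a * x + b) 1 f (df (a * x + b)) ->
  is_derive x 1 (fun x => f (a * x + b)) (a * df (a * x + b)).
Proof.
move=> h.
have h1 : is_derive x (1:R) (fun x => a * x + b) a.
  have -> : (fun x => a * x + b) = (a \*: (@id R)) \+ cst b :> (R -> R) by [].
  by apply: is_derive_eq; rewrite addr0 [LHS]mulr1.
by have := @is_derive1_comp _ f (fun x => a * x + b) x _ _ h h1;
  rewrite mulrC.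
Qed.

Lemma smooth_fam_affine F (a b : R) : smooth_fam F ->
  smooth_fam (fun k x => a ^+ k * F k (a * x + b)).
Proof.
move=> sF k x.
have h := @is_derive_affine (F k) (F k.+1) a b x (sF k (a * x + b)).
have -> : (fun x => a ^+ k * F k (a * x + b)) =
  (a ^+ k) \*: (fun x => F k (a * x + b)) :> (R -> R) by [].
by apply: is_derive_eq; rewrite exprSr -mulrA.
Qed.

Lemma smooth_fam_linear F G (a b : R) : smooth_fam F -> smooth_fam G ->
  smooth_fam (fun k x => a * F k x + b * G k x).
Proof.
move=> sF sG k x.
have -> : (fun x => a * F k x + b * G k x) =
  (a \*: F k) \+ (b \*: G k) :> (R -> R) by [].
have h1 := sF k x; have h2 := sG k x.
by apply: is_derive_eq.
Qed.

(** The i-th derivative of the product of the a-th derivative of the first function and the b-th of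
    the second; unfolding the product rule avoids binomial coefficients. *)
Fixpoint leibniz F G (i a b : nat) (x : R) : R :=
  if i is j.+1 then leibniz F G j a.+1 b x + leibniz F G j a b.+1 x
  else F a x * G b x.

Lemma leibnizP F G i a b x : smooth_fam F -> smooth_fam G ->
  is_derive x 1 (leibniz F G i a b) (leibniz F G i.+1 a b x).
Proof.
move=> sF sG; elim: i a b => [|i IH] a b.
  have h1 := sF a x; have h2 := sG b x.
  have -> : leibniz F G 0 a b = F a * G b :> (R -> R) by [].
  by apply: is_derive_eq; rewrite /= addrC; congr (_ + _); rewrite [LHS]mulrC.
have h1 := IH a.+1 b; have h2 := IH a b.+1.
have -> : leibniz F G i.+1 a b =
  leibniz F G i a.+1 b \+ leibniz F G i a b.+1 :> (R -> R) by [].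
by apply: is_derive_eq.
Qed.

(** For x > 0 the derivative of q(1/x) exp(-1/x) is (1/x)^2 (q - q')(1/x) exp(-1/x), which dictates
    the recursion. *)
Fixpoint flat_poly (k : nat) : {poly R} :=
  if k is j.+1 then 'X^2 * (flat_poly j - (flat_poly j)^`()) else 1.

(* the derivatives of [exp (- 1 / x)], extended by 0 to the left *)
Definition flat (k : nat) (x : R) : R :=
  if 0 < x then (flat_poly k).[x^-1] * expR (- x^-1) else 0.

(** With y = 1/x, a single term y^N / N! of the exponential series, with N the size of [p] plus 2,
    beats the polynomial and leaves y^-2. The square is what makes every derivative of [flat] at 0
    vanish: one factor x remains after division by the increment. *)
Lemma poly_expR_le (p : {poly R}) :
  exists2 c : R, 0 <= c & forall x : R, 0 < x -> x <= 1 ->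
    `|p.[x^-1] * expR (- x^-1)| <= c * x ^+ 2.
Proof.
pose A := \sum_(i < size p) `|p`_i|.
have A0 : 0 <= A by exact: sumr_ge0.
exists (A * (size p).+2`!%:R); first by rewrite mulr_ge0.
move=> x x0 x1; set y := x^-1.
have y1 : 1 <= y by rewrite invf_ge1.
have y0 : 0 < y by exact: lt_le_trans y1.
have hp : `|p.[y]| <= A * y ^+ size p.
  rewrite horner_coef (le_trans (ler_norm_sum _ _ _))// mulr_suml.
  apply: ler_sum => i _; rewrite normrM ler_wpM2l// normrX (ger0_norm (ltW y0)).
  by rewrite ler_weXn2l// ltnW.
have hexp : y ^+ (size p).+2 / (size p).+2`!%:R <= expR y.
  by apply: le_trans (expR_ge1Dxn (size p).+1 (ltW y0)); rewrite lerDr.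
have f0 : 0 < (size p).+2`!%:R :> R by rewrite ltr0n fact_gt0.
have -> : x ^+ 2 = (y ^+ 2)^-1 by rewrite /y exprVn invrK.
rewrite normrM (ger0_norm (expR_ge0 _)) expRN.
rewrite ler_pdivrMr ?expR_gt0// mulrAC ler_pdivlMr ?exprn_gt0//.
rewrite (le_trans (ler_wpM2r _ hp)) ?exprn_ge0 ?(ltW y0)//.
rewrite -mulrA -exprD addn2 -mulrA ler_wpM2l// mulrC -ler_pdivrMr//.
Qed.

Lemma flat_fam : smooth_fam flat.
Proof.
move=> k x; have [x0|x0|->] := ltgtP x 0.
- have -> : flat k.+1 x = 0 by rewrite /flat ltNge (ltW x0).
  apply: (near_eq_is_derive (f := cst 0)).
  near=> y; rewrite /flat ltNge ifN//; apply/negPn/ltW.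
  by near: y; exact: lt_nbhsl.
- have -> : flat k.+1 x = (flat_poly k.+1).[x^-1] * expR (- x^-1).
    by rewrite /flat x0.
  apply: (near_eq_is_derive
    (f := (horner (flat_poly k) \o (fun y => y^-1))
          * (expR \o (fun y => - y^-1)))).
    near=> y; rewrite /flat ifT//; near: y; exact: lt_nbhsr.
  have xn0 : x != 0 by rewrite gt_eqF.
  have h1 : is_derive x 1 (fun y : R => y^-1) (- x ^- 2).
    have := @is_deriveV R id x 1 1 xn0 (is_derive_id _ _).
    by rewrite [_ *: 1]mulr1.
  have h2 : is_derive x 1 (fun y : R => - y^-1) (x ^- 2).
    have h := @is_deriveN _ _ _ (fun y : R => y^-1) x 1 _ h1.
    by rewrite opprK in h.
  have h3 := @is_derive1_comp _ (horner (flat_poly k)) _ x _ _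
    (is_derive_poly _ _) h1.
  have h4 := @is_derive1_comp _ expR _ x _ _ (is_derive_expR _) h2.
  apply: is_derive_eq; rewrite /= !hornerE.
  rewrite -!/(_ * _) /GRing.scale /= exprVn.
  by ring.
have -> : flat k.+1 0 = 0 by rewrite /flat ltxx.
apply/is_derive_epsP => e e0.
have [c c0 cP] := poly_expR_le (flat_poly k).
exists (Num.min 1 (e / (c + 1))); first by rewrite lt_min ltr01 divr_gt0// ltr_wpDl.
move=> h; rewrite lt_min ltr_pdivlMr ?ltr_wpDl// => /andP[h1 he].
rewrite add0r mul0r subr0 {2}/flat ltxx subr0 /flat.
case: ifPn => h0; last by rewrite normr0 mulr_ge0// ltW.
rewrite (le_trans (cP _ h0 _))//; first by rewrite gtr0_norm// in h1; exact: ltW.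
rewrite expr2 mulrA (gtr0_norm h0) ler_pM2r//.
by move: he; rewrite gtr0_norm// mulrDr mulr1 mulrC; lra.
Unshelve. all: by end_near. Qed.

Lemma flat_ge0 x : 0 <= flat 0 x.
Proof. by rewrite /flat; case: ifP => //= _; rewrite hornerC mul1r expR_ge0. Qed.

Lemma flat_gt0 x : 0 < x -> 0 < flat 0 x.
Proof. by rewrite /flat => ->; rewrite /= hornerC mul1r expR_gt0. Qed.

Lemma flat_le1 x : flat 0 x <= 1.
Proof.
rewrite /flat; case: ifPn => //= x0; rewrite hornerC mul1r expR_le1.
by rewrite oppr_le0 invr_ge0 ltW.
Qed.

Lemma flat_eq0 k x : x <= 0 -> flat k x = 0.
Proof. by rewrite /flat ltNge => ->. Qed.

(** The step is the normalised primitive of the bump flat(x) flat(1 - x). Since the bump is at most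
    1, the inverse of its integral bounds the slope. *)
Lemma smooth_step_exists : exists S : nat -> R -> R,
  [/\ smooth_fam S, (forall x, x <= 0 -> S 0 x = 0),
    (forall x, 1 <= x -> S 0 x = 1),
    (forall x, 0 <= S 1 x) &
    (forall x, x <= 0 \/ 1 <= x -> S 1 x = 0) /\
    exists2 B, 0 < B & forall x, S 1 x <= B].
Proof.
pose G : nat -> R -> R := fun k x => (-1) ^+ k * flat k (-1 * x + 1).
have sG : smooth_fam G by exact: smooth_fam_affine flat_fam.
pose b k := leibniz flat G k 0 0.
have sb : smooth_fam b by move=> k x; exact: leibnizP flat_fam sG.
have bE x : b 0%N x = flat 0 x * flat 0 (1 - x).
  by rewrite /b /= /G expr0 mul1r mulN1r addrC.
have b0 x : x <= 0 \/ 1 <= x -> b 0%N x = 0.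
  rewrite bE => -[x0|x1]; first by rewrite flat_eq0// mul0r.
  by rewrite [flat _ (1 - x)]flat_eq0 ?mulr0// subr_le0.
have b_ge0 x : 0 <= b 0%N x by rewrite bE mulr_ge0 ?flat_ge0.
have b_le1 x : b 0%N x <= 1.
  by rewrite bE mulr_ile1 ?flat_ge0 ?flat_le1.
have cb : continuous (b 0%N) by exact: smooth_fam_continuous.
have ib : (@lebesgue_measure R).-integrable setT (EFin \o b 0%N).
  apply: (le_integrable _ _ _ (integrable_indic_itv 0 1 true false)) => //.
    by apply/measurable_EFinP; exact: continuous_measurable_fun.
  move=> x _ /=; rewrite !lee_fin ger0_norm// ger0_norm// indicE.
  case: (boolP (x \in _)) => [_|/negP xn]; first exact: b_le1.
  rewrite b0//; have [x0|x0] := leP x 0; first by left.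
  right; rewrite leNgt; apply/negP => x1; apply: xn.
  by rewrite inE /= in_itv /= !ltW.
have := is_derive_primitive ib cb.
set I := (fun x => Rintegral _ _ _) => dI.
pose c := I 1 - I 0.
have I01 : 0 < c.
  have [z /andP[z0 z1] cE] := MVT_is_derive (@ltr01 R) (fun x _ => dI x).
  by rewrite /c cE subr0 mulr1 bE mulr_gt0// flat_gt0// subr_gt0.
have I0 x : x <= 0 -> I x = I 0.
  rewrite le_eqVlt => /orP[/eqP->//|x0].
  have [z /andP[_ z0]] := MVT_is_derive x0 (fun x _ => dI x).
  rewrite b0 ?mul0r; last by left; exact: ltW.
  by move=> /eqP; rewrite subr_eq0 => /eqP.
have I1 x : 1 <= x -> I x = I 1.
  rewrite le_eqVlt => /orP[/eqP<-//|x1].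
  have [z /andP[z1 _]] := MVT_is_derive x1 (fun x _ => dI x).
  rewrite b0 ?mul0r; last by right; exact: ltW.
  by move=> /eqP; rewrite subr_eq0 => /eqP.
exists (fun k x => if k is j.+1 then c^-1 * b j x else c^-1 * (I x - I 0)).
split=> [[|k] x|x x0|x x1|x|].
- have h := dI x.
  have -> : (fun x => c^-1 * (I x - I 0)) =
    c^-1 \*: (I \- cst (I 0)) :> (R -> R) by [].
  by apply: is_derive_eq; rewrite subr0.
- have h := sb k x.
  have -> : (fun x => c^-1 * b k x) = c^-1 \*: b k :> (R -> R) by [].
  exact: is_derive_eq.
- by rewrite I0// subrr mulr0.
- by rewrite I1// mulVf// gt_eqF.
- by rewrite mulr_ge0// invr_ge0 ltW.
split=> /= [x x01|]; first by rewrite b0// mulr0.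
exists c^-1 => [|x]; first by rewrite invr_gt0.
by rewrite ler_piMr ?b_le1// invr_ge0 ltW.
Qed.

End smooth_families.

(** * Transport of travelling moments *)

Section travelling_test_functions.
Context {R : realType}.
Variables (rho theta : nat -> R -> R) (v : R).

(* The derivative [d_t^i d_x^b] of [rho^(a)(t) theta(x - v t)]. *)
Fixpoint travel (i a b : nat) (t x : R) : R :=
  if i is j.+1 then travel j a.+1 b t x + - v * travel j a b.+1 t x
  else rho a t * theta b (- v * t + x).

Hypotheses (srho : smooth_fam rho) (stheta : smooth_fam theta).

Lemma travel_dt (i a b : nat) (t x : R) :
  is_derive t 1 (fun s => travel i a b s x) (travel i.+1 a b t x).
Proof.
elim: i a b => [|i IH] a b.
  have h1 := srho a t.
  have h2 := is_derive_affine (stheta b (- v * t + x)).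
  have -> : (fun s => travel 0 a b s x) =
    (rho a : R -> R) * (fun s => theta b (- v * s + x)) :> (R -> R) by [].
  apply: is_derive_eq; rewrite /= /GRing.scale /=; ring.
have h1 := IH a.+1 b; have h2 := IH a b.+1.
have -> : (fun s => travel i.+1 a b s x) = (fun s => travel i a.+1 b s x) \+
    (- v \*: (fun s => travel i a b.+1 s x)) :> (R -> R) by [].
by apply: is_derive_eq.
Qed.

Lemma travel_dx (i a b : nat) (t x : R) :
  is_derive x 1 (travel i a b t) (travel i a b.+1 t x).
Proof.
elim: i a b => [|i IH] a b.
  have h2 := is_derive_affine (a := 1) (stheta b (1 * x + - v * t)).
  have -> : travel 0 a b t =
    rho a t \*: (fun y => theta b (1 * y + - v * t)) :> (R -> R).
    by apply/funext => y /=; rewrite mul1r addrC.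
  by apply: is_derive_eq; rewrite /= !mul1r [x + _]addrC.
have h1 := IH a.+1 b; have h2 := IH a b.+1.
have -> : travel i.+1 a b t = travel i a.+1 b t \+
    (- v \*: travel i a b.+1 t) :> (R -> R) by [].
by apply: is_derive_eq.
Qed.

Lemma travel_continuous i a b :
  continuous (fun z : R * R => travel i a b z.1 z.2).
Proof.
elim: i a b => [|i IH] a b z.
  apply: cvgM.
    apply: (@continuous_comp _ _ _ (fun z : R * R => z.1) (rho a)).
      exact: cvg_fst.
    exact: smooth_fam_continuous.
  apply: (@continuous_comp _ _ _ (fun z : R * R => - v * z.1 + z.2) (theta b)).
    apply: cvgD; last exact: cvg_snd.
    by apply: cvgM; [exact: cvg_cst|exact: cvg_fst].
  exact: smooth_fam_continuous.
apply: cvgD; first exact: IH.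
by apply: cvgM; [exact: cvg_cst|exact: IH].
Qed.

Lemma travel_testfun2 (A B : R) :
  (forall t : R, A < `|t| -> rho 0 t = 0) -> (forall x : R, B < `|x| -> theta 0 x = 0) ->
  testfun2 (fun i j => travel i 0 j).
Proof.
move=> rhoA thetaB; split; first by move=> i j t x; exact: travel_dt.
split; first by move=> i j t x; exact: travel_dx.
split; first by move=> i j; exact: travel_continuous.
exists (A + (B + `|v| * A)) => t x tx /=.
have [At|At] := ltP A `|t|; first by rewrite rhoA// mul0r.
rewrite thetaB ?mulr0//.
have h : `|x| <= `|- v * t + x| + `|v| * `|t|.
  have -> : `|v| * `|t| = `|- v * t| by rewrite normrM normrN.
  rewrite -[X in X <= _](_ : `|(- v * t + x) - (- v * t)| = _); last by congr `|_|; ring.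
  exact: ler_normB.
have : `|v| * `|t| <= `|v| * A by rewrite ler_wpM2l.
lra.
Qed.
End travelling_test_functions.

Lemma within_continuous_epsP {R : realType} (A : set R) (f : R -> R) (t0 : R) :
  {within A, continuous f} -> A t0 ->
  forall e : R, 0 < e -> exists2 d : R, 0 < d &
    forall t : R, A t -> `|t - t0| < d -> `|f t - f t0| <= e.
Proof.
move=> /subspace_continuousP cf At0 e e0.
have /cvgrPdist_le /(_ _ e0) := cf t0 At0.
rewrite near_withinE => /nbhs_ballP[d /= d0 dP].
exists d => // t At td; rewrite distrC.
by apply: dP => //; rewrite /ball /= distrC.
Qed.

Section transport.
Context {R : realType}.
Variables (u : R -> R -> R) (mu : R -> {measure set (measurableTypeR R) -> \bar R}).
Variables (T Ms : R).
Hypothesis mu_fin : forall t : R, 0 <= t <= T -> (mu t setT < +oo)%E.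
Hypothesis mu_le : forall t : R, 0 <= t <= T -> fine (mu t setT) <= Ms.
Hypothesis mu_narrow : forall f : R -> R, continuous f ->
  (exists M : R, forall x : R, `|f x| <= M) -> forall t0 : R, 0 <= t0 <= T ->
  forall e : R, 0 < e -> exists2 d : R, 0 < d & forall t : R, 0 <= t <= T -> `|t - t0| < d ->
    `| \int[mu t]_x f x - \int[mu t0]_x f x | <= e.
Hypothesis mu_weak : forall F, testfun2 F ->
  (\int[@lebesgue_measure R]_(t in `[0%R, +oo[%classic) \int[mu t]_x
        (F 1%N 0%N t x + u t x * F 0%N 1%N t x)%:E
      = - \int[mu 0%R]_x (F 0%N 0%N 0%R x)%:E)%E.

Lemma mu_integrable (t : R) (f : R -> R) (M : R) : 0 <= t <= T -> continuous f ->
  (forall x : R, `|f x| <= M) -> (mu t).-integrable setT (EFin \o f).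
Proof.
move=> tT cf fM; apply: (@bounded_fun_integrable _ (measurableTypeR R) R (mu t) setT f M) => //.
  exact: mu_fin.
exact: continuous_measurable_fun.
Qed.

Lemma mu_mass_fin (t : R) : 0 <= t <= T -> mu t setT = (fine (mu t setT))%:E.
Proof. by move=> tT; rewrite fineK// ge0_fin_numE// mu_fin. Qed.

Lemma Ms_ge0 (t : R) : 0 <= t <= T -> 0 <= Ms.
Proof. by move=> tT; apply: le_trans (mu_le tT); rewrite fine_ge0. Qed.

Lemma mu_Rint_bound (t : R) (f : R -> R) (M : R) : 0 <= t <= T -> continuous f ->
  (forall x : R, `|f x| <= M) -> `| \int[mu t]_x f x | <= M * Ms.
Proof.
move=> tT cf fM; have M0 : 0 <= M by apply: le_trans (fM 0).
have if_ := mu_integrable tT cf fM.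
rewrite (le_trans (le_normr_Rintegral _ if_))//.
have -> : M * Ms = M * Ms + 0 by rewrite addr0.
rewrite (@le_trans _ _ (\int[mu t]_x cst M x))//.
  apply: le_Rintegral => //.
  - exact: integrable_norm.
  - by apply: (mu_integrable tT (M := M)); [exact: cst_continuous|move=> x; rewrite ger0_norm].
rewrite Rintegral_cst// addr0 ler_wpM2l// mu_le//.
Qed.

Variables (theta : nat -> R -> R) (v Bd : R).
Hypothesis stheta : smooth_fam theta.
Hypothesis theta0B : forall x : R, `|theta 0 x| <= Bd.
Hypothesis theta1B : forall x : R, `|theta 1 x| <= Bd.

Definition moment (t : R) : R := \int[mu t]_x theta 0 (- v * t + x).

Lemma theta_shift_continuous (k : nat) (t : R) : continuous (fun x : R => theta k (- v * t + x)).
Proof.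
move=> x; apply: (@continuous_comp _ _ _ (fun x => - v * t + x) (theta k)).
  by apply: cvgD; [exact: cvg_cst|exact: cvg_id].
exact: smooth_fam_continuous.
Qed.

Arguments theta_shift_continuous : clear implicits.

Lemma theta_lip (x y : R) : `|theta 0 x - theta 0 y| <= Bd * `|x - y|.
Proof.
have H a b : a < b -> `|theta 0 b - theta 0 a| <= Bd * `|b - a|.
  move=> ab; have [c _ ->] := MVT_is_derive ab (fun x _ => stheta 0 x).
  by rewrite normrM ler_wpM2r.
have [xy|xy|->] := ltgtP x y; last by rewrite !subrr normr0 mulr0.
  by rewrite distrC [`|x - y|]distrC; exact: H.
exact: H.
Qed.

(** Narrow continuity handles the window frozen at time [t0]; letting the window travel costs at
    most [Bd] |v| |t - t0| times the mass. *)
Lemma moment_continuous (t0 : R) : 0 <= t0 <= T -> forall e : R, 0 < e ->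
  exists2 d : R, 0 < d & forall t : R, 0 <= t <= T -> `|t - t0| < d ->
    `|moment t - moment t0| <= e.
Proof.
move=> t0T e e0.
have e2 : 0 < e / 2 by rewrite divr_gt0.
have [d1 d10 dP1] := mu_narrow (theta_shift_continuous 0 t0)
  (ex_intro _ Bd (fun x => theta0B _)) t0T e2.
have Bd0 : 0 <= Bd by apply: le_trans (theta0B 0).
have MsT := Ms_ge0 t0T.
pose k := Bd * `|v| * Ms + 1.
have k0 : 0 < k by rewrite ltr_wpDl// !mulr_ge0.
exists (Num.min d1 (e / 2 / k)); first by rewrite lt_min d10 !divr_gt0.
move=> t tT; rewrite lt_min => /andP[/(dP1 _ tT) h1 h2].
have h3 : `|moment t - \int[mu t]_x theta 0 (- v * t0 + x)| <= e / 2.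
  rewrite /moment -RintegralB//; last 2 first.
  - exact: (mu_integrable tT (theta_shift_continuous 0 t)).
  - exact: (mu_integrable tT (theta_shift_continuous 0 t0)).
  rewrite (le_trans (mu_Rint_bound (M := Bd * (`|v| * `|t - t0|)) tT _ _))//.
  - move=> x; apply: cvgB; exact: theta_shift_continuous.
  - move=> x; rewrite (le_trans (theta_lip _ _))// ler_wpM2l//.
    by rewrite -normrM -[leRHS]normrN; rewrite le_eqVlt; apply/orP; left; apply/eqP; congr `|_|; ring.
  - have h4 : `|t - t0| * k <= e / 2 by rewrite -ler_pdivlMr// ltW.
    apply: le_trans h4; rewrite /k mulrDr mulr1.
    have -> : Bd * (`|v| * `|t - t0|) * Ms = `|t - t0| * (Bd * `|v| * Ms) by ring.
    by rewrite lerDl.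
have := ler_distD (\int[mu t]_x theta 0 (- v * t0 + x)) (moment t) (moment t0).
by rewrite {2}/moment; lra.
Qed.

(** Formally the derivative of [moment] is the integral of theta'(x - v t) (u - v) against [mu t],
    hence at least -c Ms. The weak equation gives this only after integration in time. So suppose
    that mh(t) = moment(t) + c Ms t drops from [t0] to [t1], and test with rho(t) theta(x - v t),
    where rho rises from 0 to 1 just after [t0] and falls back to 0 just before [t1]: the terms in
    rho' compare the values of mh near the two ends. *)
Lemma moment_lower (A c t0 t1 : R) :
  (forall x : R, A < `|x| -> theta 0 x = 0) -> 0 <= c ->
  0 <= t0 -> t0 < t1 -> t1 <= T ->
  (forall t x : R, t0 <= t <= t1 -> - c <= theta 1 (- v * t + x) * (u t x - v)) ->
  moment t0 - c * Ms * (t1 - t0) <= moment t1.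
Proof.
move=> thetaA c0 t00 t01 t1T lower; rewrite leNgt; apply/negP => contra.
have t0T : 0 <= t0 <= T by lra.
have t1T' : 0 <= t1 <= T by lra.
have [k kE] : exists k, k = c * Ms by exists (c * Ms).
have [mh mhE] : exists mh : R -> R, forall t, mh t = moment t + k * t.
  by exists (fun t => moment t + k * t).
have mh01 : mh t1 < mh t0.
  move: contra; rewrite -kE !mhE mulrBr => contra; lra.
(* A quarter of the drop: values within [gap] of the end values remain separated by twice [gap]. *)
have [gap gapE] : exists gap, gap * 4 = mh t0 - mh t1.
  by exists ((mh t0 - mh t1) / 4); rewrite divfK.
have gap0 : 0 < gap by lra.
have k0 : 0 <= k by rewrite kE mulr_ge0// (Ms_ge0 t0T).
have mh_cont s : 0 <= s <= T -> exists2 d : R, 0 < d & forall t : R, 0 <= t <= T ->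
    `|t - s| < d -> `|mh t - mh s| <= gap.
  move=> sT; have gap2 : 0 < gap / 2 by rewrite divr_gt0.
  have [d d0 dP] := moment_continuous sT gap2.
  exists (Num.min d (gap / 2 / (k + 1))).
    by rewrite lt_min d0 !divr_gt0// ltr_wpDl.
  move=> t tT; rewrite lt_min => /andP[/(dP _ tT) h1].
  rewrite ltr_pdivlMr ?ltr_wpDl// mulrDr mulr1 => h2.
  have -> : mh t - mh s = (moment t - moment s) + k * (t - s) by rewrite !mhE; ring.
  rewrite (le_trans (ler_normD _ _))// normrM (ger0_norm k0).
  have : 0 <= `|t - s| by [].
  rewrite [k * _]mulrC; lra.
have [d1 d10 dP1] := mh_cont _ t0T; have [d2 d20 dP2] := mh_cont _ t1T'.
(* On the ramps [t0, t0 + d] and [t1 - d, t1] of rho the function mh stays within [gap] of its end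
   values, and the two ramps do not overlap. *)
have [d dE] : exists d, d = Num.min (Num.min d1 d2) (t1 - t0) / 2.
  by exists (Num.min (Num.min d1 d2) (t1 - t0) / 2).
have d0 : 0 < d by rewrite dE divr_gt0// !lt_min d10 d20 subr_gt0.
have [dd1 dd2 dt] : [/\ d < d1, d < d2 & d <= (t1 - t0) / 2].
  have m1 : Num.min (Num.min d1 d2) (t1 - t0) <= d1 by rewrite !ge_min lexx.
  have m2 : Num.min (Num.min d1 d2) (t1 - t0) <= d2 by rewrite !ge_min lexx orbT.
  have m3 : Num.min (Num.min d1 d2) (t1 - t0) <= t1 - t0 by rewrite ge_min lexx orbT.
  by rewrite dE; split; lra.
have [c0' c0E] : exists c0', c0' = mh t0 - gap by exists (mh t0 - gap).
have [c1 c1E] : exists c1, c1 = mh t1 + gap by exists (mh t1 + gap).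
have c01 : c1 < c0' by lra.
have [S [sS S00 S01 S1ge [S1out _]]] := @smooth_step_exists R.
have [b bE] : exists b, b = t1 - d by exists (t1 - d).
pose st (s : R) (j : nat) t := d^-1 ^+ j * S j (d^-1 * t + - s / d).
have sst s : smooth_fam (st s) by exact: smooth_fam_affine.
have argE s t : d^-1 * t + - s / d = (t - s) / d by rewrite mulrC -mulrDl.
have st0 s t : t <= s -> st s 0 t = 0.
  move=> ts; rewrite /st expr0 mul1r argE S00// pmulr_lle0 ?invr_gt0//; lra.
have st1 s t : s + d <= t -> st s 0 t = 1.
  move=> ts; rewrite /st expr0 mul1r argE S01// ler_pdivlMr//; lra.
have dst_ge0 s t : 0 <= st s 1 t.
  by rewrite /st mulr_ge0// exprn_ge0// invr_ge0 ltW.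
have dst0 s t : t <= s \/ s + d <= t -> st s 1 t = 0.
  move=> ts; rewrite /st argE S1out ?mulr0//; case: ts => ts; [left|right].
    by rewrite pmulr_lle0 ?invr_gt0//; lra.
  by rewrite ler_pdivlMr//; lra.
have st_mono s t t' : t <= t' -> st s 0 t <= st s 0 t'.
  rewrite le_eqVlt => /orP[/eqP->//|tt'].
  have [z _ zE] := MVT_is_derive tt' (fun x _ => sst s 0 x).
  by rewrite -subr_ge0 zE mulr_ge0 ?dst_ge0// subr_ge0 ltW.
have t0b : t0 + d <= b by lra.
have bd : b + d = t1 by rewrite bE; ring.
pose rho (j : nat) t := 1 * st t0 j t + (-1) * st b j t.
have srho : smooth_fam rho by exact: smooth_fam_linear.
have rho_out t : t <= t0 \/ t1 <= t -> rho 0 t = 0.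
  case=> ht; first by rewrite /rho !st0 ?mulr0 ?addr0//; lra.
  by rewrite /rho !st1 ?mulr1 ?subrr//; lra.
have drho_out t : t <= t0 \/ t1 <= t -> rho 1 t = 0.
  by case=> ht; rewrite /rho !dst0 ?mulr0 ?addr0//; [left|left|right|right]; lra.
have rho_ge0 t : 0 <= rho 0 t.
  rewrite /rho mul1r mulN1r subr_ge0.
  have [tb|tb] := leP t b; first by rewrite (st0 b)//; have := @st_mono t0 (Num.min t t0) t;
    rewrite (st0 t0 (Num.min t t0)) ?ge_min ?lexx ?orbT//; apply.
  rewrite (st1 t0) ?(le_trans t0b) ?(ltW tb)//.
  by have := @st_mono b t (Num.max t t1); rewrite (st1 b (Num.max t t1)) ?bd ?le_max ?lexx ?orbT//; apply.
have tf : testfun2 (fun i j => travel rho theta v i 0 j).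
  apply: (@travel_testfun2 _ rho theta v srho stheta t1 A) => // t tt.
  apply: rho_out; have [t_ge0|t_lt0] := leP 0 t.
    by right; rewrite ger0_norm// in tt; exact: ltW.
  by left; exact: le_trans (ltW t_lt0) t00.
have := mu_weak tf.
rewrite [X in _ = (- X)%E -> _](_ : _ = 0%E); last first.
  apply: integral0_eq => x _ /=; rewrite rho_out ?mul0r//; left; lra.
rewrite oppe0 => weak0.
(* A continuous lower bound for the inner integral: rho' mh is estimated by c0' and c1 on the two
   ramps, and the remaining terms form -k (rho(t) t)', whose integral over [t0, t1] is 0. *)
pose L t := c0' * st t0 1 t + (- c1 * st b 1 t + - k * (rho 1 t * t + rho 0 t)).
have cL : continuous L.
  move=> t; apply: cvgD.
    by apply: cvgM; [exact: cvg_cst|exact: smooth_fam_continuous].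
  apply: cvgD; first by apply: cvgM; [exact: cvg_cst|exact: smooth_fam_continuous].
  apply: cvgM; first exact: cvg_cst.
  apply: cvgD; last exact: smooth_fam_continuous.
  by apply: cvgM; [exact: smooth_fam_continuous|exact: cvg_id].
pose Lam t := c0' * st t0 0 t + (- c1 * st b 0 t + - k * (rho 0 t * t)).
have dLam (t : R) : is_derive t 1 Lam (L t).
  have h1 := sst t0 0%N t; have h2 := sst b 0%N t; have h3 := srho 0%N t.
  have -> : Lam = (c0' \*: st t0 0) \+ ((- c1 \*: st b 0) \+
     (- k \*: ((rho 0 : R -> R) * (@id R)))) :> (R -> R) by [].
  by apply: is_derive_eq; rewrite /L /GRing.scale /=; ring.
have intL : (\int[@lebesgue_measure R]_(t in `[t0, t1]) (L t)%:E = (c0' - c1)%:E)%E.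
  rewrite (@integral_is_derive _ L Lam _ _ t01 cL)//; congr EFin.
  rewrite /Lam !rho_out; [|by left|by right].
  rewrite (st1 t0)//; last by lra.
  rewrite (st1 b)//; last by rewrite bd.
  rewrite (st0 t0)// (st0 b)//; last by lra.
  by ring.
suff : ((c0' - c1)%:E <= 0 :> \bar R)%E by rewrite lee_fin subr_le0 leNgt c01.
(* The contradiction: the time integral of the inner integrals is 0 by the weak equation, yet it
   dominates the integral of [L], which is c0' - c1 > 0. *)
rewrite -weak0 -intL.
rewrite (_ : `[t0, t1]%classic = `[0%R, +oo[%classic `&` `[t0, t1]%classic); last first.
  by apply/seteqP; split=> [t|t [_]//] /=; rewrite !in_itv /= andbT => h; split => //; lra.
rewrite integral_mkcondr; apply: le_integral_nomeas => t.
rewrite /= in_itv /= andbT => t_ge0; rewrite patchE.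
case: ifPn => [/set_mem|/negP tn]; last first.
  rewrite integral0_eq// => x _.
  have ht : t <= t0 \/ t1 <= t.
    have [|h1] := leP t t0; first by left.
    have [|h2] := leP t1 t; first by right.
    by case: tn; rewrite inE /= in_itv /= !ltW.
  by rewrite rho_out// drho_out// !mul0r !mulr0 !addr0.
rewrite /= in_itv /= => tt.
have tT : 0 <= t <= T by lra.
have -> : (\int[mu t]_x (rho 1%N t * theta 0%N (- v * t + x) +
      - v * (rho 0%N t * theta 1%N (- v * t + x)) +
      u t x * (rho 0%N t * theta 1%N (- v * t + x)))%:E =
   \int[mu t]_x (rho 1%N t * theta 0%N (- v * t + x) +
      rho 0%N t * (theta 1%N (- v * t + x) * (u t x - v)))%:E)%E.
  by apply: eq_integral => x _; congr EFin; ring.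
apply: (@le_trans _ _ (\int[mu t]_x
  (rho 1%N t * theta 0%N (- v * t + x) + - (rho 0%N t * c))%:E)%E); last first.
  apply: le_integral_nomeas => x _; rewrite lee_fin lerD2l -mulrN.
  by apply: ler_wpM2l; [exact: rho_ge0|exact: lower].
have i1 : (mu t).-integrable setT (EFin \o (fun x => rho 1%N t * theta 0%N (- v * t + x))).
  apply: (mu_integrable (M := `|rho 1%N t| * Bd) tT).
    by move=> x; apply: cvgM; [exact: cvg_cst|exact: theta_shift_continuous].
  by move=> x; rewrite normrM ler_wpM2l.
have i2 : (mu t).-integrable setT (EFin \o (fun=> - (rho 0%N t * c))).
  by apply: (mu_integrable (M := `|rho 0%N t * c|) tT); [exact: cst_continuous|move=> x; rewrite normrN].
rewrite integralD_EFin// integral_cst//.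
have -> : (\int[mu t]_x (rho 1%N t * theta 0%N (- v * t + x))%:E =
    (rho 1%N t * moment t)%:E)%E.
  rewrite /moment -RintegralZl//; last first.
    exact: (mu_integrable tT (theta_shift_continuous 0 t)).
  rewrite /Rintegral fineK//; exact: integrable_fin_num.
rewrite mu_mass_fin// -EFinM -EFinD lee_fin.
have -> : moment t = mh t - k * t by rewrite mhE; ring.
have hk : rho 0%N t * c * fine (mu t setT) <= k * rho 0%N t.
  rewrite kE -mulrA [leRHS]mulrC ler_wpM2l// ler_wpM2l// mu_le//.
have hm1 : c0' * st t0 1%N t <= mh t * st t0 1%N t.
  have [h|h] := leP (t0 + d) t; first by rewrite dst0 ?mulr0//; right.
  apply: ler_wpM2r => //; have := dP1 t tT.
  rewrite ger0_norm ?subr_ge0; last lra.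
  move=> /(_ ltac:(lra)); rewrite ler_norml c0E => /andP[? _]; lra.
have hm2 : mh t * st b 1%N t <= c1 * st b 1%N t.
  have [h|h] := leP t b; first by rewrite dst0 ?mulr0//; left.
  apply: ler_wpM2r => //; have := dP2 t tT.
  rewrite ler0_norm ?subr_le0; last lra.
  move=> /(_ ltac:(lra)); rewrite ler_norml c1E => /andP[_ ?]; lra.
have rho1E : rho 1%N t = st t0 1%N t - st b 1%N t by rewrite /rho; ring.
rewrite /L rho1E; move: hk hm1 hm2.
have -> : (st t0 1%N t - st b 1%N t) * (mh t - k * t) =
  mh t * st t0 1%N t - mh t * st b 1%N t - k * ((st t0 1%N t - st b 1%N t) * t) by ring.
have -> : - k * ((st t0 1%N t - st b 1%N t) * t + rho 0%N t) =
  - (k * ((st t0 1%N t - st b 1%N t) * t)) - k * rho 0%N t by ring.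
lra.
Qed.
End transport.

(** * Distribution functions and quantiles *)

Section cumulative_distribution.
Context {R : realType}.
Variable m : {measure set (measurableTypeR R) -> \bar R}.
Hypothesis m_fin : (m setT < +oo)%E.

Lemma measure_finE (A : set R) : measurable A -> m A = (fine (m A))%:E.
Proof.
move=> mA; rewrite fineK// ge0_fin_numE//; apply: le_lt_trans m_fin.
by apply: le_measure; rewrite ?inE.
Qed.

Lemma cdf_nd (x y : R) : x <= y -> cdf m x <= cdf m y.
Proof.
move=> xy; rewrite -lee_fin /cdf -!measure_finE//; apply: le_measure; rewrite ?inE//.
by apply: subset_itvl; rewrite bnd_simp.
Qed.

Lemma cdf_ge0 (x : R) : 0 <= cdf m x.
Proof. by rewrite fine_ge0. Qed.

Lemma cdf_le_mass (x : R) : cdf m x <= fine (m setT).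
Proof.
by rewrite -lee_fin /cdf -!measure_finE//; apply: le_measure; rewrite ?inE.
Qed.

Let fine_mu_cvg (A : nat -> set R) (B : set R) :
  (forall k, measurable (A k)) -> measurable B ->
  m (A k) @[k --> \oo] --> m B -> fine (m (A k)) @[k --> \oo] --> fine (m B).
Proof.
move=> mA mB h; apply: fine_cvg.
by rewrite -measure_finE.
Qed.

Lemma cdf_left_cont (x e : R) : 0 < e ->
  exists2 d : R, 0 < d & forall y, x - d <= y -> cdf m x - e <= cdf m y.
Proof.
move=> e0; pose A (k : nat) := `]-oo, x - k.+1%:R^-1[%classic : set R.
have AE : \bigcup_k A k = `]-oo, x[%classic.
  apply/seteqP; split=> [y [k _]|y] /=; rewrite !in_itv /= => yx.
    by apply: (lt_le_trans yx); rewrite lerBlDr lerDl.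
  have xy : 0 < x - y by rewrite subr_gt0.
  exists (Num.truncn (x - y)^-1) => //=; rewrite /A /= in_itv /= ltrBrDl -ltrBrDr.
  by rewrite invf_plt ?posrE// truncnS_gt.
have := @nondecreasing_cvg_mu _ _ _ m A.
rewrite AE => /(_ (fun k => measurable_itv _) (measurable_itv _)).
have ndA : nondecreasing_seq A.
  move=> i j ij; apply/subsetPset; apply: subset_itvl; rewrite bnd_simp.
  by rewrite lerD2l lerN2 lef_pV2 ?posrE// ler_nat.
move=> /(_ ndA) /(@fine_mu_cvg A _ (fun k => measurable_itv _) (measurable_itv _)).
move=> /cvgrPdist_le /(_ e e0)[k _ /(_ k (leqnn k)) /= h].
exists k.+1%:R^-1 => [|y xy]; first by rewrite invr_gt0.
have h2 := cdf_nd xy; move: h; rewrite ler_norml /cdf -/(cdf m x) => /andP[_ h].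
by move: h h2; rewrite /cdf; lra.
Qed.

Lemma cdf_lim_Ny (e : R) : 0 < e -> exists x : R, forall y, y <= x -> cdf m y <= e.
Proof.
move=> e0; pose A (k : nat) := `]-oo, - k%:R[%classic : set R.
have AE : \bigcap_k A k = set0.
  apply/seteqP; split=> // y /=; move=> /(_ (Num.truncn `|y|).+1 I).
  rewrite /A /= in_itv /= => yk.
  have : `|y| < (Num.truncn `|y|).+1%:R by rewrite truncnS_gt.
  have := ler_norm (- y); rewrite normrN; lra.
have ndA : nonincreasing_seq A.
  move=> i j ij; apply/subsetPset; apply: subset_itvl; rewrite bnd_simp.
  by rewrite lerN2 ler_nat.
have A0 : (m (A 0%N) < +oo)%E by apply: le_lt_trans m_fin; apply: le_measure; rewrite ?inE//; exact: measurable_itv.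
have := @nonincreasing_cvg_mu _ _ _ m A A0.
rewrite AE => /(_ (fun k => measurable_itv _) measurable0 ndA).
move=> /(@fine_mu_cvg A _ (fun k => measurable_itv _) measurable0).
move=> /cvgrPdist_le /(_ e e0)[k _ /(_ k (leqnn k)) /= h].
exists (- k%:R) => y yk; apply: le_trans (cdf_nd yk) _.
by move: h; rewrite measure0 /= sub0r normrN => /(le_trans (ler_norm _)).
Qed.

Lemma cdf_lim_y (e : R) : 0 < e ->
  exists x : R, forall y, x <= y -> fine (m setT) - e <= cdf m y.
Proof.
move=> e0; pose A (k : nat) := `]-oo, k%:R[%classic : set R.
have AE : \bigcup_k A k = setT.
  apply/seteqP; split=> // y _; exists (Num.truncn y).+1 => //=.
  by rewrite /A /= in_itv /= truncnS_gt.
have ndA : nondecreasing_seq A.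
  move=> i j ij; apply/subsetPset; apply: subset_itvl; rewrite bnd_simp.
  by rewrite ler_nat.
have := @nondecreasing_cvg_mu _ _ _ m A.
rewrite AE => /(_ (fun k => measurable_itv _) measurableT ndA).
move=> /(@fine_mu_cvg A _ (fun k => measurable_itv _) measurableT).
move=> /cvgrPdist_le /(_ e e0)[k _ /(_ k (leqnn k)) /= h].
exists k%:R => y yk; have := cdf_nd yk.
by move: h; rewrite ler_norml /cdf => /andP[_ h]; lra.
Qed.

Lemma Rint_indic_ray (a : R) : \int[m]_x \1_(`]-oo, a[%classic : set R) x = cdf m a.
Proof. by rewrite /Rintegral integral_indic// setIT. Qed.

Lemma integrable_indic_ray (a : R) :
  m.-integrable setT (EFin \o \1_(`]-oo, a[%classic : set R)).
Proof.
apply: (@bounded_fun_integrable _ (measurableTypeR R) R m setT _ 1) => //.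
by move=> x _; rewrite indicE ger0_norm// lern1 leq_b1.
Qed.
End cumulative_distribution.

(** * Quantile functions and their comparison *)

Section quantile.
Context {R : realType}.

Definition quantile (F : R -> R) (eta : R) : R := sup [set x | F x < eta].

(** The properties shared by the distribution functions of open rays: monotone, left-continuous,
    with limits that make the set defining [quantile] nonempty and bounded above at every level
    strictly between 0 and [c]. At the other levels [sup] carries no information. *)
Definition has_quantile (F : R -> R) (c : R) : Prop :=
  [/\ (forall x y, x <= y -> F x <= F y),
      (forall x e, 0 < e -> exists2 d : R, 0 < d & F x - e <= F (x - d)),
      (forall eta, 0 < eta -> exists x, F x < eta) &
      (forall eta, eta < c -> exists x, eta <= F x)].

Variables (F : R -> R) (c : R).
Hypothesis qF : has_quantile F c.
Variable eta : R.
Hypothesis etac : 0 < eta < c.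

Let F_nd : forall x y, x <= y -> F x <= F y. Proof. by case: qF. Qed.

Let has_sup_F : has_sup [set x | F x < eta].
Proof.
case: qF => _ _ lo hi; case/andP: etac => eta0 etac'; split.
  by have [x Fx] := lo _ eta0; exists x.
have [x Fx] := hi _ etac'; exists x => y /= Fy; rewrite leNgt; apply/negP => xy.
by have := lt_le_trans Fy (le_trans Fx (F_nd (ltW xy))); rewrite ltxx.
Qed.

Lemma quantile_le (x : R) : eta <= F x -> quantile F eta <= x.
Proof.
move=> Fx; apply: ge_sup; first by case: has_sup_F.
move=> y /= Fy; rewrite leNgt; apply/negP => xy.
by have := lt_le_trans Fy (le_trans Fx (F_nd (ltW xy))); rewrite ltxx.
Qed.

Lemma quantile_ge (x : R) : F x < eta -> x <= quantile F eta.
Proof. by move=> Fx; apply: ub_le_sup => //; case: has_sup_F. Qed.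

Lemma gt_quantile (x : R) : quantile F eta < x -> eta <= F x.
Proof. by move=> Qx; rewrite leNgt; apply/negP => /quantile_ge; rewrite leNgt Qx. Qed.

Lemma lt_quantile (x : R) : x < quantile F eta -> F x < eta.
Proof. by move=> Qx; rewrite ltNge; apply/negP => /quantile_le; rewrite leNgt Qx. Qed.

(** Strictness comes from left-continuity: [F] still reaches [eta] slightly to the left of [x]. *)
Lemma quantile_lt (x : R) : eta < F x -> quantile F eta < x.
Proof.
move=> Fx; have Fe : 0 < F x - eta by rewrite subr_gt0.
have [_ lc _ _] := qF; have [d d0 Fd] := lc x _ Fe.
apply: (@le_lt_trans _ _ (x - d)); last by rewrite ltrBlDr ltrDl.
by apply: quantile_le; move: Fd; rewrite subKr.
Qed.

End quantile.

Section quantile_comparison.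
Context {R : realType}.
Variables (F0 F1 : R -> R) (c : R).
Hypotheses (q0 : has_quantile F0 c) (q1 : has_quantile F1 c).

(** The comparison is required only on a short interval to the right of the quantile (to its left in
    [quantile_down]), so that estimates valid merely near one point apply. *)
Lemma quantile_up (eta w r : R) : 0 < eta < c -> 0 < r ->
  (forall x, quantile F0 eta < x < quantile F0 eta + r -> F0 x <= F1 (x + w)) ->
  quantile F1 eta <= quantile F0 eta + w.
Proof.
move=> etac r0 H; apply/ler_addgt0Pr => e e0.
pose x := quantile F0 eta + Num.min e (r / 2).
have m0 : 0 < Num.min e (r / 2) by rewrite lt_min e0 divr_gt0.
have xr : quantile F0 eta < x < quantile F0 eta + r.
  rewrite /x ltrDl m0 ltrD2l; have : Num.min e (r / 2) <= r / 2 by rewrite ge_min lexx orbT.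
  lra.
have := gt_quantile q0 etac (andP xr).1 => /le_trans /(_ (H _ xr)).
move=> /(quantile_le q1 etac) /le_trans; apply.
have : Num.min e (r / 2) <= e by rewrite ge_min lexx.
by rewrite /x; lra.
Qed.

Lemma quantile_down (eta w r : R) : 0 < eta < c -> 0 < r ->
  (forall x, quantile F0 eta - r < x < quantile F0 eta -> F1 (x + w) <= F0 x) ->
  quantile F0 eta + w <= quantile F1 eta.
Proof.
move=> etac r0 H; apply/ler_addgt0Pr => e e0.
pose x := quantile F0 eta - Num.min e (r / 2).
have m0 : 0 < Num.min e (r / 2) by rewrite lt_min e0 divr_gt0.
have xr : quantile F0 eta - r < x < quantile F0 eta.
  rewrite /x; have : Num.min e (r / 2) <= r / 2 by rewrite ge_min lexx orbT.
  lra.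
have h := lt_quantile q0 etac (andP xr).2.
have := quantile_ge q1 etac (le_lt_trans (H _ xr) h).
have : Num.min e (r / 2) <= e by rewrite ge_min lexx.
by rewrite /x; lra.
Qed.
End quantile_comparison.

Lemma cdf_has_quantile {R : realType} (m : {measure set (measurableTypeR R) -> \bar R}) :
  (m setT < +oo)%E -> has_quantile (cdf m) (fine (m setT)).
Proof.
move=> mfin; split=> [x y xy|x e e0|eta eta0|eta etac].
- exact: cdf_nd.
- have [d d0 dP] := cdf_left_cont mfin x e0; exists d => //.
  exact: dP.
- have eta2 : 0 < eta / 2 by rewrite divr_gt0.
  have [x xP] := cdf_lim_Ny mfin eta2; exists x.
  by apply: le_lt_trans (xP _ (lexx _)) _; rewrite ltr_pdivrMr// ltr_pMr// ltr1n.
- have etac' : 0 < fine (m setT) - eta by rewrite subr_gt0.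
  have [x xP] := cdf_lim_y mfin etac'; exists x.
  by have := xP _ (lexx _); rewrite subKr.
Qed.

(* A smooth plateau [theta], between the indicators of [[-r, a - d]] and of
   [[-2r, a]], with a slow ascent on the left. *)
Lemma plateau_exists {R : realType} : exists2 B : R, 0 < B &
  forall a d r : R, 0 < d -> 0 < r -> - r <= a - d ->
  exists theta : nat -> R -> R,
  [/\ smooth_fam theta,
    (forall y, 2 * r + `|a| < `|y| -> theta 0 y = 0),
    (forall y, \1_(`]-oo, (a - d)[%classic : set R) y
       - \1_(`]-oo, - r[%classic : set R) y <= theta 0 y
       <= \1_(`]-oo, a[%classic : set R) y),
    (forall y, `|theta 1 y| <= B / r + B / d) &
    (forall y, y <= - r -> 0 <= theta 1 y <= B / r) /\
    (forall y, - r <= y -> theta 1 y <= 0 /\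
       (y <= a - d \/ a <= y -> theta 1 y = 0))].
Proof.
have [S [sS S00 S01 S1ge [S1out [B B0 SB]]]] := @smooth_step_exists R.
exists B => // a d r d0 r0 rad.
pose st (l s : R) (j : nat) t := l^-1 ^+ j * S j (l^-1 * t + - s / l).
have sst l s : smooth_fam (st l s) by exact: smooth_fam_affine.
have argE (l s t : R) : l^-1 * t + - s / l = (t - s) / l by rewrite mulrC -mulrDl.
have st0 (l s t : R) : 0 < l -> t <= s -> st l s 0 t = 0.
  by move=> l0 ts; rewrite /st expr0 mul1r argE S00// pmulr_lle0 ?invr_gt0//; lra.
have st1 (l s t : R) : 0 < l -> s + l <= t -> st l s 0 t = 1.
  by move=> l0 ts; rewrite /st expr0 mul1r argE S01// ler_pdivlMr//; lra.
have dst_ge0 (l s t : R) : 0 < l -> 0 <= st l s 1 t.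
  by move=> l0; rewrite /st mulr_ge0// exprn_ge0// invr_ge0 ltW.
have dst0 (l s t : R) : 0 < l -> t <= s \/ s + l <= t -> st l s 1 t = 0.
  move=> l0 ts; rewrite /st argE S1out ?mulr0//; case: ts => ts; [left|right].
    by rewrite pmulr_lle0 ?invr_gt0//; lra.
  by rewrite ler_pdivlMr//; lra.
have dst_le (l s t : R) : 0 < l -> st l s 1 t <= B / l.
  by move=> l0; rewrite /st expr1 mulrC ler_wpM2r// invr_ge0 ltW.
have st_mono (l s t t' : R) : 0 < l -> t <= t' -> st l s 0 t <= st l s 0 t'.
  move=> l0; rewrite le_eqVlt => /orP[/eqP->//|tt'].
  have [z _ zE] := MVT_is_derive tt' (fun x _ => sst l s 0 x).
  by rewrite -subr_ge0 zE mulr_ge0 ?dst_ge0// subr_ge0 ltW.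
have st_ge0 (l s t : R) : 0 < l -> 0 <= st l s 0 t.
  move=> l0; have [ts|ts] := leP t s; first by rewrite st0.
  by rewrite -(st0 l s s)// st_mono// ltW.
have st_le1 (l s t : R) : 0 < l -> st l s 0 t <= 1.
  move=> l0; have [ts|ts] := leP (s + l) t; first by rewrite st1.
  by rewrite -(st1 l s (s + l))// st_mono// ltW.
pose theta (j : nat) t := 1 * st r (- (2 * r)) j t + (-1) * st d (a - d) j t.
have thE j t : theta j t = st r (- (2 * r)) j t - st d (a - d) j t.
  by rewrite /theta mul1r mulN1r.
exists theta; split.
- exact: smooth_fam_linear.
- move=> y yA; rewrite thE; have := ler_norm y; have := ler_norm (- y).
  have := ler_norm a; have := ler_norm (- a); rewrite !normrN => h1 h2 h3 h4.
  have [y0|y0] := leP y 0.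
    have yE : `|y| = - y by rewrite ler0_norm.
    by rewrite !st0// ?subrr//; lra.
  have yE : `|y| = y by rewrite gtr0_norm.
  by rewrite !st1// ?subrr//; lra.
- move=> y; have memE (b : R) : (y \in (`]-oo, b[%classic : set R)) = (y < b).
    apply/idP/idP => [/set_mem|yb]; first by rewrite /= in_itv.
    by apply: mem_set; rewrite /= in_itv.
  rewrite thE !indicE !memE.
  have g1 := st_ge0 r (- (2 * r)) y r0; have g2 := st_ge0 d (a - d) y d0.
  have l1 := st_le1 r (- (2 * r)) y r0; have l2 := st_le1 d (a - d) y d0.
  have [y1|y1] := ltP y (- r).
    rewrite (_ : y < a - d)//=; last by lra.
    by rewrite (_ : y < a)//=; [rewrite (st0 d)//; lra|lra].
  rewrite (st1 r)//; last by lra.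
  have [y2|y2] := ltP y (a - d).
    rewrite (_ : y < a)//=; last by lra.
    by rewrite (st0 d)//=; lra.
  have [y3|y3] := ltP y a; rewrite /=; first by lra.
  by rewrite (st1 d)//; lra.
- move=> y; rewrite thE (le_trans (ler_normB _ _))// lerD//.
    by rewrite ger0_norm ?dst_ge0// dst_le.
  by rewrite ger0_norm ?dst_ge0// dst_le.
split=> y yr; rewrite thE.
  by rewrite (dst0 d)//; [rewrite subr0 dst_ge0//= dst_le|left; lra].
rewrite (dst0 r)//; last by right; lra.
rewrite sub0r oppr_le0 dst_ge0//; split=> // yad.
by rewrite dst0// ?oppr0//; case: yad => ?; [left|right]; lra.
Qed.

(** * Characteristics *)

(* All that is used of a conservative solution on [[0, T]]. *)
Record flow {R : realType} (u : R -> R -> R)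
    (mu : R -> {measure set (measurableTypeR R) -> \bar R}) (T Ms M : R) : Prop :=
  Flow {
  flow_fin : forall t : R, 0 <= t <= T -> (mu t setT < +oo)%E;
  flow_le : forall t : R, 0 <= t <= T -> fine (mu t setT) <= Ms;
  flow_narrow : forall f : R -> R, continuous f ->
    (exists B : R, forall x : R, `|f x| <= B) -> forall t0 : R, 0 <= t0 <= T ->
    forall e : R, 0 < e -> exists2 d : R, 0 < d &
      forall t : R, 0 <= t <= T -> `|t - t0| < d ->
      `| \int[mu t]_x f x - \int[mu t0]_x f x | <= e;
  flow_weak : forall F, testfun2 F ->
    (\int[@lebesgue_measure R]_(t in `[0%R, +oo[%classic) \int[mu t]_x
          (F 1%N 0%N t x + u t x * F 0%N 1%N t x)%:E
        = - \int[mu 0%R]_x (F 0%N 0%N 0%R x)%:E)%E;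
  flow_bound : forall t x : R, 0 <= t <= T -> `|u t x| <= M;
  flow_unif : forall e : R, 0 < e -> exists2 r : R, 0 < r &
    forall s t x y : R, 0 <= s <= T -> 0 <= t <= T -> `|t - s| <= r ->
      `|x - y| <= r -> `|u t x - u s y| <= e }.

Arguments flow_fin {R u mu T Ms M} _ {t} _.
Arguments flow_le {R u mu T Ms M} _ {t} _.
Arguments flow_narrow {R u mu T Ms M} _ {f} _ _ {t0} _ {e} _.
Arguments flow_bound {R u mu T Ms M} _ [t] x _.
Arguments flow_unif {R u mu T Ms M} _ [e] _.

Lemma plateau_bounds (R : realType) (u : R -> R -> R)
    (mu : R -> {measure set (measurableTypeR R) -> \bar R}) (T Ms M : R)
    (H : flow u mu T Ms M) (a d r v t : R) (theta : nat -> R -> R) (Bd : R) :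
  0 <= t <= T -> smooth_fam theta -> (forall y, `|theta 0 y| <= Bd) ->
  (forall y, \1_(`]-oo, (a - d)[%classic : set R) y
       - \1_(`]-oo, - r[%classic : set R) y <= theta 0 y
       <= \1_(`]-oo, a[%classic : set R) y) ->
  cdf (mu t) (a + v * t - d) - cdf (mu t) (- r + v * t) <= moment mu theta v t
    <= cdf (mu t) (a + v * t).
Proof.
move=> tT sth thB thE.
have ind (b x : R) : \1_(`]-oo, b[%classic : set R) (- v * t + x) =
    \1_(`]-oo, (b + v * t)[%classic : set R) x :> R.
  rewrite !indicE; congr ((nat_of_bool _)%:R).
  by apply/idP/idP => /set_mem h; apply/mem_set; move: h;
    rewrite /= !in_itv /=; clear; lra.
have ith : (mu t).-integrable setT (EFin \o (fun x => theta 0%N (- v * t + x))).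
  apply: (mu_integrable (@flow_fin _ _ _ _ _ _ H) (M := Bd) tT) => //.
  exact: theta_shift_continuous.
have fT := flow_fin H tT.
apply/andP; split; last first.
  rewrite -Rint_indic_ray; apply: le_Rintegral => //.
    exact: integrable_indic_ray.
  by move=> x _; rewrite -ind; have /andP[] := thE (- v * t + x).
rewrite -!Rint_indic_ray -RintegralB//; try exact: integrable_indic_ray.
apply: le_Rintegral => //.
  exact: (integrableB measurableT (integrable_indic_ray fT (a + v * t - d))
    (integrable_indic_ray fT (- r + v * t))).
move=> x _; have /andP[+ _] := thE (- v * t + x).
by rewrite !ind addrAC.
Qed.

(** A plateau moving with velocity v approximates the mass to the left of the moving front. On its
    descent, inside the strip, the sign of u - v makes the flux favourable. On its ascent, far to
    the left, the slope is at most B/r and |u - v| at most M + |v|, so the loss is k/r and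
    disappears for large r. *)
Lemma cdf_transport (R : realType) (u : R -> R -> R)
    (mu : R -> {measure set (measurableTypeR R) -> \bar R}) (T Ms M : R)
    (H : flow u mu T Ms M) (sg v y d t0 t1 : R) : sg = 1 \/ sg = -1 ->
  0 <= t0 -> t0 < t1 -> t1 <= T -> 0 < d ->
  (forall t x : R, t0 <= t <= t1 -> y - d <= x - v * (t - t0) <= y ->
    sg * u t x <= sg * v) ->
  sg * cdf (mu t0) y <= sg * cdf (mu t1) (y + v * (t1 - t0)).
Proof.
move=> sg1 t00 t01 t1T d0 strip.
have t0T : 0 <= t0 <= T by rewrite t00 (le_trans (ltW t01)).
have t1T' : 0 <= t1 <= T by rewrite t1T (le_trans t00 (ltW t01)).
have [B B0 plat] := @plateau_exists R.
apply/ler_addgt0Pr => e e0.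
(* One third each for the width of the descent, for the mass left of the plateau and for the loss
   k/r on the ascent. *)
have [e' eE] : exists e', e = e' + e' + e' by exists (e / 3); field.
have {}e0 : 0 < e' by lra.
(* The front in the moving frame, where a point x at time t has coordinate x - v t. *)
have [a aE] : exists a, a = y - v * t0 by exists (y - v * t0).
have a0 : a + v * t0 = y by rewrite aE; ring.
have a1 : a + v * t1 = y + v * (t1 - t0) by rewrite aE; ring.
have [d1 d10 dP1] := cdf_left_cont (flow_fin H t0T) y e0.
have [d2 d20 dP2] := cdf_left_cont (flow_fin H t1T') (y + v * (t1 - t0)) e0.
have [x1 xP1] := cdf_lim_Ny (flow_fin H t0T) e0.
have [x2 xP2] := cdf_lim_Ny (flow_fin H t1T') e0.
have [dl [dl0 dld dld1 dld2]] : exists dl, [/\ 0 < dl, dl <= d, dl <= d1 & dl <= d2].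
  exists (Num.min d (Num.min d1 d2)).
  by rewrite !lt_min d0 d10 d20 !ge_min !lexx ?orbT.
have M0 : 0 <= M by apply: le_trans (flow_bound H 0 t0T).
have Ms0 : 0 <= Ms by exact: (Ms_ge0 (@flow_le _ _ _ _ _ _ H) t0T).
have [c' c'E] : exists c', c' = (M + `|v|) by exists (M + `|v|).
have c'0 : 0 <= c' by rewrite c'E addr_ge0.
have [k kE] : exists k, k = B * c' * Ms * (t1 - t0) by exists (B * c' * Ms * (t1 - t0)).
have k0 : 0 <= k by rewrite kE !mulr_ge0 ?(ltW B0)// subr_ge0 ltW.
have [r [r0 rx1 rx2 ra rk]] : exists r, [/\ 0 < r, - r + v * t0 <= x1,
    - r + v * t1 <= x2, - r <= a - dl & k / r <= e'].
  have ke0 : 0 <= k / e' by rewrite divr_ge0// ltW.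
  have n1 := normr_ge0 (v * t0 - x1); have n2 := normr_ge0 (v * t1 - x2).
  have n3 := normr_ge0 (a - dl).
  have l1 := ler_norm (v * t0 - x1); have l2 := ler_norm (v * t1 - x2).
  have l3 := ler_norm (- (a - dl)); rewrite normrN in l3.
  exists (1 + `|v * t0 - x1| + `|v * t1 - x2| + `|a - dl| + k / e').
  have rpos : 0 < 1 + `|v * t0 - x1| + `|v * t1 - x2| + `|a - dl| + k / e'.
    by clear -n1 n2 n3 ke0; lra.
  split => //; try by clear -n1 n2 n3 l1 l2 l3 ke0; lra.
  rewrite ler_pdivrMr// mulrC -ler_pdivrMr//.
  by clear -n1 n2 n3 ke0; lra.
have [th [sth thA thE thB [th1 th2]]] := plat a dl r dl0 r0 ra.
have Br0 : 0 <= B / r by rewrite divr_ge0// ltW.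
have Bd0 : 0 <= B / dl by rewrite divr_ge0// ltW.
have th01 z : `|th 0%N z| <= B / r + B / dl + 1.
  have /andP[h1 h2] := thE z; rewrite ler_norml; apply/andP; split.
    apply: le_trans h1; rewrite lerBrDr; apply: le_trans (_ : 0 <= _).
      rewrite -lerBrDr sub0r lerN2 (le_trans (_ : _ <= 1%:R))//.
        by rewrite indicE ler_nat leq_b1.
      by rewrite lerDr addr_ge0.
    by rewrite indicE ler0n.
  apply: (le_trans h2); rewrite indicE (le_trans (_ : _ <= 1%:R))//.
    by rewrite ler_nat leq_b1.
  by rewrite lerDr addr_ge0.
(* For sg = -1 the lower bound for the moment of -theta is the upper bound for that of theta. *)
pose th' (j : nat) z := sg * th j z + 0 * th j z.
have th'E j z : th' j z = sg * th j z by rewrite /th' mul0r addr0.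
have sth' : smooth_fam th' by exact: smooth_fam_linear.
have sgn : `|sg| = 1 by case: sg1 => ->; rewrite ?normrN normr1.
have momE t : 0 <= t <= T -> moment mu th' v t = sg * moment mu th v t.
  move=> tT; rewrite /moment -RintegralZl//.
    by apply: eq_Rintegral => x _; rewrite th'E.
  apply: (mu_integrable (@flow_fin _ _ _ _ _ _ H) (M := B / r + B / dl + 1) tT) => //.
  exact: theta_shift_continuous.
have low : moment mu th' v t0 - (B / r * c') * Ms * (t1 - t0) <= moment mu th' v t1.
  apply: (moment_lower (@flow_fin _ _ _ _ _ _ H) (@flow_le _ _ _ _ _ _ H) (@flow_narrow _ _ _ _ _ _ H) (flow_weak H) sth'
    (Bd := B / r + B / dl + 1) _ _ (A := 2 * r + `|a|)) => //.
  - by move=> z; rewrite th'E normrM sgn mul1r.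
  - by move=> z; rewrite th'E normrM sgn mul1r (le_trans (thB z))// lerDl.
  - by move=> z zA; rewrite th'E thA// mulr0.
  - by rewrite mulr_ge0.
  move=> t x tt; rewrite th'E.
  have tT : 0 <= t <= T by clear -tt t00 t1T; lra.
  have [z zE] : exists z, z = - v * t + x by exists (- v * t + x).
  rewrite -zE.
  have [zr|zr] := leP z (- r).
    have /andP[h1 h2] := th1 z zr.
    rewrite -lerN2 opprK (le_trans (ler_norm _))// normrN !normrM sgn mul1r.
    rewrite ler_pM//; first by rewrite ger0_norm.
    by rewrite c'E (le_trans (ler_normB _ _))// lerD2r (flow_bound H).
  have [h1 h2] := th2 z (ltW zr).
  apply: (@le_trans _ _ 0); first by rewrite oppr_le0 mulr_ge0.
  have [za|za] := leP z (a - dl); first by rewrite h2 ?mulr0 ?mul0r//; left.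
  have [az|az] := leP a z; first by rewrite h2 ?mulr0 ?mul0r//; right.
  rewrite [sg * _]mulrC -mulrA mulrBr mulr_le0// subr_le0; apply: strip => //.
  have -> : x - v * (t - t0) = z + v * t0 by rewrite zE; ring.
  by clear -za az a0 dld; lra.
have cE : (B / r * c') * Ms * (t1 - t0) = k / r.
  by rewrite kE; field; rewrite gt_eqF.
rewrite cE !momE// in low.
have /andP[b0l b0u] := plateau_bounds H v t0T sth th01 thE.
have /andP[b1l b1u] := plateau_bounds H v t1T' sth th01 thE.
have c0l := dP1 _ (lerD (lexx y) (_ : - d1 <= - dl)).
have c1l := dP2 _ (lerD (lexx (y + v * (t1 - t0))) (_ : - d2 <= - dl)).
have c0r := xP1 _ rx1; have c1r := xP2 _ rx2.
rewrite lerN2 in c0l; rewrite lerN2 in c1l.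
have {}c0l := c0l dld1; have {}c1l := c1l dld2.
rewrite a0 in b0l b0u; rewrite a1 in b1l b1u.
case: sg1 low => ->; clear -rk b0l b0u b1l b1u c0l c1l c0r c1r eE; rewrite ?mul1r ?mulN1r; lra.
Qed.

(** The product with t - s makes the speed condition independent of the direction of time. For t < s
    it is the forward transport from t to s with the opposite sign. *)
Lemma cdf_line (R : realType) (u : R -> R -> R)
    (mu : R -> {measure set (measurableTypeR R) -> \bar R}) (T Ms M : R)
    (H : flow u mu T Ms M) (sg v y d s t : R) : sg = 1 \/ sg = -1 ->
  0 <= s <= T -> 0 <= t <= T -> 0 < d ->
  (forall tau x : R, 0 <= tau <= T -> `|tau - s| <= `|t - s| ->
    y - d <= x - v * (tau - s) <= y -> sg * ((t - s) * (u tau x - v)) <= 0) ->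
  sg * cdf (mu s) y <= sg * cdf (mu t) (y + v * (t - s)).
Proof.
move=> sg1 sT tT d0 strip.
have [st|ts|->] := ltgtP s t; last by rewrite subrr mulr0 addr0.
  apply: (cdf_transport H sg1 _ st _ d0); [by case/andP: sT|by case/andP: tT|].
  move=> tau x ht hx; have := strip tau x.
  rewrite !ger0_norm; try (clear -st ht; lra).
  move=> /(_ _ _ hx); rewrite mulrCA pmulr_rle0 ?subr_gt0// mulrBr subr_le0; apply.
    by clear -sT tT ht; lra.
  by clear -ht; lra.
have sg1' : - sg = 1 \/ - sg = -1 by case: sg1 => ->; [right|left]; rewrite ?opprK.
have := cdf_transport H (v := v) (y := y + v * (t - s)) sg1' _ ts _ d0.
have -> : y + v * (t - s) + v * (s - t) = y by ring.
rewrite !mulNr lerN2; apply; [by case/andP: tT|by case/andP: sT|].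
move=> tau x ht hx; have := strip tau x.
rewrite !ler0_norm; try (clear -ts ht; lra).
have eN : (- (sg * u tau x) <= - (sg * v)) = (sg * v <= sg * u tau x).
  by rewrite lerN2.
rewrite mulNr eN.
have hx' : y - d <= x - v * (tau - s) <= y.
  have e1 : x - v * (tau - t) = x - v * (tau - s) + v * (t - s) by ring.
  by rewrite e1 in hx; clear -hx; lra.
move=> /(_ _ _ hx'); rewrite mulrCA nmulr_rle0 ?subr_lt0// mulrBr subr_ge0; apply.
  by clear -sT tT ht; lra.
by clear -ht; lra.
Qed.

Lemma cdf_speed (R : realType) (u : R -> R -> R)
    (mu : R -> {measure set (measurableTypeR R) -> \bar R}) (T Ms M : R)
    (H : flow u mu T Ms M) (s t y : R) : 0 <= s <= T -> 0 <= t <= T ->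
  cdf (mu s) y <= cdf (mu t) (y + M * `|t - s|) /\
  cdf (mu t) (y - M * `|t - s|) <= cdf (mu s) y.
Proof.
move=> sT tT; have nE : `|t - s| = Num.sg (t - s) * (t - s) by rewrite normrEsg.
have Hu tau x : 0 <= tau <= T -> `|(t - s) * u tau x| <= M * `|t - s|.
  by move=> hT; rewrite normrM mulrC ler_wpM2r// (flow_bound H).
split.
  have := cdf_line H (v := M * Num.sg (t - s)) (y := y) (or_introl erefl) sT tT (@ltr01 R).
  rewrite -mulrA -nE !mul1r; apply => tau x hT _ _.
  rewrite mul1r mulrBr [(t - s) * (M * _)]mulrC -mulrA -nE subr_le0.
  exact: le_trans (ler_norm _) (Hu tau x hT).
have := cdf_line H (v := - M * Num.sg (t - s)) (y := y) (or_intror erefl) sT tT (@ltr01 R).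
rewrite -mulrA -nE !mulN1r lerN2 [- M * `|_|]mulNr; apply => tau x hT _ _.
rewrite mulN1r oppr_le0 mulrBr [(t - s) * (- M * _)]mulrC -mulrA -nE [- M * `|_|]mulNr opprK.
have := Hu tau x hT; rewrite ler_norml => /andP[+ _].
by rewrite -subr_ge0 opprK addrC.
Qed.

(** The lines with velocity u(s, x0) ± e sg(t - s) bracket the motion of all mass close to [x0]. The
    radius [k] depends on [e] only, through the uniform continuity of [u]. *)
Lemma cdf_near (R : realType) (u : R -> R -> R)
    (mu : R -> {measure set (measurableTypeR R) -> \bar R}) (T Ms M : R)
    (H : flow u mu T Ms M) (e : R) : 0 < e -> exists2 k : R, 0 < k &
  forall s t x0 y : R, 0 <= s <= T -> 0 <= t <= T -> `|t - s| <= k ->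
   `|y - x0| <= k ->
   cdf (mu s) y <= cdf (mu t) (y + (u s x0 * (t - s) + e * `|t - s|)) /\
   cdf (mu t) (y + (u s x0 * (t - s) - e * `|t - s|)) <= cdf (mu s) y.
Proof.
move=> e0; have [r r0 rP] := flow_unif H e0.
have [T0|T0] := leP 0 T; last first.
  by exists 1 => // s t x0 y /andP[s0 sT]; have := le_trans s0 sT; rewrite leNgt T0.
have M0 : 0 <= M by apply: le_trans (flow_bound H 0 (_ : 0 <= 0 <= T)); rewrite // lexx.
have Me0 : 0 < M + e + 1 by clear -M0 e0; lra.
(* The drift (M + e) k and the distance |y - x0| <= k add up to r/3; with the strip width r/3 the
   points met stay within r of [x0]. *)
exists (r / 3 / (M + e + 1)); first by rewrite !divr_gt0.
move=> s t x0 y sT tT tsk yk.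
have r3 : 0 < r / 3 by rewrite divr_gt0.
have nE : `|t - s| = Num.sg (t - s) * (t - s) by rewrite normrEsg.
have main v tau x : `|v| <= M + e -> 0 <= tau <= T -> `|tau - s| <= `|t - s| ->
    y - r / 3 <= x - v * (tau - s) <= y ->
    `|(t - s) * (u tau x - u s x0)| <= e * `|t - s|.
  move=> vM hT hts hx; rewrite normrM mulrC ler_wpM2r// rP//.
    apply: (le_trans hts); apply: (le_trans tsk).
    rewrite ler_pdivrMr// (le_trans (_ : _ <= r * 1))//.
      by rewrite mulr1; clear -r0; lra.
    by rewrite ler_wpM2l ?(ltW r0)//; clear -M0 e0; lra.
  have h1 : `|v * (tau - s)| <= (M + e) * (r / 3 / (M + e + 1)).
    rewrite normrM ler_pM// (le_trans hts)//.
  have h2 : (M + e) * (r / 3 / (M + e + 1)) + r / 3 / (M + e + 1) = r / 3.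
    by field; rewrite gt_eqF.
  have e1 : x - x0 = (x - v * (tau - s) - y) + v * (tau - s) + (y - x0) by ring.
  have h3 : `|x - v * (tau - s) - y| <= r / 3.
    by rewrite ler_norml; clear -hx r3; lra.
  rewrite e1 (le_trans (ler_normD _ _))//.
  have := ler_normD (x - v * (tau - s) - y) (v * (tau - s)).
  clear -h1 h2 h3 yk r3; lra.
have vM (g : R) : `|g| <= e -> `|u s x0 + g * Num.sg (t - s)| <= M + e.
  move=> ge; rewrite (le_trans (ler_normD _ _))// lerD ?(flow_bound H)//.
  rewrite normrM (le_trans _ ge)// ler_piMr// normr_sg.
  by case: (t - s != 0) => /=; rewrite ?lexx ?ler01.
have vE (g : R) : (u s x0 + g * Num.sg (t - s)) * (t - s) = u s x0 * (t - s) + g * `|t - s|.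
  by rewrite nE; ring.
have wE (g tau x : R) : (t - s) * (u tau x - (u s x0 + g * Num.sg (t - s))) =
    (t - s) * (u tau x - u s x0) - g * `|t - s|.
  by rewrite nE; ring.
split.
  have := cdf_line H (v := u s x0 + e * Num.sg (t - s)) (y := y)
    (or_introl erefl) sT tT r3.
  rewrite vE !mul1r; apply => tau x hT hts hx; rewrite mul1r wE subr_le0.
  apply: le_trans (ler_norm _) (main _ tau x _ hT hts hx).
  by apply: vM; rewrite gtr0_norm.
have := cdf_line H (v := u s x0 + (- e) * Num.sg (t - s)) (y := y)
  (or_intror erefl) sT tT r3.
rewrite vE !mulN1r lerN2 [- e * `|_|]mulNr; apply => tau x hT hts hx.
rewrite mulN1r wE oppr_le0 [- e * `|_|]mulNr opprK.
have := main _ tau x (vM (- e) _) hT hts hx.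
rewrite normrN gtr0_norm// => /(_ (lexx _)); rewrite ler_norml => /andP[+ _].
by rewrite -subr_ge0 opprK addrC.
Qed.

(** Test functions have compact support, so conservation of the total mass is not immediate; the
    bounded speed prevents mass from escaping to infinity. *)
Lemma mass_const (R : realType) (u : R -> R -> R)
    (mu : R -> {measure set (measurableTypeR R) -> \bar R}) (T Ms M : R)
    (H : flow u mu T Ms M) (s t : R) : 0 <= s <= T -> 0 <= t <= T ->
  fine (mu s setT) = fine (mu t setT).
Proof.
suff K s' t' : 0 <= s' <= T -> 0 <= t' <= T ->
    fine (mu s' setT) <= fine (mu t' setT).
  by move=> sT tT; apply/eqP; rewrite eq_le !K.
move=> sT tT; apply/ler_addgt0Pr => e e0.
have [x xP] := cdf_lim_y (flow_fin H sT) e0.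
have := xP x (lexx _); have [h _] := cdf_speed H x sT tT.
have := cdf_le_mass (flow_fin H tT) (x + M * `|t' - s'|).
clear -h; lra.
Qed.

(** The position at time t of the particle labelled by the mass m to its left: the Lagrangian
    coordinate. *)
Definition charac {R : realType} (mu : R -> {measure set (measurableTypeR R) -> \bar R})
    (t m : R) : R := quantile (cdf (mu t)) m.

Lemma cdf_has_quantileC (R : realType) (u : R -> R -> R)
    (mu : R -> {measure set (measurableTypeR R) -> \bar R}) (T Ms M : R) (C : R)
    (H : flow u mu T Ms M)
    (massC : forall t : R, 0 <= t <= T -> fine (mu t setT) = C) (t : R) : 0 <= t <= T -> has_quantile (cdf (mu t)) C.
Proof. by move=> tT; rewrite -(massC _ tT); apply: cdf_has_quantile; exact: (flow_fin H tT). Qed.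

Lemma charac_lip (R : realType) (u : R -> R -> R)
    (mu : R -> {measure set (measurableTypeR R) -> \bar R}) (T Ms M : R) (C : R)
    (H : flow u mu T Ms M)
    (massC : forall t : R, 0 <= t <= T -> fine (mu t setT) = C) (s t m : R) : 0 <= s <= T -> 0 <= t <= T -> 0 < m < C ->
  `|charac mu t m - charac mu s m| <= M * `|t - s|.
Proof.
move=> sT tT mC; rewrite ler_norml.
have qs := cdf_has_quantileC H massC sT; have qt := cdf_has_quantileC H massC tT.
have := quantile_up qs qt mC ltr01 (w := M * `|t - s|)
  (fun x _ => (cdf_speed H x sT tT).1).
have := quantile_down qs qt mC ltr01 (w := - (M * `|t - s|))
  (fun x _ => (cdf_speed H x sT tT).2).
rewrite -/(charac mu s m) -/(charac mu t m) => h1 h2.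
by clear -h1 h2; lra.
Qed.

Lemma charac_near (R : realType) (u : R -> R -> R)
    (mu : R -> {measure set (measurableTypeR R) -> \bar R}) (T Ms M : R) (C : R)
    (H : flow u mu T Ms M)
    (massC : forall t : R, 0 <= t <= T -> fine (mu t setT) = C) (e : R) : 0 < e -> exists2 k : R, 0 < k &
  forall s t m : R, 0 <= s <= T -> 0 <= t <= T -> `|t - s| <= k -> 0 < m < C ->
    `|charac mu t m - charac mu s m - u s (charac mu s m) * (t - s)| <= e * `|t - s|.
Proof.
move=> e0; have [k k0 kP] := cdf_near H e0; exists k => // s t m sT tT tsk mC.
have qs := cdf_has_quantileC H massC sT; have qt := cdf_has_quantileC H massC tT.
have K x : quantile (cdf (mu s)) m - k < x < quantile (cdf (mu s)) m + k ->
    `|x - charac mu s m| <= k.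
  by rewrite /charac ler_norml => /andP[h1 h2]; clear -h1 h2; lra.
have h1 : charac mu t m <= charac mu s m + (u s (charac mu s m) * (t - s) + e * `|t - s|).
  apply: (quantile_up qs qt mC k0) => x /andP[hx1 hx2].
  apply: (kP s t (charac mu s m) x sT tT tsk _).1; apply: K.
  by clear -hx1 hx2 k0; lra.
have h2 : charac mu s m + (u s (charac mu s m) * (t - s) - e * `|t - s|) <= charac mu t m.
  apply: (quantile_down qs qt mC k0) => x /andP[hx1 hx2].
  apply: (kP s t (charac mu s m) x sT tT tsk _).2; apply: K.
  by clear -hx1 hx2 k0; lra.
rewrite ler_norml.
by clear -h1 h2; lra.
Qed.

(** * The kernel *)

Lemma measurable_monotone_on (R : realType) (f : R -> R) (a b : R) :
  (forall x y : R, a < x -> x <= y -> y < b -> f x <= f y) ->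
  measurable_fun `]a, b[%classic f.
Proof.
move=> f_nd; apply: (measurability (@RGenCInfty.G R)) => [|/= _ [_] [r] -> <-].
  exact: RGenCInfty.measurableE.
apply: is_interval_measurable => s t /= [].
rewrite !in_itv/= !andbT => /andP[a_s sb] fs [/andP[_ tb] ft] u /andP[su ut].
have us : a < u by exact: lt_le_trans su.
have ub : u < b by exact: le_lt_trans tb.
by split; rewrite in_itv/= ?us//= andbT (le_trans fs)// f_nd.
Qed.

Section kernel.
Context {R : realType}.
Variable n : nat.
Hypothesis n1 : (0 < n)%N.
Local Notation K := (@Kn R n).

Lemma Kn_base_gt0 (x : R) : 0 < 1 + x ^+ 2.
Proof. by rewrite ltr_pwDl// sqr_ge0. Qed.

Lemma Kn_gt0 (x : R) : 0 < K x.
Proof. by rewrite invr_gt0 exprn_gt0// Kn_base_gt0. Qed.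

Lemma Kn_ge0 (x : R) : 0 <= K x.
Proof. exact/ltW/Kn_gt0. Qed.

Lemma Kn_le_oneDsqrV (x : R) : K x <= (1 + x ^+ 2)^-1.
Proof.
rewrite lef_pV2 ?posrE ?exprn_gt0 ?Kn_base_gt0//.
by rewrite -{1}(expr1 (1 + x ^+ 2)) ler_weXn2l// lerDl sqr_ge0.
Qed.

Lemma Kn_le1 (x : R) : K x <= 1.
Proof.
apply: (le_trans (Kn_le_oneDsqrV x)).
by rewrite invf_le1 ?Kn_base_gt0// lerDl sqr_ge0.
Qed.

Definition dKn (x : R) : R := - (n%:R * (2 * x)) * (1 + x ^+ 2) ^- n.+1.

Lemma is_derive_Kn (x : R) : is_derive x 1 K (dKn x).
Proof.
have pow (f : R -> R) (l : R) k : is_derive x (1 : R) f l ->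
    is_derive x (1 : R) (fun y : R => f y ^+ k) (k%:R * f x ^+ k.-1 * l).
  move=> hf; have := @is_deriveX _ _ _ k _ _ _ hf.
  by have -> : f ^+ k = (fun y => f y ^+ k) by apply/funext => y; rewrite exprfctE.
have h : is_derive x (1 : R) (fun y : R => 1 + y ^+ 2) (2 * x).
  have h0 := is_deriveD (is_derive_cst (1 : R) x (1 : R)) (pow id 1 2%N (is_derive_id x (1 : R))).
  by rewrite add0r mulr1 expr1 in h0; exact: h0.
have b0 := Kn_base_gt0 x.
have nz : (fun y : R => (1 + y ^+ 2) ^+ n) x != 0 by rewrite gt_eqF// exprn_gt0.
have := @is_deriveV R (fun y : R => (1 + y ^+ 2) ^+ n) x _ 1 nz (pow _ _ n h).
have E (m : nat) (b y : R) : b != 0 ->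
    - (b ^+ m.+1) ^- 2 * (m.+1%:R * b ^+ m * y) = - (m.+1%:R * y) * b ^- m.+2.
  move=> bn; rewrite !exprS; field.
  by rewrite bn expf_neq0.
have := E n.-1 _ (2 * x) (negbT (gt_eqF b0)); rewrite prednK// => e1 hD.
exact: (is_derive_eq hD e1).
Qed.

Lemma dKn_le (x : R) : `|dKn x| <= n%:R.
Proof.
have b0 := Kn_base_gt0 x.
rewrite /dKn normrM normrN normrM ger0_norm// [X in _ * X]ger0_norm; last first.
  by rewrite invr_ge0 exprn_ge0// ltW.
rewrite -mulrA ler_piMr// ler_pdivrMr ?exprn_gt0// mul1r.
apply: (@le_trans _ _ (1 + x ^+ 2)); last first.
  rewrite -{1}(expr1 (1 + x ^+ 2)) ler_weXn2l// lerDl sqr_ge0//.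
have h1 := sqr_ge0 (x - 1); have h2 := sqr_ge0 (x + 1).
rewrite ler_norml; clear -h1 h2; nra.
Qed.

Lemma Kn_lip (x y : R) : `|K x - K y| <= n%:R * `|x - y|.
Proof.
wlog xy : x y / x <= y.
  move=> H; have [|/ltW] := leP x y; first exact: H.
  by move=> yx; rewrite distrC (distrC x); exact: H.
move: xy; rewrite le_eqVlt => /predU1P[->|xy]; first by rewrite !subrr !normr0 mulr0.
have [c _ e] := MVT_is_derive xy (fun z _ => is_derive_Kn z).
by rewrite distrC e normrM (distrC x) ler_wpM2r// dKn_le.
Qed.

Lemma Kn_continuous : continuous K.
Proof. by move=> x; exact: is_derive_continuous (is_derive_Kn x). Qed.

Lemma Kn_integrable : (@lebesgue_measure R).-integrable setT (EFin \o K).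
Proof.
apply: (@le_integrable _ (measurableTypeR R) _ _ _ _ _ (EFin \o (fun x => (1 + x ^+ 2)^-1))) => //.
- apply/measurable_EFinP; apply: continuous_measurable_fun; exact: Kn_continuous.
- move=> x _ /=; rewrite lee_fin !ger0_norm ?Kn_ge0//; last by rewrite invr_ge0 ltW ?Kn_base_gt0.
  exact: Kn_le_oneDsqrV.
apply/integrableP; split.
  apply/measurable_EFinP; apply: continuous_measurable_fun; exact: continuous_oneDsqrV.
under eq_integral => x _ do
  rewrite /= ger0_norm ?invr_ge0 ?ltW ?Kn_base_gt0//.
rewrite ge0_symfun_integralT//.
- rewrite (_ : [set x | _] = `[0, +oo[%classic); last first.
    by apply/seteqP; split => x/=; rewrite in_itv/= andbT.
  by rewrite integral0y_oneDsqr -EFinM ltry.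
- by move=> x; rewrite invr_ge0 ltW// Kn_base_gt0.
- exact: continuous_oneDsqrV.
- by move=> x /=; rewrite sqrrN.
Qed.

Definition Kmass : R := \int[@lebesgue_measure R]_x K x.

Lemma Kmass_ge0 : 0 <= Kmass.
Proof. by apply: Rintegral_ge0 => x _; exact: Kn_ge0. Qed.

Lemma KmassE : (\int[@lebesgue_measure R]_x (K x)%:E = Kmass%:E)%E.
Proof.
by rewrite /Kmass /Rintegral fineK//; apply: integrable_fin_num => //; exact: Kn_integrable.
Qed.

Definition Wn (x : R) : R := \int[@lebesgue_measure R]_(t in `]-oo, x]%classic) K t.

Lemma is_derive_Wn (x : R) : is_derive x 1 Wn (K x).
Proof. exact: is_derive_primitive Kn_integrable Kn_continuous x. Qed.

Lemma Wn_ge0 (x : R) : 0 <= Wn x.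
Proof. by apply: Rintegral_ge0 => y _; exact: Kn_ge0. Qed.

Lemma WnE (x : R) : (\int[@lebesgue_measure R]_(t in `]-oo, x[%classic) (K t)%:E = (Wn x)%:E)%E.
Proof.
rewrite integral_itv_bndo_bndc; last first.
  by apply/measurable_EFinP; apply: measurable_funTS; apply: continuous_measurable_fun; exact: Kn_continuous.
rewrite /Wn /Rintegral fineK//; apply: integrable_fin_num => //.
by apply: integrableS Kn_integrable.
Qed.

Lemma Wn_le (x : R) : Wn x <= Kmass.
Proof.
rewrite -lee_fin -WnE -KmassE; apply: ge0_subset_integral => //.
- by apply/measurable_EFinP; apply: continuous_measurable_fun; exact: Kn_continuous.
- by move=> y _; rewrite lee_fin Kn_ge0.
Qed.

Lemma Wn_MVT (x y : R) : exists2 c : R, `|c - y| <= `|x - y| & Wn x - Wn y = K c * (x - y).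
Proof.
have [xy|yx|->] := ltgtP x y.
- have [c /andP[h1 h2] e] := MVT_is_derive xy (fun z _ => is_derive_Wn z).
  exists c; first by rewrite !ltr0_norm ?subr_lt0//; clear -h1 h2; lra.
  by rewrite -[LHS]opprB e; ring.
- have [c /andP[h1 h2] e] := MVT_is_derive yx (fun z _ => is_derive_Wn z).
  exists c; first by rewrite !gtr0_norm ?subr_gt0//; clear -h1 h2; lra.
  by rewrite e.
- by exists y => //; rewrite !subrr mulr0.
Qed.

Lemma Wn_nd (x y : R) : x <= y -> Wn x <= Wn y.
Proof.
move=> xy; rewrite -subr_ge0; have [c _ ->] := Wn_MVT y x.
by rewrite mulr_ge0 ?Kn_ge0 ?subr_ge0.
Qed.

(** The mean value point lies within |x - y| of y, so the Lipschitz constant n of the kernel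
    controls the remainder. *)
Lemma Wn_taylor (x y : R) : `|Wn x - Wn y - K y * (x - y)| <= n%:R * `|x - y| ^+ 2.
Proof.
have [c cy ->] := Wn_MVT x y; rewrite -mulrBl normrM expr2 mulrA.
by rewrite ler_wpM2r// (le_trans (Kn_lip c y))// ler_wpM2l.
Qed.
End kernel.

(** * Quantile representation of p *)

Section quantile_image.
Context {R : realType}.
Local Notation lam := (@lebesgue_measure R).
Variable m : {measure set (measurableTypeR R) -> \bar R}.
Hypothesis m_fin : (m setT < +oo)%E.
Local Notation c := (fine (m setT)).
Local Notation X := (quantile (cdf m)).

Lemma quantile_nd_on (F : R -> R) (k : R) : has_quantile F k ->
  forall x y : R, 0 < x -> x <= y -> y < k -> quantile F x <= quantile F y.
Proof.
move=> qF x y x0 xy yk.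
have hx : 0 < x < k by rewrite x0 (le_lt_trans xy).
have hy : 0 < y < k by rewrite yk (lt_le_trans x0).
rewrite leNgt; apply/negP => yx.
have [z zE] : exists z, z = (quantile F x + quantile F y) / 2.
  by exists ((quantile F x + quantile F y) / 2).
have h1 := lt_quantile qF hx (x := z); have h2 := gt_quantile qF hy (x := z).
have : F z < F z.
  by apply: (lt_le_trans (h1 _)); [rewrite zE; lra|apply: (le_trans xy); apply: h2; rewrite zE; lra].
by rewrite ltxx.
Qed.

Lemma measurable_quantile (F : R -> R) (k : R) : has_quantile F k ->
  measurable_fun `]0, k[%classic (quantile F).
Proof. by move=> qF; apply: measurable_monotone_on; exact: quantile_nd_on. Qed.

Let g : R -> R := X \_ `]0, c[%classic.
Let w : R -> R := \1_(`]0, c[%classic : set R).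

Let gE (x : R) : 0 < x < c -> g x = X x.
Proof. by move=> xc; rewrite /g patchE mem_set//= in_itv. Qed.

Let mg : measurable_fun setT g.
Proof.
by apply/(measurable_restrictT _ _).1 => //; apply: measurable_quantile; exact: cdf_has_quantile.
Qed.

Let mw : measurable_fun setT w.
Proof. exact: measurable_indic. Qed.

Lemma lebesgue_itvoo0 (a : R) : 0 <= a -> lam `]0, a[%classic = a%:E.
Proof.
move=> a0; rewrite lebesgue_measure_itv /= lte_fin sube0.
by case: ltgtP a0 => // <-.
Qed.

Lemma lebesgue_itvoc0 (a : R) : 0 <= a -> lam `]0, a]%classic = a%:E.
Proof.
move=> a0; rewrite lebesgue_measure_itv /= lte_fin sube0.
by case: ltgtP a0 => // <-.
Qed.

(** Within ]0, c[ the levels whose quantile is below x contain ]0, F(x)[ and are contained in ]0,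
    F(x)]; both intervals have length F(x). *)
Lemma quantile_image (f : R -> \bar R) : measurable_fun setT f ->
  (\int[m]_x f x = \int[lam]_(e in `]0%R, c[%classic) f (X e))%E.
Proof.
move=> mf; rewrite (@finite_measure_weighted_image _ m w g mw mg _ m_fin _ f mf).
- rewrite [RHS]integral_mkcond; apply: eq_integral => x _.
  rewrite patchE /w indicE; case: ifPn => hx; last by rewrite mule0.
  by rewrite mule1 /g patchE hx.
- by move=> x; rewrite /w indicE ler0n.
move=> x.
have mA : measurable [set e : R | g e < x].
  have -> : [set e : R | g e < x] = setT `&` g @^-1` `]-oo, x[%classic.
    by apply/seteqP; split=> y /=; rewrite in_itv /= => // -[].
  exact: mg.
rewrite integral_indic//.
have Fc := cdf_le_mass m_fin x; have F0 := cdf_ge0 m x.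
have l1 := lebesgue_itvoo0 F0; have l2 := lebesgue_itvoc0 F0.
transitivity (cdf m x)%:E; last by rewrite /cdf -measure_finE.
have qF := cdf_has_quantile m_fin.
apply/eqP; rewrite eq_le; apply/andP; split.
  rewrite -l2; apply: le_measure; rewrite ?inE//; first exact: measurableI.
  move=> y [/=]; rewrite !in_itv /= => hy; rewrite gE// => yx.
  by case/andP: (hy) => -> _ /=; exact: (gt_quantile qF hy yx).
rewrite -[X in (X <= _)%E]l1; apply: le_measure; rewrite ?inE//; first exact: measurableI.
move=> y /=; rewrite !in_itv /= => /andP[y0 yF].
have hy : 0 < y < c by rewrite y0 (lt_le_trans yF).
by split => //; rewrite gE//; exact: (quantile_lt qF hy yF).
Qed.

Variable n : nat.
Hypothesis n1 : (0 < n)%N.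
Local Notation K := (@Kn R n).

Definition kconv (x : R) : R := fine (\int[m]_y (K (x - y))%:E).

Lemma measurable_Kn : measurable_fun setT (K : measurableTypeR R -> measurableTypeR R).
Proof. by apply: continuous_measurable_fun; exact: Kn_continuous. Qed.

Lemma measurable_Kn_sub (x : R) :
  measurable_fun setT ((fun y => K (x - y)) : measurableTypeR R -> measurableTypeR R).
Proof.
apply: measurableT_comp; first exact: measurable_Kn.
by apply: measurable_funB.
Qed.

Lemma Kn_sub_integrable (x : R) : m.-integrable setT (EFin \o (fun y => K (x - y))).
Proof.
apply: (@bounded_fun_integrable _ (measurableTypeR R) R m setT _ 1) => //.
  exact: measurable_Kn_sub.
by move=> y _; rewrite ger0_norm ?Kn_ge0// Kn_le1.
Qed.

Lemma kconvE (x : R) : (\int[m]_y (K (x - y))%:E = (kconv x)%:E)%E.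
Proof. by rewrite /kconv fineK//; apply: integrable_fin_num => //; exact: Kn_sub_integrable. Qed.

Lemma kconv_ge0 (x : R) : 0 <= kconv x.
Proof. by apply: fine_ge0; apply: integral_ge0 => y _; rewrite lee_fin Kn_ge0. Qed.

Lemma kconv_lip (x y : R) : `|kconv x - kconv y| <= n%:R * `|x - y| * c.
Proof.
rewrite -[kconv x]/(Rintegral m setT (fun z => K (x - z))) -[kconv y]/(Rintegral m setT (fun z => K (y - z))).
have ix := Kn_sub_integrable x; have iy := Kn_sub_integrable y.
rewrite -RintegralB//.
have iB := integrableB measurableT ix iy.
apply: (le_trans (le_normr_Rintegral measurableT iB)).
rewrite -(Rintegral_cst m measurableT).
apply: le_Rintegral => //.
- exact: integrable_norm.
- by apply: (@bounded_fun_integrable _ (measurableTypeR R) R m setT _ `|n%:R * `|x - y| |).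
- move=> z _; apply: (le_trans (Kn_lip n1 _ _)).
  by rewrite (_ : x - z - (y - z) = x - y)//; ring.
Qed.

Lemma kconv_continuous : continuous kconv.
Proof.
move=> x; apply/cvgrPdist_le => e e0.
have k0 : 0 < n%:R * c + 1 by rewrite ltr_wpDl// mulr_ge0// fine_ge0.
near=> y; apply: (le_trans (kconv_lip x y)).
have : `|x - y| <= e / (n%:R * c + 1).
  near: y; apply/nbhs_normP; exists (e / (n%:R * c + 1)); first exact: divr_gt0.
  by move=> z /= /ltW.
rewrite ler_pdivlMr// => h; apply: le_trans h.
by rewrite mulrAC [X in X <= _]mulrC ler_wpM2l// lerDl.
Unshelve. all: by end_near. Qed.

Lemma kconv_quantile (x : R) :
  (kconv x)%:E = (\int[lam]_(e in `]0%R, c[%classic) (K (x - X e))%:E)%E.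
Proof.
by rewrite -kconvE quantile_image//; apply/measurable_EFinP; exact: measurable_Kn_sub.
Qed.

(** The weight covers three uses: phi = 1 gives the total mass of p, the indicator of a ray gives
    its primitive, and |x|^r its moments. *)
Lemma kconv_tonelli (phi : R -> R) : measurable_fun setT phi -> (forall x, 0 <= phi x) ->
  (\int[lam]_x (phi x * kconv x)%:E =
   \int[lam]_(e in `]0%R, c[%classic) \int[lam]_x (phi x * K (x - X e))%:E)%E.
Proof.
move=> mphi phi0.
pose f (z : measurableTypeR R * measurableTypeR R) : \bar R := (phi z.1 * (K (z.1 - g z.2) * w z.2))%:E.
have mf : measurable_fun setT f.
  apply/measurable_EFinP; apply: measurable_funM.
    by apply: measurableT_comp.
  apply: measurable_funM; last by apply: measurableT_comp.
  apply: measurableT_comp; first exact: measurable_Kn.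
  apply: measurable_funB; first exact: measurable_fst.
  by apply: measurableT_comp.
have f0 z : (0 <= f z)%E.
  by rewrite lee_fin !mulr_ge0 ?Kn_ge0// /w indicE ler0n.
have := @fubini_tonelli _ _ (measurableTypeR R) (measurableTypeR R) R lam lam f mf f0.
have fE x e : f (x, e) = ((phi x)%:E * ((fun e => (K (x - X e))%:E) \_ (`]0%R, c[%classic : set R)) e)%E.
  rewrite patchE /f /=; case: ifPn => he; last by rewrite /w indicE (negbTE he) !mulr0 mule0.
  by rewrite /w indicE he mulr1 /g patchE he EFinM.
have m1 x : measurable_fun setT ((fun e => (K (x - X e))%:E) \_ (`]0%R, c[%classic : set R)).
  apply/(measurable_restrictT _ _).1 => //.
  apply/measurable_EFinP; apply: (measurableT_comp (measurable_Kn_sub x)).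
  by apply: measurable_quantile; exact: cdf_has_quantile.
have -> : (\int[lam]_x \int[lam]_y f (x, y) = \int[lam]_x (phi x * kconv x)%:E)%E.
  apply: eq_integral => x _; under eq_integral => e _ do rewrite fE.
  rewrite ge0_integralZl//; [|exact: m1| |by rewrite lee_fin].
    by rewrite -integral_mkcond -kconv_quantile EFinM.
  by move=> e _; rewrite patchE; case: ifPn => // _; rewrite lee_fin Kn_ge0.
move=> ->; rewrite [RHS]integral_mkcond; apply: eq_integral => e _.
rewrite patchE; case: ifPn => he.
  by apply: eq_integral => x _; rewrite fE patchE he EFinM.
by apply: integral0_eq => x _; rewrite fE patchE (negbTE he) mule0.
Qed.

Lemma integral_Kn_sub (z : R) : (\int[lam]_x (K (x - z))%:E = (Kmass n)%:E)%E.
Proof.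
rewrite (ge0_integral_shift z)//=.
- rewrite (_ : [set _ | True] = setT); last by apply/seteqP; split.
  by under eq_integral do rewrite addrK; exact: KmassE.
- apply/measurable_EFinP; apply: measurableT_comp; first exact: measurable_Kn.
  by apply: measurable_funB.
- by move=> x _; rewrite lee_fin Kn_ge0.
Qed.

Lemma integral_Kn_sub_ray (z x : R) :
  (\int[lam]_(y in `]-oo, x[%classic) (K (y - z))%:E = (Wn n (x - z))%:E)%E.
Proof.
rewrite (ge0_integral_shift z)//=.
- rewrite (_ : [set y | _] = `]-oo, (x - z)[%classic); last first.
    by apply/seteqP; split => y /=; rewrite !in_itv /= ltrBrDr.
  by under eq_integral do rewrite addrK; exact: WnE.
- apply/measurable_EFinP; apply: measurable_funTS; apply: measurableT_comp; first exact: measurable_Kn.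
  by apply: measurable_funB.
- by move=> y _; rewrite lee_fin Kn_ge0.
Qed.

Lemma kconv_mass : (\int[lam]_x (kconv x)%:E = (Kmass n * c)%:E)%E.
Proof.
have := kconv_tonelli (measurable_cst (1 : R)) (fun=> ler01).
under eq_integral do rewrite mul1r.
move=> ->; rewrite (_ : (fun e => _) = cst (Kmass n)%:E); last first.
  by apply/funext => e /=; under eq_integral do rewrite mul1r; exact: integral_Kn_sub.
have l1 := lebesgue_itvoo0 (fine_ge0 (measure_ge0 m setT)).
rewrite EFinM -[X in (_ * X)%E]l1; exact: integral_cst.
Qed.

Lemma Wn_quantile_integrable (x : R) :
  lam.-integrable `]0, c[%classic (EFin \o (fun e => Wn n (x - X e))).
Proof.
have l1 := lebesgue_itvoo0 (fine_ge0 (measure_ge0 m setT)).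
apply: (@bounded_fun_integrable _ (measurableTypeR R) R lam _ _ (Kmass n)) => //.
- by apply: le_lt_trans (ltry c); rewrite -l1.
- have mW : measurable_fun setT ((fun y => Wn n (x - y)) : measurableTypeR R -> measurableTypeR R).
    apply: measurableT_comp; last exact: measurable_funB.
    by apply: nondecreasing_measurable => // y z yz; exact: Wn_nd.
  apply: (measurableT_comp mW).
  by apply: measurable_quantile; exact: cdf_has_quantile.
- by move=> e _; rewrite ger0_norm ?Wn_ge0// Wn_le.
Qed.

Lemma kconv_ray (x : R) : (\int[lam]_(y in `]-oo, x[%classic) (kconv y)%:E =
  (\int[lam]_(e in `]0%R, c[%classic) Wn n (x - X e))%:E)%E.
Proof.
have := kconv_tonelli (measurable_indic (R := R) (_ : measurable (`]-oo, x[%classic : set (measurableTypeR R))))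
  (fun y => _ : 0 <= \1_(`]-oo, x[%classic : set R) y).
move=> /(_ _ (fun y => ler0n _ _)) h.
have E (f : R -> R) : (\int[lam]_y (\1_(`]-oo, x[%classic : set R) y * f y)%:E =
    \int[lam]_(y in `]-oo, x[%classic) (f y)%:E)%E.
  rewrite [RHS]integral_mkcond; apply: eq_integral => y _.
  by rewrite patchE indicE; case: ifPn => // _; rewrite ?mul1r ?mul0r.
rewrite -E h// /Rintegral fineK; last first.
  by apply: integrable_fin_num => //; exact: Wn_quantile_integrable.
by apply: eq_integral => e _; rewrite E integral_Kn_sub_ray.
Qed.
End quantile_image.

(** * The energy distribution G *)

(** The argument of W moves by (v - U) h up to e |h|, hence by at most A |h|. The three errors are
    the second-order remainder at y - X, the replacement of K(y - X) by K(x0 - X), and the error of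
    the particle displacement. *)
Lemma Wn_expand (R : realType) (n : nat) (n1 : (0 < n)%N) (y x0 X X' U v h e A : R) :
  `|X' - X - U * h| <= e * `|h| -> 0 <= e <= 1 -> `|v - U| <= A - 1 ->
  `|Wn n (y + v * h - X') - Wn n (y - X) - h * (v - U) * Kn n (x0 - X)|
    <= `|h| * (n%:R * A ^+ 2 * `|h| + n%:R * A * `|y - x0| + e).
Proof.
move=> hX /andP[e0 e1] hv.
have [a aE] : exists a, a = y + v * h - X' by exists (y + v * h - X').
have [b bE] : exists b, b = y - X by exists (y - X).
have [r rE] : exists r, r = X' - X - U * h by exists (X' - X - U * h).
have abE : a - b = (v - U) * h - r by rewrite aE bE rE; ring.
rewrite -rE in hX; rewrite -aE -bE.
have h0 := normr_ge0 h.
have ab : `|a - b| <= A * `|h|.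
  rewrite abE (le_trans (ler_normB _ _))// normrM.
  have := ler_wpM2r h0 hv; have := ler_wpM2r h0 e1.
  by clear -hX; rewrite mulrBl !mul1r; lra.
have A0 : 0 <= A - 1 by apply: le_trans hv.
have t1 := Wn_taylor n1 a b.
have k1 := Kn_lip n1 b (x0 - X).
have E1 : b - (x0 - X) = y - x0 by rewrite bE; ring.
rewrite E1 in k1.
have -> : Wn n a - Wn n b - h * (v - U) * Kn n (x0 - X) =
    (Wn n a - Wn n b - Kn n b * (a - b)) + (Kn n b - Kn n (x0 - X)) * (a - b)
    + Kn n (x0 - X) * (- r).
  have -> : r = (v - U) * h - (a - b) by rewrite abE; ring.
  by ring.
have t2 : `|Kn n (x0 - X) * (- r)| <= e * `|h|.
  by rewrite normrM normrN ger0_norm ?Kn_ge0// (le_trans _ hX)// ler_piMl// Kn_le1.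
have t3 : `|(Kn n b - Kn n (x0 - X)) * (a - b)| <= n%:R * `|y - x0| * (A * `|h|).
  by rewrite normrM ler_pM.
have t4 : n%:R * `|a - b| ^+ 2 <= n%:R * (A * `|h|) ^+ 2.
  by rewrite ler_wpM2l// lerXn2r// ?nnegrE// mulr_ge0//; clear -A0; lra.
apply: (le_trans (ler_normD _ _)).
have := ler_normD (Wn n a - Wn n b - Kn n b * (a - b)) ((Kn n b - Kn n (x0 - X)) * (a - b)).
have -> : `|h| * (n%:R * A ^+ 2 * `|h| + n%:R * A * `|y - x0| + e) =
  n%:R * (A * `|h|) ^+ 2 + n%:R * `|y - x0| * (A * `|h|) + e * `|h| by ring.
by clear -t1 t2 t3 t4; lra.
Qed.

(** The primitive P of p. Written over mass levels, it depends on the measure only through the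
    quantiles, whose motion is known. The lock leaves its unfolding to explicit rewriting. *)
HB.lock Definition kprim {R : realType} (n : nat) (m : {measure set (measurableTypeR R) -> \bar R}) (x : R) : R :=
  \int[@lebesgue_measure R]_(e in `]0%R, fine (m setT)[%classic) Wn n (x - quantile (cdf m) e).

(** The measure is p dx + m. Having G as its distribution function makes all results on quantiles
    available for chi, and its integral formula turns moments of chi into moments of p dx and m. *)
Lemma energy_measure_exists (R : realType) (n : nat) (m : {measure set (measurableTypeR R) -> \bar R}) :
  (0 < n)%N -> (m setT < +oo)%E ->
  exists N : {measure set (measurableTypeR R) -> \bar R},
  [/\ N setT = (Kmass n * fine (m setT) + fine (m setT))%:E,
      (forall x : R, cdf N x = kprim n m x + cdf m x) &
      (forall f : R -> \bar R, measurable_fun setT f -> (forall x, 0 <= f x)%E ->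
        (\int[N]_x f x =
         \int[@lebesgue_measure R]_x (f x * (kconv m n x)%:E) + \int[m]_x f x)%E)].
Proof.
move=> n1 mfin.
have mp : measurable_fun setT ((kconv m n) : measurableTypeR R -> measurableTypeR R).
  by apply: continuous_measurable_fun; apply: kconv_continuous.
have mid : measurable_fun setT (@id (measurableTypeR R)) by exact: measurable_id.
have [rho [rhoA rhof]] := @weighted_pushforward _ _ (measurableTypeR R) (measurableTypeR R) R
  (@lebesgue_measure R) (kconv m n) id mp mid (kconv_ge0 m n).
pose N : {measure set (measurableTypeR R) -> \bar R} := measure_add rho m.
have addE (A : set (measurableTypeR R)) : N A = (rho A + m A)%E.
  by rewrite /N /measure_add /= /msum big_ord_recl big_ord1.
have addI (f : R -> \bar R) : measurable_fun setT f -> (forall x, 0 <= f x)%E ->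
    (\int[N]_x f x = \int[rho]_x f x + \int[m]_x f x)%E.
  by move=> mf f0; rewrite ge0_integral_measure_add.
exists N; clearbody N; split.
- rewrite addE rhoA//= preimage_setT.
  by rewrite kconv_mass// EFinD; congr (_ + _)%E; rewrite -measure_finE.
- move=> x; rewrite kprim.unlock /cdf addE rhoA//=.
  rewrite (_ : _ @^-1` _ = `]-oo, x[%classic)// kconv_ray//.
  by have -> : m `]-oo, x[%classic = (cdf m x)%:E by rewrite /cdf -measure_finE.
- by move=> f mf f0; rewrite addI// rhof.
Qed.

Section energy_coordinate.
Context {R : realType}.
Variables (u : R -> R -> R) (mu : R -> {measure set (measurableTypeR R) -> \bar R}).
Variables (T Ms M C : R) (n : nat).
Hypothesis n1 : (0 < n)%N.
Hypothesis H : flow u mu T Ms M.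
Hypothesis massC : forall t : R, 0 <= t <= T -> fine (mu t setT) = C.
Local Notation lam := (@lebesgue_measure R).

Lemma GfunE (t x : R) : 0 <= t <= T -> Gfun n mu t x = kprim n (mu t) x + cdf (mu t) x.
Proof.
move=> tT; rewrite /Gfun /cdf kprim.unlock.
have := kconv_ray (flow_fin H tT) n1 x; rewrite /kconv /pfun => ->.
exact.
Qed.

Lemma Gfun_has_quantile (t : R) : 0 <= t <= T ->
  has_quantile (Gfun n mu t) (Kmass n * C + C).
Proof.
move=> tT; have [N [NT Ncdf _]] := energy_measure_exists n1 (flow_fin H tT).
have -> : Gfun n mu t = cdf N.
  by apply/funext => x; rewrite GfunE// Ncdf.
have -> : Kmass n * C + C = fine (N setT) by rewrite NT /= (massC tT).
by apply: cdf_has_quantile; rewrite NT ltry.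
Qed.

Lemma kprim_shift (s t w x : R) : 0 <= s <= T -> 0 <= t <= T ->
  (forall e : R, 0 < e < C -> charac mu t e <= charac mu s e + w) ->
  kprim n (mu s) x <= kprim n (mu t) (x + w).
Proof.
move=> sT tT hw; rewrite kprim.unlock.
have is_ := Wn_quantile_integrable (flow_fin H sT) n1 x.
have it := Wn_quantile_integrable (flow_fin H tT) n1 (x + w).
rewrite (massC sT) in is_ *; rewrite (massC tT) in it *.
apply: (le_Rintegral _ is_ it); first exact: measurable_itv.
move=> e /=; rewrite in_itv /= => he; apply: Wn_nd; first exact: n1.
by have := hw e he; rewrite /charac; lra.
Qed.

Lemma Gfun_speed (s t x : R) : 0 <= s <= T -> 0 <= t <= T ->
  Gfun n mu s x <= Gfun n mu t (x + M * `|t - s|) /\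
  Gfun n mu t (x - M * `|t - s|) <= Gfun n mu s x.
Proof.
move=> sT tT; rewrite !GfunE//; have [h1 h2] := cdf_speed H x sT tT.
have K e : 0 < e < C -> `|charac mu t e - charac mu s e| <= M * `|t - s|.
  exact: (charac_lip H massC).
split; [apply: lerD h1|apply: lerD h2].
  by apply: kprim_shift => [//|//|e /K]; rewrite ler_norml => /andP[]; lra.
have := @kprim_shift t s (M * `|t - s|) (x - M * `|t - s|) tT sT.
by rewrite subrK; apply => e /K; rewrite ler_norml => /andP[]; lra.
Qed.

Lemma chi_lip (s t eta : R) : 0 <= s <= T -> 0 <= t <= T -> 0 < eta < Kmass n * C + C ->
  `|chi n mu t eta - chi n mu s eta| <= M * `|t - s|.
Proof.
move=> sT tT etaC; rewrite ler_norml.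
have qs := Gfun_has_quantile sT; have qt := Gfun_has_quantile tT.
have h1 := quantile_up qs qt etaC ltr01 (w := M * `|t - s|)
  (fun x _ => (Gfun_speed x sT tT).1).
have h2 := quantile_down qs qt etaC ltr01 (w := - (M * `|t - s|))
  (fun x _ => (Gfun_speed x sT tT).2).
rewrite -[chi n mu t eta]/(quantile (Gfun n mu t) eta) -[chi n mu s eta]/(quantile (Gfun n mu s) eta).
by lra.
Qed.

(** The integral of u(t, y) K(x - y) against [mu t], in the mass coordinate. *)
Definition qflux (t x : R) : R :=
  \int[lam]_(e in `]0%R, C[%classic) (u t (charac mu t e) * Kn n (x - charac mu t e)).

Lemma flow_continuous (t : R) : 0 <= t <= T -> continuous (u t).
Proof.
move=> tT x; apply/cvgrPdist_le => e e0; have [r r0 rP] := flow_unif H e0.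
apply/nbhs_normP; exists r; first exact: r0.
move=> y /= xy; apply: (rP t t x y tT tT); last exact: ltW.
by rewrite subrr normr0 ltW.
Qed.

Lemma flow_M_ge0 (t : R) : 0 <= t <= T -> 0 <= M.
Proof. by move=> tT; apply: le_trans (flow_bound H 0 tT). Qed.

Lemma C_ge0 (t : R) : 0 <= t <= T -> 0 <= C.
Proof. by move=> tT; rewrite -(massC tT) fine_ge0. Qed.

Lemma measurable_charac (t : R) : 0 <= t <= T ->
  measurable_fun `]0, C[%classic (charac mu t).
Proof. by move=> tT; apply: measurable_quantile; exact: (cdf_has_quantileC H massC). Qed.

Lemma charac_integrable (t B : R) (f : R -> R) : 0 <= t <= T ->
  measurable_fun setT f -> (forall x, `|f x| <= B) ->
  lam.-integrable `]0, C[%classic (EFin \o (fun e => f (charac mu t e))).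
Proof.
move=> tT mf fB; have C0 := C_ge0 tT.
apply: (@bounded_fun_integrable _ (measurableTypeR R) R lam _ _ B) => //.
  by apply: le_lt_trans (ltry C); rewrite -(lebesgue_itvoo0 C0).
by apply: (measurableT_comp mf); exact: measurable_charac.
Qed.

Lemma kprim_expand (V e : R) : 0 <= V -> 0 < e -> exists2 k : R, 0 < k &
  forall s t x0 y v : R, 0 <= s <= T -> 0 <= t <= T -> `|t - s| <= k -> `|y - x0| <= k ->
  `|v| <= V ->
  `|kprim n (mu t) (y + v * (t - s)) - kprim n (mu s) y
    - (t - s) * (v * pfun n mu s x0 - qflux s x0)| <= e * `|t - s|.
Proof.
move=> V0 e0; have [T0|T0] := leP 0 T; last first.
  by exists 1 => // s t x0 y v /andP[s0 sT]; have := le_trans s0 sT; rewrite leNgt T0.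
have zT : 0 <= (0 : R) <= T by rewrite lexx.
have M0 := flow_M_ge0 zT; have C0 := C_ge0 zT.
have [A AE] : exists A, A = V + M + 1 by exists (V + M + 1).
(* Each mass level contributes three errors of size [e1], and the levels have total length [C]; C +
   1 keeps the quotient defined when C = 0. *)
have [e1 e1E] : exists e1, e1 = Num.min 1 (e / (3 * (C + 1))).
  by exists (Num.min 1 (e / (3 * (C + 1)))).
have C1 : 0 < 3 * (C + 1) by lra.
have e10 : 0 < e1 by rewrite e1E lt_min ltr01 divr_gt0.
have e11 : e1 <= 1 by rewrite e1E ge_min lexx.
have e1e : 3 * e1 * C <= e.
  have : e1 <= e / (3 * (C + 1)) by rewrite e1E ge_min lexx orbT.
  rewrite ler_pdivlMr// => h; apply: le_trans h.
  by nra.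
have [k1 k10 k1P] := charac_near H massC e10.
have A1 : 1 <= A by rewrite AE; lra.
have nA0 : 0 < n%:R * A ^+ 2 + 1 by rewrite ltr_wpDl// mulr_ge0// sqr_ge0.
exists (Num.min k1 (e1 / (n%:R * A ^+ 2 + 1))); first by rewrite lt_min k10 divr_gt0.
move=> s t x0 y v sT tT; rewrite !le_min => /andP[tk1 tke] /andP[_ yk] vV.
have [h hE] : exists h, h = t - s by exists (t - s).
rewrite -hE in tk1 tke *.
rewrite !ler_pdivlMr// in tke yk.
have nn : (0 : R) <= n%:R by [].
have b1 : n%:R * A ^+ 2 * `|h| <= e1.
  by apply: le_trans tke; rewrite mulrC ler_wpM2l// lerDl.
have b2 : n%:R * A * `|y - x0| <= e1.
  apply: le_trans yk; rewrite mulrC ler_wpM2l//.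
  have : n%:R * A <= n%:R * A ^+ 2 by rewrite ler_wpM2l// expr2 ler_peMr// (le_trans ler01).
  by lra.
have iq := @charac_integrable s (M * 1) (fun X => u s X * Kn n (x0 - X)) sT.
have ip := @charac_integrable s 1 (fun X => Kn n (x0 - X)) sT (measurable_Kn_sub n1 x0).
have mu_ : measurable_fun setT (u s : measurableTypeR R -> measurableTypeR R).
  by apply: continuous_measurable_fun; exact: flow_continuous.
have {}iq := iq (measurable_funM mu_ (measurable_Kn_sub n1 x0)).
have {}iq : lam.-integrable `]0, C[%classic (EFin \o (fun e => u s (charac mu s e) * Kn n (x0 - charac mu s e))).
  apply: iq => X; rewrite normrM ler_pM//; first exact: (flow_bound H).
  by rewrite ger0_norm ?Kn_ge0// Kn_le1.
have {}ip : lam.-integrable `]0, C[%classic (EFin \o (fun e => Kn n (x0 - charac mu s e))).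
  by apply: ip => X; rewrite ger0_norm ?Kn_ge0// Kn_le1.
have is_ := Wn_quantile_integrable (flow_fin H sT) n1 y.
have it := Wn_quantile_integrable (flow_fin H tT) n1 (y + v * h).
have pE : pfun n mu s x0 = \int[lam]_(e in `]0%R, C[%classic) Kn n (x0 - charac mu s e).
  have := kconv_quantile (flow_fin H sT) n1 x0; rewrite (massC sT) /charac /Rintegral.
  by move=> <-.
rewrite kprim.unlock (massC sT) in is_ *; rewrite (massC tT) in it *; rewrite pE /qflux.
have mI : measurable (`]0, C[%classic : set (measurableTypeR R)) by [].
have ipv : lam.-integrable `]0, C[%classic (EFin \o (fun e => v * Kn n (x0 - charac mu s e))).
  exact: (integrableZl mI v ip).
have ipq := integrableB mI ipv iq.
have ihpq := integrableZl mI h ipq.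
have id1 := integrableB mI it is_.
have id2 := integrableB mI id1 ihpq.
rewrite -(RintegralZl v mI ip) -(RintegralB mI ipv iq) -(RintegralZl h mI ipq).
rewrite -(RintegralB mI it is_) -(RintegralB mI id1 ihpq).
apply: (le_trans (le_normr_Rintegral mI id2)).
have bnd : 3 * e1 * C * `|h| <= e * `|h| by rewrite ler_wpM2r.
apply: le_trans bnd; rewrite [X in _ <= X]mulrAC.
have -> : 3 * e1 * `|h| * C = \int[lam]_(e in `]0%R, C[%classic) (cst (3 * e1 * `|h|) e).
  rewrite Rintegral_cst//; congr (_ * _).
  exact: (esym (congr1 fine (lebesgue_itvoo0 C0))).
apply: le_Rintegral => //.
- exact: integrable_norm.
- apply: (@bounded_fun_integrable _ (measurableTypeR R) R lam _ _ `|3 * e1 * `|h| |) => //.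
  by apply: le_lt_trans (ltry C); rewrite -(lebesgue_itvoo0 C0).
move=> m /=; rewrite in_itv /= => hm.
have := k1P s t m sT tT; rewrite -hE => /(_ tk1 hm) hX.
have hv : `|v - u s (charac mu s m)| <= A - 1.
  rewrite AE addrK (le_trans (ler_normB _ _))// lerD// (flow_bound H)//.
have := Wn_expand n1 y x0 hX _ hv; rewrite (ltW e10) e11 => /(_ isT) hh.
rewrite -mulrBl mulrA; apply: (le_trans hh).
rewrite mulrC; apply: ler_wpM2r => //.
by lra.
Qed.
End energy_coordinate.

(** * Time derivative of chi *)

Lemma Gfun_near (R : realType) (u : R -> R -> R)
    (mu : R -> {measure set (measurableTypeR R) -> \bar R}) (T Ms M C : R) (n : nat)
    (n1 : (0 < n)%N) (H : flow u mu T Ms M)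
    (massC : forall t : R, 0 <= t <= T -> fine (mu t setT) = C) (e : R) :
  0 < e -> exists2 k : R, 0 < k &
  forall s t x0 y : R, 0 <= s <= T -> 0 <= t <= T -> `|t - s| <= k -> `|y - x0| <= k ->
  Gfun n mu s y + (t - s) * (u s x0 * pfun n mu s x0 - qflux u mu C n s x0) - e * `|t - s|
    <= Gfun n mu t (y + (u s x0 * (t - s) + e * `|t - s|)) /\
  Gfun n mu t (y + (u s x0 * (t - s) - e * `|t - s|)) <=
  Gfun n mu s y + (t - s) * (u s x0 * pfun n mu s x0 - qflux u mu C n s x0) + e * `|t - s|.
Proof.
move=> e0; have [T0|T0] := leP 0 T; last first.
  by exists 1 => // s t x0 y /andP[s0 sT]; have := le_trans s0 sT; rewrite leNgt T0.
have zT : 0 <= (0 : R) <= T by rewrite lexx.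
have M0 := flow_M_ge0 H zT.
have [k1 k10 kP] := cdf_near H e0.
have V0 : 0 <= M + e by rewrite addr_ge0// ltW.
have [k2 k20 k2P] := kprim_expand n1 H massC V0 e0.
exists (Num.min k1 k2); first by rewrite lt_min k10.
move=> s t x0 y sT tT; rewrite !le_min => /andP[tk1 tk2] /andP[yk1 yk2].
have [f1 f2] := kP s t x0 y sT tT tk1 yk1.
have {}k2P v := k2P s t x0 y v sT tT tk2 yk2.
have [h hE] : exists h, h = t - s by exists (t - s).
rewrite -hE in f1 f2 k2P *.
have nE : `|h| = Num.sg h * h by rewrite normrEsg.
have vM (g : R) : `|g| <= e -> `|u s x0 + g * Num.sg h| <= M + e.
  move=> ge; rewrite (le_trans (ler_normD _ _))// lerD ?(flow_bound H)//.
  rewrite normrM (le_trans _ ge)// ler_piMr// normr_sg.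
  by case: (h != 0) => /=; rewrite ?lexx ?ler01.
have vE (g : R) : (u s x0 + g * Num.sg h) * h = u s x0 * h + g * `|h|.
  by rewrite nE; ring.
have wE (g p q : R) : h * ((u s x0 + g * Num.sg h) * p - q) =
    h * (u s x0 * p - q) + g * (`|h| * p).
  by rewrite nE; ring.
(* The extra shift by ± e |h| changes P by ± e |h| p up to the error already counted. As p >= 0,
   this term helps in both inequalities and is dropped. *)
have p0 : 0 <= e * (`|h| * pfun n mu s x0).
  by rewrite !mulr_ge0// ?(ltW e0)//; exact: kconv_ge0.
have r1 := k2P _ (vM e _); have r2 := k2P _ (vM (- e) _).
rewrite normrN gtr0_norm// lexx in r1 r2.
have {}r1 := r1 isT; have {}r2 := r2 isT.
rewrite vE wE in r1; rewrite vE wE in r2.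
rewrite !ler_norml !mulNr in r1 r2.
rewrite !(GfunE n1 H _ sT) !(GfunE n1 H _ tT).
move: f1 f2 r1 r2 p0.
set a1 := cdf _ _; set a2 := cdf _ _; set a3 := cdf _ _.
set b1 := kprim _ _ _; set b2 := kprim _ _ _; set b3 := kprim _ _ _.
set q := e * (_ * _); set z := h * _; set w := e * _.
move: a1 a2 a3 b1 b2 b3 q z w; clear.
by move=> a1 a2 a3 b1 b2 b3 q z w f1 f2 /andP[r1 r2] /andP[r3 r4] p0; lra.
Qed.

Lemma is_derive_nd_ge0 (R : realType) (f : R -> R) (x d : R) (r : R) : 0 < r ->
  (forall y : R, x <= y -> y < x + r -> f x <= f y) -> is_derive x 1 f d -> 0 <= d.
Proof.
move=> r0 fnd /is_derive_epsP fd; rewrite leNgt; apply/negP => d0.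
have d2 : 0 < - d / 2 by rewrite divr_gt0// oppr_gt0.
have [k k0 kP] := fd _ d2.
have [h [h0 hk hr]] : exists h, [/\ 0 < h, h < k & h < r].
  exists (Num.min k r / 2); have m0 : 0 < Num.min k r by rewrite lt_min k0.
  have m1 : Num.min k r <= k by rewrite ge_min lexx.
  have m2 : Num.min k r <= r by rewrite ge_min lexx orbT.
  by split; clear -m0 m1 m2; lra.
have := kP h; rewrite gtr0_norm// => /(_ hk); rewrite ler_norml => /andP[_ h1].
have h2 : f x <= f (x + h) by apply: fnd; rewrite ?ltrD2l// lerDl ltW.
have h3 : d * h < 0 by rewrite nmulr_rlt0.
by clear -h1 h2 h3; lra.
Qed.

(** An inverse function argument without regularity of G: the level eta at time t0 + j corresponds
    to the level eta - j h0 ± e |j| at time t0, carried along by U j ± e |j|. Differentiability of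
    chi(t0, .) at eta then evaluates chi at the displaced level. *)
Lemma chi_time_derivative (R : realType) (u : R -> R -> R)
    (mu : R -> {measure set (measurableTypeR R) -> \bar R}) (T Ms M C : R) (n : nat)
    (n1 : (0 < n)%N) (H : flow u mu T Ms M)
    (massC : forall t : R, 0 <= t <= T -> fine (mu t setT) = C) (t0 eta d : R) :
  0 < t0 < T -> 0 < eta < Kmass n * C + C -> is_derive eta 1 (chi n mu t0) d ->
  is_derive t0 1 (fun t => chi n mu t eta)
    (u t0 (chi n mu t0 eta) - (u t0 (chi n mu t0 eta) * pfun n mu t0 (chi n mu t0 eta)
      - qflux u mu C n t0 (chi n mu t0 eta)) * d).
Proof.
move=> /andP[t00 t0T] etaC dchi.
have tT : 0 <= t0 <= T by rewrite !ltW.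
have qt := Gfun_has_quantile n1 H massC tT.
have chiE s z : chi n mu s z = quantile (Gfun n mu s) z by [].
have /andP[eta0 etaL] := etaC.
have d0 : 0 <= d.
  apply: (is_derive_nd_ge0 (r := Kmass n * C + C - eta) _ _ dchi); first by rewrite subr_gt0.
  move=> y xy yk; rewrite !chiE; apply: (quantile_nd_on qt) => //.
  by move: yk; rewrite addrC subrK.
move/is_derive_epsP : dchi => dchi.
apply/is_derive_epsP => eps eps0.
have [x0 x0E] : exists x0, x0 = chi n mu t0 eta by exists (chi n mu t0 eta).
rewrite -x0E in dchi *.
have [U UE] : exists U, U = u t0 x0 by exists (u t0 x0).
have [h0 h0E] : exists h0, h0 = u t0 x0 * pfun n mu t0 x0 - qflux u mu C n t0 x0.
  by exists (u t0 x0 * pfun n mu t0 x0 - qflux u mu C n t0 x0).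
rewrite -h0E -UE.
have [A AE] : exists A, A = `|h0| + 1 by exists (`|h0| + 1).
have A1 : 1 <= A by rewrite AE lerDr.
have cst0 : 0 < 1 + d + A by clear -A1 d0; lra.
(* The three errors, per unit of |j|: the position shift, the level shift multiplied by the slope d,
   and the remainder of chi(t0, .) over a level displacement of at most A |j|. *)
have [e [e0 e1 eeps]] : exists e, [/\ 0 < e, e <= 1 & e + d * e + e * A <= eps].
  exists (Num.min 1 (eps / (1 + d + A))); split.
  - by rewrite lt_min ltr01 divr_gt0.
  - by rewrite ge_min lexx.
  - have : Num.min 1 (eps / (1 + d + A)) <= eps / (1 + d + A) by rewrite ge_min lexx orbT.
    rewrite ler_pdivlMr//.
    by clear; set z := Num.min _ _; move=> h; apply: le_trans h; rewrite le_eqVlt; apply/orP; left; apply/eqP; ring.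
have [d1 d10 d1P] := dchi e e0.
have [k k0 kP] := Gfun_near n1 H massC e0.
(* A de bounds the displacement of the level: it must stay in the range of the expansion of chi and
   inside ]0, B + C[, and move the position by at most k/2, which leaves k/2 for an auxiliary point
   y. The time must remain in [0, T]. *)
have [de [de0 deA dek dee1 dee2]] : exists de, [/\ 0 < de, A * de < d1,
    (d + 1) * (A * de) <= k / 2, A * de < eta /\ A * de < Kmass n * C + C - eta
    & de <= k /\ de < t0 /\ de < T - t0].
  have pos3 : 0 < Num.min (k / 2 / (d + 1)) (Num.min (d1 / 2) (Num.min (eta / 2) ((Kmass n * C + C - eta) / 2))).
    have ? : 0 < d + 1 by clear -d0; lra.
    by rewrite !lt_min !divr_gt0 ?subr_gt0.
  have pos4 : 0 < Num.min k (Num.min (t0 / 2) ((T - t0) / 2)).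
    by rewrite !lt_min k0 !divr_gt0 ?subr_gt0.
  have A0 : 0 < A by clear -A1; lra.
  move: pos3 pos4; set m3 := Num.min _ _; set m4 := Num.min _ _ => pos3 pos4.
  have := lexx m3; rewrite {2}/m3 !le_min => /andP[q1 /andP[q2 /andP[q3 q4]]].
  have := lexx m4; rewrite {2}/m4 !le_min => /andP[q5 /andP[q6 q7]].
  move: m3 m4 pos3 pos4 q1 q2 q3 q4 q5 q6 q7 => m3 m4 pos3 pos4 q1 q2 q3 q4 q5 q6 q7.
  have q1' : (d + 1) * m3 <= k / 2.
    by rewrite mulrC -ler_pdivlMr//; clear -d0; lra.
  have m3A : A * Num.min (m3 / A) m4 <= m3.
    rewrite mulrC -ler_pdivlMr// ge_min lexx//.
  have m4A : Num.min (m3 / A) m4 <= m4 by rewrite ge_min lexx orbT.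
  exists (Num.min (m3 / A) m4).
  have p0 : 0 < Num.min (m3 / A) m4 by rewrite lt_min pos4 divr_gt0.
  clear -p0 m3A m4A q1' q2 q3 q4 q5 q6 q7 d0 pos3 pos4 eta0 etaL t00 t0T d10 k0.
  split => //; [lra| |split; lra|split;[lra|split; lra]].
  apply: le_trans q1'; apply: ler_wpM2l => //; lra.
exists de => // j jde.
have [t tE] : exists t, t = t0 + j by exists (t0 + j).
have jE : t - t0 = j by rewrite tE addrC addKr.
have jabs : `|j| < de by [].
have j1 := ler_norm j; have j2 := ler_norm (- j); rewrite normrN in j2.
have tT' : 0 <= t <= T.
  by case: dee2 => _ [i1 i2]; rewrite tE; clear -j1 j2 jabs i1 i2; lra.
have qt' := Gfun_has_quantile n1 H massC tT'.
have tk : `|t - t0| <= k.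
  by rewrite jE; case: dee2 => i1 _; apply: le_trans i1; exact: ltW.
have {}kP y := kP t0 t x0 y tT tT' tk; rewrite jE -h0E -UE in kP.
have A0 : 0 < A by clear -A1; lra.
have jA : A * `|j| < A * de by rewrite ltr_pM2l.
have njn := normr_ge0 j.
have shift (g : R) : `|g| <= e -> `|- j * h0 + g * `|j| | <= A * `|j|.
  move=> ge; rewrite (le_trans (ler_normD _ _))// !normrM normrN normr_id.
  rewrite AE mulrDl mul1r mulrC lerD2l ler_piMl// (le_trans ge)//.
have near (g : R) : `|g| <= e ->
    exists eta' x', [/\ eta' = eta + (- j * h0 + g * `|j|), x' = chi n mu t0 eta',
      0 < eta' < Kmass n * C + C,
      `|x' - x0 - d * (- j * h0 + g * `|j|)| <= e * (A * `|j|) & `|x' - x0| <= k / 2].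
  move=> ge; have sg := shift g ge.
  exists (eta + (- j * h0 + g * `|j|)), (chi n mu t0 (eta + (- j * h0 + g * `|j|))).
  have [s sE] : exists s, s = - j * h0 + g * `|j| by exists (- j * h0 + g * `|j|).
  rewrite -sE in sg *.
  have hs := d1P s (le_lt_trans sg (lt_trans jA deA)).
  have s1 := ler_norm s; have s2 := ler_norm (- s); rewrite normrN in s2.
  have hs' : `|chi n mu t0 (eta + s) - x0 - d * s| <= e * (A * `|j|).
    by apply: (le_trans hs); rewrite ler_wpM2l// ltW.
  split => //.
    by case: dee1 => i1 i2; clear -s1 s2 i1 i2 sg jA; apply/andP; split; lra.
  have [Y YE] : exists Y, Y = chi n mu t0 (eta + s) - x0 - d * s.
    by exists (chi n mu t0 (eta + s) - x0 - d * s).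
  have -> : chi n mu t0 (eta + s) - x0 = Y + d * s by rewrite YE subrK.
  rewrite -YE in hs'; apply: (le_trans (ler_normD _ _)); rewrite normrM (ger0_norm d0).
  apply: le_trans dek.
  have b1 : d * `|s| <= d * (A * `|j|) by rewrite ler_wpM2l.
  have b2 : e * (A * `|j|) <= 1 * (A * `|j|) by rewrite ler_wpM2r// mulr_ge0// ltW.
  have b3 : (d + 1) * (A * `|j|) <= (d + 1) * (A * de).
    by apply: ler_wpM2l; [clear -d0; lra|exact: ltW].
  apply: le_trans b3; rewrite mulrDl.
  by clear -hs' b1 b2; lra.
have ee : `|e| <= e by rewrite gtr0_norm.
have eN : `|- e| <= e by rewrite normrN.
have up : chi n mu t eta <= x0 + d * (- j * h0 + e * `|j|) + e * (A * `|j|) + (U * j + e * `|j|).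
  have [eta' [x' [eE xE eC hx xk]]] := near e ee.
  have : chi n mu t eta <= x' + (U * j + e * `|j|).
    apply/ler_addgt0Pr => r r0.
    have [y [yx yr yk]] : exists y, [/\ x' < y, y <= x' + r & y <= x' + k / 2].
      exists (x' + Num.min r (k / 2)); have m0 : 0 < Num.min r (k / 2) by rewrite lt_min r0 divr_gt0.
      by split; rewrite ?ltrDl// lerD2l ge_min lexx ?orbT.
    (* At x' itself [Gfun] may lie below the level; strictly to its right it has reached it, hence
       the auxiliary y > x'. *)
    have Gy : eta' <= Gfun n mu t0 y by apply: (gt_quantile qt eC); rewrite -chiE -xE.
    have yx0 : `|y - x0| <= k.
      by move: xk; rewrite !ler_norml; clear -yx yk k0; lra.
    have [Gt _] := kP y yx0.
    have : quantile (Gfun n mu t) eta <= y + (U * j + e * `|j|).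
      apply: (quantile_le qt' etaC); apply: le_trans Gt.
      rewrite eE in Gy.
      have -> : eta = eta + (- j * h0 + e * `|j|) + j * h0 - e * `|j| by ring.
      by rewrite lerD2r lerD2r.
    rewrite -chiE; clear -yr; lra.
  by move: hx; rewrite ler_norml => /andP[_ +]; clear; lra.
have lo : x0 + d * (- j * h0 - e * `|j|) - e * (A * `|j|) + (U * j - e * `|j|) <= chi n mu t eta.
  have [eta' [x' [eE xE eC hx xk]]] := near (- e) eN.
  have : x' + (U * j - e * `|j|) <= chi n mu t eta.
    apply/ler_addgt0Pr => r r0.
    have [y [yx yr yk]] : exists y, [/\ y < x', x' - r <= y & x' - k / 2 <= y].
      exists (x' - Num.min r (k / 2)); have m0 : 0 < Num.min r (k / 2) by rewrite lt_min r0 divr_gt0.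
      by split; rewrite ?gtrDl ?oppr_lt0// lerD2l lerN2 ge_min lexx ?orbT.
    have Gy : Gfun n mu t0 y < eta' by apply: (lt_quantile qt eC); rewrite -chiE -xE.
    have yx0 : `|y - x0| <= k.
      by move: xk; rewrite !ler_norml; clear -yx yk k0; lra.
    have [_ Gt] := kP y yx0.
    have : y + (U * j - e * `|j|) <= quantile (Gfun n mu t) eta.
      apply: (quantile_ge qt' etaC); apply: (le_lt_trans Gt).
      rewrite eE in Gy.
      have -> : eta = eta + (- j * h0 + - e * `|j|) + j * h0 + e * `|j| by ring.
      by rewrite ltrD2r ltrD2r.
    rewrite -chiE; clear -yr; lra.
  by move: hx; rewrite ler_norml => /andP[+ _]; clear; lra.
have fin : (e + d * e + e * A) * `|j| <= eps * `|j| by rewrite ler_wpM2r.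
rewrite -tE ler_norml.
move: up lo fin; clear.
set X := chi _ _ _ _; set w := `|j| => up lo fin.
have E1 : x0 + d * (- j * h0 + e * w) + e * (A * w) + (U * j + e * w) =
  x0 + (U - h0 * d) * j + (e + d * e + e * A) * w by ring.
have E2 : x0 + d * (- j * h0 - e * w) - e * (A * w) + (U * j - e * w) =
  x0 + (U - h0 * d) * j - (e + d * e + e * A) * w by ring.
rewrite E1 in up; rewrite E2 in lo.
by move: up lo fin; set a := _ * j; set b := _ * w; set c := eps * w; clear; lra.
Qed.

(** * Change of variables to the energy coordinate *)

Lemma derivative_measurable (R : realType) (f g : R -> R) (D : set R) :
  measurable_fun setT f -> measurable D ->
  (forall x, D x -> is_derive x 1 f (g x)) -> measurable_fun D g.
Proof.
move=> mf mD dfg.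
pose q (j : nat) (x : R) := (f (x + j.+1%:R^-1) - f x) / j.+1%:R^-1.
apply: (@measurable_fun_cvg _ _ _ _ q).
  move=> j; apply: measurable_funTS; apply: measurable_funM; last exact: measurable_cst.
  apply: measurable_funB; last exact: mf.
  by apply: (measurableT_comp mf); exact: measurable_addr.
move=> x Dx; have /is_derive_epsP dx := dfg x Dx.
have h_cvg : (fun j : nat => j.+1%:R^-1) @ \oo --> (0 : R) by exact: cvg_harmonic.
apply/cvgrPdist_le => e e0; have [d d0 dP] := dx e e0.
near=> j; have hd : `|j.+1%:R^-1 : R| < d.
  by near: j; apply: (cvgr0_norm_lt _ h_cvg).
have j0 : (0 : R) < j.+1%:R^-1 by [].
have := dP _ hd; rewrite distrC /q -ler_pdivrMr ?normr_gt0 ?gt_eqF//.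
by rewrite -normf_div mulrBl mulfK ?gt_eqF.
Unshelve. all: by end_near. Qed.

Lemma lebesgue_null_setU (R : realType) (A B : set R) : measurable A -> measurable B ->
  @lebesgue_measure R A = 0%E -> @lebesgue_measure R B = 0%E ->
  @lebesgue_measure R (A `|` B) = 0%E.
Proof.
move=> mA mB A0 B0; apply/eqP; rewrite eq_le measure_ge0 andbT.
have := @measureU2 _ _ _ (@lebesgue_measure R) A B mA mB.
by rewrite [X in (_ <= X + _)%E]A0 [X in (_ <= _ + X)%E]B0 adde0.
Qed.

Section energy_image.
Context {R : realType}.
Local Notation lam := (@lebesgue_measure R).
Variables (m : {measure set (measurableTypeR R) -> \bar R}) (n : nat).
Hypothesis n1 : (0 < n)%N.
Hypothesis m_fin : (m setT < +oo)%E.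
Local Notation c := (fine (m setT)).
Local Notation B := (Kmass n * c).
Local Notation F := (cdf m).
Local Notation P := (kprim n m).
Local Notation p := (kconv m n).
Variable G : R -> R.
Hypothesis GE : forall x, G x = P x + F x.
Local Notation X := (quantile G).

Lemma kprim_ge0 (x : R) : 0 <= P x.
Proof. by rewrite kprim.unlock; apply: Rintegral_ge0 => e _; exact: Wn_ge0. Qed.

Lemma kprim_nd (x y : R) : x <= y -> P x <= P y.
Proof.
move=> xy; rewrite kprim.unlock; apply: le_Rintegral => //; try exact: Wn_quantile_integrable.
by move=> e _; apply: Wn_nd => //; rewrite lerD2r.
Qed.

Lemma kprim_le (x : R) : P x <= B.
Proof.
have c0 : 0 <= c by rewrite fine_ge0.
have E := esym (congr1 fine (lebesgue_itvoo0 c0)).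
have -> : B = \int[lam]_(e in `]0%R, c[%classic) (cst (Kmass n) e).
  by rewrite Rintegral_cst//; congr (_ * _).
rewrite kprim.unlock; apply: le_Rintegral => //; first exact: Wn_quantile_integrable.
- apply: (@bounded_fun_integrable _ (measurableTypeR R) R lam _ _ `|Kmass n|) => //.
  by apply: le_lt_trans (ltry c); rewrite -(lebesgue_itvoo0 c0).
- by move=> e _; exact: Wn_le.
Qed.

Lemma kconv_integrable : lam.-integrable setT (EFin \o p).
Proof.
apply/integrableP; split.
  by apply/measurable_EFinP; apply: continuous_measurable_fun; exact: kconv_continuous.
under eq_integral => x _ do rewrite /= ger0_norm ?kconv_ge0//.
by rewrite kconv_mass// ltry.
Qed.

Lemma is_derive_kprim (x : R) : is_derive x 1 P (p x).
Proof.
have -> : P = (fun x => \int[lam]_(t in `]-oo, x]%classic) p t).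
  apply/funext => y; rewrite -Rintegral_itv_bndo_bndc; last first.
    by apply: integrableS kconv_integrable.
  by rewrite kprim.unlock [RHS]/Rintegral kconv_ray.
by apply: is_derive_primitive; [exact: kconv_integrable|exact: kconv_continuous].
Qed.

Lemma kprim_continuous : continuous P.
Proof. by move=> x; exact: is_derive_continuous (is_derive_kprim x). Qed.

Lemma energy_has_quantile : has_quantile G (B + c).
Proof.
have [N [NT Ncdf _]] := energy_measure_exists n1 m_fin.
have -> : G = cdf N by apply/funext => x; rewrite GE Ncdf.
have -> : B + c = fine (N setT) by rewrite NT.
by apply: cdf_has_quantile; rewrite NT ltry.
Qed.

Let qG := energy_has_quantile.

(** The level is known to be reached by G only strictly to the right of the quantile. P is
    continuous, unlike F, so its lower bounds pass to the quantile itself. *)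
Let kprim_right (z r : R) (a : R) : 0 < r -> (forall x, z < x -> x < z + r -> a <= P x) -> a <= P z.
Proof.
move=> r0 h; apply/ler_addgt0Pr => e e0.
have : \forall y \near z, `|P z - P y| <= e.
  by have /cvgrPdist_le := @kprim_continuous z; apply.
move=> /nbhs_normP[d d0 dP].
have m0 : 0 < Num.min r d by rewrite lt_min r0.
have m1 : Num.min r d <= r by rewrite ge_min lexx.
have m2 : Num.min r d <= d by rewrite ge_min lexx orbT.
have h1 := h (z + Num.min r d / 2).
have h2 : `|P z - P (z + Num.min r d / 2)| <= e.
  apply: dP => /=; rewrite opprD addrA subrr add0r normrN gtr0_norm ?divr_gt0//.
  by move: m0 m2; set w := Num.min _ _; lra.
move: m0 m1 h1 h2; set w := Num.min _ _ => m0 m1 h1 h2.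
have {}h1 : a <= P (z + w / 2) by apply: h1; lra.
by move: h2; rewrite ler_norml => /andP[h2 h3]; lra.
Qed.

Lemma energy_quantile_le (eta : R) : 0 < eta < B + c -> G (X eta) <= eta.
Proof.
move=> he; apply/ler_addgt0Pr => e e0; have [_ lc _ _] := qG.
have [d d0 dP] := lc (X eta) e e0.
rewrite -lerBlDr; apply: (le_trans dP); apply: ltW.
by apply: (lt_quantile qG he); rewrite ltrBlDr ltrDl.
Qed.

(** The share of the level eta that comes from P. The constant extensions keep it nondecreasing and
    1-Lipschitz on the whole line, as [lipschitz_FTC] requires. *)
Let cap (eta : R) : R := if eta <= 0 then 0 else if eta < B + c then P (X eta) else B.

Let B0 : 0 <= B.
Proof. by apply: mulr_ge0; [exact: Kmass_ge0|exact: fine_ge0]. Qed.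

Let PX_le (a : R) : 0 < a < B + c -> P (X a) <= a.
Proof.
move=> ha; have := energy_quantile_le ha; rewrite GE.
by have := cdf_ge0 m (X a); lra.
Qed.

Let PX_ge (a : R) : 0 < a < B + c -> a - c <= P (X a).
Proof.
move=> ha; apply: (kprim_right ltr01) => x xa _.
have := gt_quantile qG ha xa; rewrite GE.
by have := cdf_le_mass m_fin x; lra.
Qed.

(** For x between X(a) and X(b), P + F is at least a at x and at most b at X(b), while F does not
    decrease; so P grows by at most b - a. Then x tends to X(a). *)
Let PX_lip (a b : R) : 0 < a -> a <= b -> b < B + c -> 0 <= P (X b) - P (X a) <= b - a.
Proof.
move=> a0 ab bc; have ha : 0 < a < B + c by rewrite a0 (le_lt_trans ab).
have hb : 0 < b < B + c by rewrite bc (lt_le_trans a0).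
have XX := quantile_nd_on qG a0 ab bc.
rewrite subr_ge0 kprim_nd//=.
have : P (X b) - (b - a) <= P (X a).
  have [r [r0 rX]] : exists r, 0 < r /\ (X a < X b -> r = X b - X a).
    have [ltX|geX] := ltP (X a) (X b); first by exists (X b - X a); rewrite subr_gt0.
    by exists 1; split.
  move: XX; rewrite le_eqVlt => /predU1P[->|ltX]; first by lra.
  have rE := rX ltX.
  apply: (kprim_right r0) => x xa xb.
  have Gx := gt_quantile qG ha xa; have Gb := energy_quantile_le hb.
  have xb' : x <= X b by lra.
  rewrite !GE in Gx Gb; have := cdf_nd m_fin xb'; lra.
by lra.
Qed.

Let cap_lip (a b : R) : a <= b -> 0 <= cap b - cap a <= b - a.
Proof.
move=> ab; rewrite /cap; have b0 := B0.
have c0 : 0 <= c by rewrite fine_ge0.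
have [a0|a0] := leP a 0; have [b0'|b0'] := leP b 0; last 2 first.
- by exfalso; lra.
- have [aL|aL] := ltP a (B + c); have [bL|bL] := ltP b (B + c); last 2 first.
  + by exfalso; lra.
  + by lra.
  + by exact: PX_lip.
  + have ha : 0 < a < B + c by rewrite a0.
    by have := PX_ge ha; have := kprim_le (X a); lra.
- by lra.
- have [bL|bL] := ltP b (B + c); last by lra.
  have hb : 0 < b < B + c by rewrite b0'.
  by have := PX_le hb; have := kprim_ge0 (X b); lra.
Qed.

(** X(G(x)) may lie to the left of x, but then G is constant in between, and so are its two
    nondecreasing summands. *)
Let capG (x : R) : cap (G x) = P x.
Proof.
have h0 := kprim_ge0 x; have h1 := cdf_ge0 m x; have h2 := kprim_le x.
have h3 := cdf_le_mass m_fin x; rewrite /cap.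
have [g0|g0] := leP (G x) 0; first by rewrite GE in g0; lra.
have [gL|gL] := ltP (G x) (B + c); last by rewrite GE in gL; lra.
have hG : 0 < G x < B + c by rewrite g0.
have Xx := quantile_le qG hG (lexx (G x)).
apply/eqP; rewrite eq_le kprim_nd//=.
have [lt|xX] := ltP (X (G x)) x; last by apply: kprim_nd.
have r0 : 0 < x - X (G x) by rewrite subr_gt0.
apply: (kprim_right r0) => y y1 y2.
have yx : y <= x by lra.
have := gt_quantile qG hG y1; rewrite !GE.
by have := kprim_nd yx; have := cdf_nd m_fin yx; lra.
Qed.

Variables (dX : R -> R) (N : set R).
Hypotheses (mN : measurable N) (N0 : lam N = 0%E).
Hypothesis derX : forall eta : R, 0 < eta < B + c -> ~ N eta -> is_derive eta 1 X (dX eta).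

Let der_cap (eta : R) : 0 < eta < B + c -> ~ N eta ->
  is_derive eta 1 cap (p (X eta) * dX eta).
Proof.
move=> he Ne; have := is_derive1_comp (is_derive_kprim (X eta)) (derX he Ne).
move=> /is_derive_epsP h; apply/is_derive_epsP => e e0; have [d d0 dP] := h e e0.
have /andP[e1 e2] := he.
exists (Num.min d (Num.min eta (B + c - eta))).
  by rewrite !lt_min d0 e1 subr_gt0 e2.
move=> k; rewrite !lt_min => /andP[k1 /andP[k2 k3]].
have := ler_norm k; have := ler_norm (- k); rewrite normrN => q1 q2.
have := dP k k1; rewrite /cap /=.
have [w1|w1] := leP eta 0; first by exfalso; lra.
have [w2|w2] := leP (eta + k) 0; first by exfalso; lra.
have [w3|w3] := ltP eta (B + c); last by exfalso; lra.
by have [w4|w4] := ltP (eta + k) (B + c); last by exfalso; lra.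
Qed.

Let w : R -> R := (fun eta => 1 - p (X eta) * dX eta) \_ (`]0, B + c[%classic `\` N).

Let mL : measurable (`]0, B + c[%classic `\` N : set R).
Proof. by apply: measurableD. Qed.

(** The complementary share, that of F: by [capG] its value at G(x) is F(x). Its derivative is the
    weight [w], which is therefore nonnegative. *)
Let cocap (eta : R) : R := eta - cap eta.

Let cocap_lip (a b : R) : a <= b -> 0 <= cocap b - cocap a <= b - a.
Proof. by move=> ab; rewrite /cocap; have := cap_lip ab; lra. Qed.

Let der_cocap (eta : R) : 0 < eta < B + c -> ~ N eta ->
  is_derive eta 1 cocap (1 - p (X eta) * dX eta).
Proof.
by move=> he Ne; exact: (is_deriveB (is_derive_id eta 1) (der_cap he Ne)).
Qed.

Let mw : measurable_fun setT w.
Proof.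
apply/(measurable_restrictT _ _).1 => //.
apply: (@derivative_measurable _ cocap) => //.
  apply: nondecreasing_measurable => // x y xy.
  by have /andP[+ _] := cocap_lip xy; rewrite subr_ge0.
by move=> x [/=]; rewrite in_itv /= => hx Nx; exact: der_cocap.
Qed.

Let w_ge0 (x : R) : 0 <= w x.
Proof.
rewrite /w patchE; case: ifPn => // /set_mem[/=]; rewrite in_itv /= => hx Nx.
apply: (is_derive_nd_ge0 ltr01 _ (der_cocap hx Nx)) => y xy _.
by have /andP[+ _] := cocap_lip xy; rewrite subr_ge0.
Qed.

Let g : R -> R := X \_ `]0, B + c[%classic.

Let mg : measurable_fun setT g.
Proof.
by apply/(measurable_restrictT _ _).1 => //; exact: (measurable_quantile qG).
Qed.

Let gE (x : R) : 0 < x < B + c -> g x = X x.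
Proof. by move=> xc; rewrite /g patchE mem_set//= in_itv. Qed.

(** Where [w] does not vanish, the set is ]0, G(x)[ up to the point G(x), and the integral of the
    derivative of [cocap] over that interval is F(x). *)
Let w_ray (x : R) : (\int[lam]_(e in [set e : R | (g e < x)%R]) (w e)%:E = m `]-oo, x[%classic)%E.
Proof.
have h0 := kprim_ge0 x; have h1 := cdf_ge0 m x; have h2 := kprim_le x.
have h3 := cdf_le_mass m_fin x.
have G0 : 0 <= G x by rewrite GE addr_ge0.
have GL : G x <= B + c by rewrite GE lerD.
have -> : m `]-oo, x[%classic = (F x)%:E by rewrite /cdf -measure_finE.
have -> : F x = cocap (G x) - cocap 0.
  by rewrite /cocap capG /cap lexx GE; ring.
have hd (y : R) : 0 < y < G x -> ~ N y -> is_derive y 1 cocap (w y).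
  move=> /andP[y0 yG] Ny; have hy : 0 < y < B + c by rewrite y0 (lt_le_trans yG).
  have hy' : (`]0, B + c[%classic `\` N) y by split; [rewrite /= in_itv|].
  by rewrite /w patchE (mem_set hy'); exact: der_cocap.
rewrite -(lipschitz_FTC G0 cocap_lip mN N0 hd).
rewrite integral_mkcond [RHS]integral_mkcond.
apply: (@ae_eq_integral_nomeas _ _ _ lam setT (N `|` [set G x])).
- by apply: measurableU.
- by apply: lebesgue_null_setU => //; exact: lebesgue_measure_set1.
move=> e _ Ne; have {Ne}[Ne eG] : ~ N e /\ e <> G x.
  by split => h; apply: Ne; [left|right].
rewrite !patchE; case: ifPn => he; case: ifPn => hG => //.
- move/set_mem : he => /= he; rewrite /w patchE; case: ifPn => // /set_mem[/=].
  rewrite in_itv /= => hL _; exfalso; rewrite gE// in he.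
  have := gt_quantile qG hL he; rewrite le_eqVlt => /predU1P[//|lt].
  by move/negP : hG; apply; apply/mem_set; rewrite /= in_itv /= lt; case/andP : hL => ->.
- move/set_mem : hG => /=; rewrite in_itv /= => /andP[e0 eGx]; exfalso.
  have hL : 0 < e < B + c by rewrite e0 (lt_le_trans eGx).
  by move/negP : he; apply; apply/mem_set; rewrite /= gE//; exact: (quantile_lt qG hL eGx).
Qed.

Lemma energy_image (phi : R -> \bar R) : measurable_fun setT phi ->
  (\int[m]_x phi x = \int[lam]_(e in `[0%R, (B + c)%R]%classic)
     (phi (X e) * (1 - p (X e) * dX e)%:E))%E.
Proof.
move=> mphi; rewrite (finite_measure_weighted_image mw mg w_ge0 m_fin w_ray mphi).
rewrite [RHS]integral_mkcond.
apply: (@ae_eq_integral_nomeas _ _ _ lam setT (N `|` ([set 0] `|` [set (B + c)%R]))).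
- by apply: measurableU => //; apply: measurableU.
- apply: lebesgue_null_setU => //; first by apply: measurableU.
  by apply: lebesgue_null_setU => //; exact: lebesgue_measure_set1.
move=> e _ Ne; have {Ne}[Ne e0 eL] : [/\ ~ N e, e <> 0 & e <> B + c].
  by split => h; apply: Ne; [left|right; left|right; right].
rewrite patchE; case: ifPn => [/set_mem|/negP he].
  rewrite /= in_itv /= => /andP[]; rewrite !le_eqVlt => /predU1P[/esym//|e1] /predU1P[//|e2].
  have hL : 0 < e < B + c by rewrite e1.
  by rewrite gE// /w patchE mem_set//=; split => //=; rewrite in_itv.
rewrite /w patchE; case: ifPn => [/set_mem[/=]|]; last by rewrite mule0.
rewrite in_itv /= => /andP[e1 e2] _; exfalso; apply: he; apply/mem_set.
by rewrite /= in_itv /= !ltW.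
Qed.
End energy_image.

(** * Solutions *)

Lemma powR_le (R : realType) (r a b : R) : 0 <= r -> 0 <= a -> a <= b -> a `^ r <= b `^ r.
Proof.
move=> r0 a0 ab; apply: (ge0_ler_powR r0) => //; rewrite nnegrE//.
exact: le_trans ab.
Qed.

Lemma powR_le_self (R : realType) (r z : R) : 1 <= r -> 0 <= z <= 1 -> z `^ r <= z.
Proof.
move=> r1 /andP[z0 z1]; have [->|zn] := eqVneq z 0.
  by rewrite powR0// gt_eqF// (lt_le_trans ltr01).
have -> : r = 1 + (r - 1) by ring.
rewrite powRD; last by rewrite zn implybT.
rewrite powRr1// ler_piMr//.
have e1 : 1 `^ (r - 1) = 1 :> R by rewrite powR1.
by rewrite -[X in _ <= X]e1; apply: powR_le => //; rewrite subr_ge0.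
Qed.

Lemma powR_small (R : realType) (a L e : R) : 0 < a -> 0 <= L -> 0 < e ->
  exists2 r : R, 0 < r & forall z : R, 0 <= z <= r -> L * z `^ a <= e.
Proof.
move=> a0 L0 e0; have L1 : 0 < L + 1 by rewrite ltr_wpDl.
exists ((e / (L + 1)) `^ a^-1); first by rewrite powR_gt0// divr_gt0.
move=> z /andP[z0 zr].
have h : z `^ a <= e / (L + 1).
  apply: (le_trans (powR_le (ltW a0) z0 zr)).
  by rewrite -powRrM mulVf ?gt_eqF// powRr1// divr_ge0// ltW.
apply: (le_trans (ler_wpM2l L0 h)).
rewrite mulrCA ler_piMr ?(ltW e0)// ler_pdivrMr// mul1r.
by rewrite lerDl.
Qed.

(** If f^2 were at least S + 1 on a unit interval, with S the squared norm, its integral would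
    exceed S. Combined with Hölder continuity this turns an L^2 bound into a uniform one. *)
Lemma L2_bounded_somewhere (R : realType) (f : R -> R) : L2 f ->
  exists S : R, 0 <= S /\ forall x : R, exists2 y, x <= y <= x + 1 & `|f y| <= S.
Proof.
move=> [mf ffin].
have f2 : (0 <= L2norm2 f)%E by apply: integral_ge0 => x _; rewrite lee_fin sqr_ge0.
have [S SE] : exists S : R, L2norm2 f = S%:E.
  exists (fine (L2norm2 f)); rewrite fineK// ge0_fin_numE//.
have S0 : 0 <= S by rewrite -lee_fin -SE.
exists (S + 2); split; first by rewrite addr_ge0.
move=> x; apply: contrapT => no.
have big y : x <= y <= x + 1 -> S + 1 <= (f y) ^+ 2.
  move=> xy; have [//|/ltW h] := leP (S + 1) ((f y) ^+ 2); exfalso; apply: no; exists y => //.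
  have := real_normK (num_real (f y)) => E; rewrite -E in h.
  have := normr_ge0 (f y); have := sqr_ge0 (`|f y| - 1); clear -h S0; nra.
have : ((S + 1)%:E <= L2norm2 f)%E.
  apply: (@le_trans _ _ (\int[@lebesgue_measure R]_(y in `[x, (x + 1)%R]) (S + 1)%:E)%E).
    rewrite integral_cst//= lebesgue_measure_itv /= lte_fin ltrDl ltr01.
    by rewrite -EFinB addrAC subrr add0r mule1.
  apply: (@le_trans _ _ (\int[@lebesgue_measure R]_(y in `[x, (x + 1)%R]) ((f y) ^+ 2)%:E)%E).
    apply: le_integral_nomeas => y /=; rewrite in_itv /= => hy.
    by rewrite lee_fin big.
  apply: ge0_subset_integral => //.
    apply/measurable_EFinP; exact: measurable_funX.
  by move=> y _; rewrite lee_fin sqr_ge0.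
by rewrite SE lee_fin; clear; lra.
Qed.

(** Constancy of the mass is deduced from [flow], so here the mass is bounded by its maximum over
    [0, T], attained because it is continuous in t. For the bound on u, every x has within distance
    1 a point where u(0, .) is controlled; Hölder continuity covers the rest. *)
Lemma flow_of_solution (R : realType) (psip psim : R -> R) (u ux : R -> R -> R)
    (mu : R -> {measure set (measurableTypeR R) -> \bar R}) (T : R) :
  psi_pair psip psim -> weak_conservative_solution psip psim u ux mu -> 0 < T ->
  exists Ms M : R, flow u mu T Ms M.
Proof.
move=> [_ [_ [_ [p01 [m01 _]]]]] [uE2 [_ [mfin [weak [hol [_ nar]]]]]] T0.
have [[al [L [/andP[al0 al1] [L0 hL]]]] _] := hol T T0.
have fin t : 0 <= t <= T -> (mu t setT < +oo)%E by move=> /andP[t0 _]; case: (mfin t t0).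
have mass t : fine (\int[mu t]_x (1 : R)%:E) = fine (mu t setT).
  by rewrite integral_cst// mul1e.
have c1 : continuous (fun _ : R => 1 : R) by move=> x; exact: cvg_cst.
have massc : {within `[0, T], continuous (fun t => fine (mu t setT))}.
  have b1 : exists B : R, forall x : R, `|1 : R| <= B by exists 1 => x; rewrite normr1.
  have := nar _ c1 b1.
  rewrite (_ : (fun t => fine (\int[mu t]_x 1%:E)) = (fun t => fine (mu t setT))); last first.
    by apply/funext => t; exact: mass.
  apply: continuous_subspaceW.
  by move=> x /=; rewrite !in_itv /= => /andP[-> _].
have [t1 _ t1P] := EVT_max (ltW T0) massc.
have [fb [a [b [[fb2 _] u0E]]]] := uE2 0 (lexx 0).
have [S [S0 SP]] := L2_bounded_somewhere fb2.
exists (fine (mu t1 setT)), (S + `|a| + `|b| + L * (T + 1) `^ al); split => //.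
- move=> f cf fB t0 t0T e e0.
  have At0 : `[0, +oo[%classic t0 by rewrite /= in_itv /= andbT; case/andP: t0T.
  have [d d0 dP] := within_continuous_epsP (nar f cf fB) At0 e0.
  exists d => // t tT; apply: dP.
  by rewrite /= in_itv /= andbT; case/andP: tT.
- by move=> F /weak[].
- move=> t x tT; have [y xy fy] := SP x.
  have zT : 0 <= (0 : R) <= T by rewrite lexx ltW.
  have h1 := hL 0 t x y zT tT.
  have h2 : L * (`|t - 0| + `|x - y|) `^ al <= L * (T + 1) `^ al.
    rewrite ler_wpM2l//; apply: powR_le; first exact: ltW.
      by rewrite addr_ge0.
    rewrite subr0 lerD//; first by rewrite ger0_norm; case/andP: tT.
    by rewrite distrC ger0_norm; clear -xy; lra.
  have h3 : `|u 0 y| <= S + `|a| + `|b|.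
    rewrite u0E (le_trans (ler_normD _ _))// lerD//.
      rewrite (le_trans (ler_normD _ _))// lerD// normrM ler_piMr//.
      by have /andP[i1 i2] := p01 y; rewrite ger0_norm.
    rewrite normrM ler_piMr//.
    by have /andP[i1 i2] := m01 y; rewrite ger0_norm.
  have -> : u t x = (u t x - u 0 y) + u 0 y by rewrite subrK.
  apply: (le_trans (ler_normD _ _)).
  by clear -h1 h2 h3; lra.
- move=> e e0; have [r r0 rP] := powR_small al0 L0 e0.
  exists (r / 2); first by rewrite divr_gt0.
  move=> s t x y sT tT ts xy; apply: (le_trans (hL s t x y sT tT)).
  apply: rP; rewrite addr_ge0//=.
  by clear -ts xy; lra.
Qed.

(** * Convergence in L^gamma *)

Lemma powR_add_le (R : realType) (r a b : R) : 0 <= r -> 0 <= a -> 0 <= b ->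
  (a + b) `^ r <= 2 `^ r * (a `^ r + b `^ r).
Proof.
move=> r0 a0 b0; have [ab|ba] := leP a b.
  apply: (@le_trans _ _ ((2 * b) `^ r)).
    by apply: powR_le => //; [exact: addr_ge0|lra].
  by rewrite powRM// ler_wpM2l ?powR_ge0// lerDr powR_ge0.
apply: (@le_trans _ _ ((2 * a) `^ r)).
  by apply: powR_le => //; [exact: addr_ge0|lra].
by rewrite powRM// ler_wpM2l ?powR_ge0// lerDl powR_ge0.
Qed.

(** The claim is |z|^r <= (1 + z^2)^(n-1); for |z| > 1 it follows from r <= n <= 2 (n - 1). *)
Lemma Kn_moment (R : realType) (n : nat) (r z : R) : 0 <= r -> r <= n%:R -> (1 < n)%N ->
  `|z| `^ r * Kn n z <= Kn 1 z.
Proof.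
move=> r0 rn n1; have b0 := Kn_base_gt0 z.
rewrite /Kn ler_pdivrMr ?exprn_gt0// expr1.
have -> : (1 + z ^+ 2)^-1 * (1 + z ^+ 2) ^+ n = (1 + z ^+ 2) ^+ n.-1.
  by case: n n1 {rn} => // k _; rewrite (exprS _ k) mulrA mulVf ?mul1r// gt_eqF.
have b1 : 1 <= 1 + z ^+ 2 by rewrite lerDl sqr_ge0.
have [z1|z1] := leP `|z| 1.
  apply: (@le_trans _ _ 1); last by rewrite exprn_ege1.
  have e1 : 1 `^ r = 1 :> R by rewrite powR1.
  by rewrite -[X in _ <= X]e1; apply: powR_le.
apply: (@le_trans _ _ (`|z| `^ n%:R)); first by apply: ler_powR => //; exact: ltW.
rewrite powR_mulrn//; apply: (@le_trans _ _ ((`|z| ^+ 2) ^+ n.-1)).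
  rewrite -exprM ler_weXn2l ?(ltW z1)//.
  by case: n n1 {rn} => [|[|k]]//= _; rewrite mulnS mul2n -addnn !addSn add0n ltnS ltnS leq_addr.
have z20 : 0 <= `|z| ^+ 2 by exact: exprn_ge0.
by rewrite lerXn2r ?nnegrE ?(ltW b0)// real_normK ?num_real// lerDr.
Qed.

Lemma Kn_weighted_moment (R : realType) (n : nat) (r x y : R) :
  0 <= r -> r <= n%:R -> (1 < n)%N ->
  `|x| `^ r * Kn n (x - y) <= 2 `^ r * (1 + `|y| `^ r) * Kn 1 (x - y).
Proof.
move=> r0 rn n1; have k0 := Kn_ge0 n (x - y).
have h1 : `|x| `^ r <= 2 `^ r * (`|x - y| `^ r + `|y| `^ r).
  apply: le_trans (powR_add_le r0 (normr_ge0 _) (normr_ge0 _)).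
  by apply: powR_le => //; rewrite -{1}(subrK y x) ler_normD.
apply: (le_trans (ler_wpM2r k0 h1)).
rewrite -!mulrA ler_wpM2l ?powR_ge0// !mulrDl mul1r lerD//; first exact: Kn_moment.
rewrite ler_wpM2l ?powR_ge0//.
have b0 := Kn_base_gt0 (x - y).
by rewrite lef_pV2 ?posrE ?exprn_gt0// ler_weXn2l ?(ltnW n1)// lerDl sqr_ge0.
Qed.

(** * Moments of p dx and of chi at a fixed time *)

Section moments.
Context {R : realType}.
Local Notation lam := (@lebesgue_measure R).
Variables (m : {measure set (measurableTypeR R) -> \bar R}) (n : nat) (r : R).
Hypotheses (r0 : 0 <= r) (rn : r <= n%:R) (n2 : (1 < n)%N).
Hypothesis m_fin : (m setT < +oo)%E.
Hypothesis m_moment : (\int[m]_x (1 + `|x| `^ r)%:E < +oo)%E.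

Let n1 : (0 < n)%N := ltnW n2.

Lemma measurable_normr_powR : measurable_fun setT ((fun x => `|x| `^ r) : measurableTypeR R -> measurableTypeR R).
Proof. by apply: (measurableT_comp (measurable_powR r)); exact: (@normr_measurable R setT). Qed.

Let m1 : measurable_fun setT (fun x : measurableTypeR R => (1 + `|x| `^ r)%:E).
Proof.
by apply/measurable_EFinP; apply: measurable_funD => //; exact: measurable_normr_powR.
Qed.

Let pos1 (x : R) : 0 <= 1 + `|x| `^ r.
Proof. by rewrite addr_ge0// powR_ge0. Qed.

(** By Tonelli each mass point y contributes the integral of |x|^r K(x - y), at most a constant
    times 1 + |y|^r; the integrable kernel with exponent 1 supplies the constant. *)
Lemma kconv_moment : (\int[lam]_x (`|x| `^ r * kconv m n x)%:E < +oo)%E.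
Proof.
rewrite (kconv_tonelli m_fin n1 measurable_normr_powR); last by move=> x; exact: powR_ge0.
have [D DE] : exists D : R, D = 2 `^ r * Kmass 1 by exists (2 `^ r * Kmass 1).
have D0 : 0 <= D by rewrite DE mulr_ge0 ?powR_ge0 ?Kmass_ge0.
apply: (@le_lt_trans _ _ (\int[lam]_(e in `]0%R, (fine (m setT))[)
    ((fun x : R => D%:E * (1 + `|x| `^ r)%:E)%E (quantile (cdf m) e)))%E).
  apply: le_integral_nomeas => e _ /=; set X := quantile _ _.
  apply: (@le_trans _ _ (\int[lam]_x ((2 `^ r * (1 + `|X| `^ r))%:E * (Kn 1 (x - X))%:E))%E).
    by apply: le_integral_nomeas => x _; rewrite -EFinM lee_fin Kn_weighted_moment.
  rewrite ge0_integralZl//.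
  - by rewrite (integral_Kn_sub (ltn0Sn 0)) -!EFinM lee_fin DE le_eqVlt; apply/orP; left; apply/eqP; ring.
  - apply/measurable_EFinP; apply: measurableT_comp; first exact: (@measurable_Kn _ 1 (ltn0Sn 0)).
    exact: measurable_funB.
  - by move=> x _; rewrite lee_fin Kn_ge0.
rewrite -(quantile_image m_fin (f := fun x : R => (D%:E * (1 + `|x| `^ r)%:E)%E)); last first.
  exact: measurable_funeM.
rewrite ge0_integralZl; [exact: lte_mul_pinfty|by []|exact: m1| |by rewrite lee_fin].
by move=> x _ /=; rewrite lee_fin.
Qed.

Lemma energy_moment (G : R -> R) : (forall x, G x = kprim n m x + cdf m x) ->
  (\int[lam]_(e in `]0%R, (Kmass n * fine (m setT) + fine (m setT))%R[)
     (`|quantile G e| `^ r)%:E < +oo)%E.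
Proof.
move=> GE; have [N [NT Ncdf Nint]] := energy_measure_exists n1 m_fin.
have -> : G = cdf N by apply/funext => x; rewrite GE Ncdf.
have Nfin : (N setT < +oo)%E by rewrite NT ltry.
have mp : measurable_fun setT (fun x : R => (`|x| `^ r)%:E).
  by apply/measurable_EFinP; exact: measurable_normr_powR.
have -> : Kmass n * fine (m setT) + fine (m setT) = fine (N setT) by rewrite NT.
have p0 (x : R) : (0 <= (`|x| `^ r)%:E)%E by rewrite lee_fin powR_ge0.
rewrite -(quantile_image Nfin mp) (Nint _ mp p0).
apply: lte_add_pinfty.
  by apply: le_lt_trans kconv_moment; apply: le_integral_nomeas => x _; rewrite EFinM.
apply: le_lt_trans m_moment; apply: le_integral_nomeas => x _.
by rewrite lee_fin lerDr.
Qed.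
End moments.

(** * Families that are Lipschitz in time, uniformly in the level *)

Section Lp_flow.
Context {R : realType}.
Local Notation lam := (@lebesgue_measure R).
Variables (phi : R -> R -> R) (T L M r : R).
Hypotheses (L0 : 0 <= L) (M0 : 0 <= M) (r1 : 1 <= r).
Hypothesis mphi : forall s, 0 <= s <= T -> measurable_fun `]0, L[%classic (phi s).
Hypothesis phi_lip : forall s t eta, 0 <= s <= T -> 0 <= t <= T -> 0 < eta < L ->
  `|phi t eta - phi s eta| <= M * `|t - s|.

Let r0 : 0 <= r. Proof. exact: le_trans r1. Qed.

Lemma integral_cc_oo (f : R -> \bar R) : (forall x, (0 <= f x)%E) ->
  (\int[lam]_(x in `[0%R, L]) f x = \int[lam]_(x in `]0%R, L[) f x)%E.
Proof.
move=> f0; rewrite (@ge0_integral_setD_null_nomeas _ _ _ lam _ ([set 0] `|` [set L]))//.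
- congr (integral _ _ _); apply/seteqP; split => x /=; rewrite !in_itv /=.
    move=> [/andP[x0 xL] nx]; rewrite !lt_neqAle x0 xL !andbT.
    by apply/andP; split; apply/eqP => e; apply: nx; [left|right].
  move=> /andP[x0 xL]; rewrite !ltW//; split => // -[] e.
    by move: x0; rewrite e ltxx.
  by move: xL; rewrite e ltxx.
- exact: measurableU.
- by apply: lebesgue_null_setU => //; exact: lebesgue_measure_set1.
Qed.

Lemma measurable_cc_oo (f : R -> R) :
  measurable_fun `]0, L[%classic f -> measurable_fun `[0, L]%classic f.
Proof.
by move=> mf; apply/measurable_fun_itv_bndo_bndcP; apply/measurable_fun_itv_obnd_cbndP.
Qed.

Lemma Lp_bound (f : R -> R) (b : R) : (forall x, 0 < x < L -> `|f x| <= b) ->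
  (\int[lam]_(x in `[0%R, L]) (`|f x| `^ r)%:E <= (b `^ r * L)%:E)%E.
Proof.
move=> fb; rewrite integral_cc_oo; last by move=> x; rewrite lee_fin powR_ge0.
apply: (@le_trans _ _ (\int[lam]_(x in `]0%R, L[) (b `^ r)%:E)%E).
  apply: le_integral_nomeas => x /=; rewrite in_itv /= => hx.
  by rewrite lee_fin; apply: powR_le => //; exact: fb.
have l1 := lebesgue_itvoo0 L0.
by rewrite EFinM -[X in (_ <= _ * X)%E]l1 integral_cst.
Qed.

Lemma Lp_continuity (t e : R) : 0 <= t <= T -> 0 < e -> exists2 d : R, 0 < d &
  forall s, 0 <= s <= T -> `|s - t| < d ->
   (\int[lam]_(x in `[0%R, L]) (`|phi s x - phi t x| `^ r)%:E <= e%:E)%E.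
Proof.
move=> tT e0; have r00 : 0 < r by apply: lt_le_trans r1.
have [d d0 dP] := powR_small r00 L0 e0.
have M1 : 0 < M + 1 by rewrite ltr_wpDl.
exists (d / (M + 1)); first exact: divr_gt0.
move=> s sT st.
apply: (le_trans (Lp_bound (b := M * `|s - t|) _)).
  by move=> x hx; exact: phi_lip.
rewrite lee_fin mulrC; apply: dP; rewrite mulr_ge0//=.
rewrite ltr_pdivlMr// in st; apply: le_trans (ltW st).
by rewrite mulrC ler_wpM2l// lerDl.
Qed.

(** The two functions differ by a bounded function on a bounded interval, so integrability at one
    time passes to all others. *)
Lemma Lp_moment (s t : R) : 0 <= s <= T -> 0 <= t <= T ->
  (\int[lam]_(x in `]0%R, L[) (`|phi s x| `^ r)%:E < +oo)%E ->
  (\int[lam]_(x in `[0%R, L]) (`|phi t x| `^ r)%:E < +oo)%E.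
Proof.
move=> sT tT sfin; rewrite integral_cc_oo; last by move=> x; rewrite lee_fin powR_ge0.
have ms : measurable_fun `]0, L[%classic (fun x => (`|phi s x| `^ r)%:E).
  apply/measurable_EFinP.
  apply: (measurableT_comp (measurable_powR r)); apply: (measurableT_comp (@normr_measurable _ setT)).
  exact: mphi.
have c0 : 0 <= (M * `|t - s|) `^ r by rewrite powR_ge0.
apply: (@le_lt_trans _ _ (\int[lam]_(x in `]0%R, L[)
    ((2 `^ r)%:E * ((`|phi s x| `^ r)%:E + ((M * `|t - s|) `^ r)%:E)))%E).
  apply: le_integral_nomeas => x /=; rewrite in_itv /= => hx.
  rewrite -EFinD -EFinM lee_fin.
  apply: le_trans (powR_add_le r0 (normr_ge0 _) (mulr_ge0 M0 (normr_ge0 _))).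
  apply: powR_le => //; rewrite -(subrK (phi s x) (phi t x)) addrC.
  by rewrite (le_trans (ler_normD _ _))// lerD2l phi_lip.
have c0' : (0 <= ((M * `|t - s|) `^ r)%:E)%E by rewrite lee_fin.
have p0 (x : R) : (0 <= (`|phi s x| `^ r)%:E)%E by rewrite lee_fin powR_ge0.
have two0 : (0 <= (2 `^ r : R)%:E)%E by rewrite lee_fin powR_ge0.
rewrite ge0_integralZl; [|by []| | |exact: two0].
- apply: lte_mul_pinfty => //.
  rewrite ge0_integralD; [|by []|by []|exact: ms|by []|exact: measurable_cst].
  apply: lte_add_pinfty; first exact: sfin.
  rewrite integral_cst//; apply: lte_mul_pinfty => //.
  by apply: le_lt_trans (ltry L); rewrite -(lebesgue_itvoo0 L0).
- by apply: emeasurable_funD => //; exact: measurable_cst.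
- by move=> x _; rewrite adde_ge0.
Qed.

Variables (N : set R) (t : R) (D : R -> R).
Hypotheses (mN : measurable N) (N0 : lam N = 0%E) (tT : 0 < t < T).
Hypothesis D_out : forall x, ~ (`]0, L[%classic `\` N) x -> D x = 0.
Hypothesis D_in : forall x, 0 < x < L -> ~ N x -> is_derive t 1 (phi ^~ x) (D x).

Let q (k : R) (x : R) : R := (phi (t + k) x - phi t x) / k.

Let tT' : 0 <= t <= T. Proof. by case/andP: tT => a b; rewrite !ltW. Qed.

Let rad : R := Num.min t (T - t).

Let rad0 : 0 < rad.
Proof. by rewrite /rad; case/andP: tT => a b; rewrite lt_min a subr_gt0. Qed.

Let radT (k : R) : `|k| < rad -> 0 <= t + k <= T.
Proof.
rewrite /rad lt_min => /andP[h1 h2]; have := ler_norm k; have := ler_norm (- k).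
by rewrite normrN => h3 h4; lra.
Qed.

Let qM (k x : R) : `|k| < rad -> 0 < x < L -> `|q k x| <= M.
Proof.
move=> hk hx; have [->|k0] := eqVneq k 0; first by rewrite /q invr0 mulr0 normr0.
rewrite normrM normfV ler_pdivrMr ?normr_gt0//.
have := phi_lip tT' (radT hk) hx.
by rewrite (_ : t + k - t = k)//; ring.
Qed.

Let q_cvg (k : nat -> R) (x : R) : (forall j, k j != 0) -> k @ \oo --> (0 : R) ->
  0 < x < L -> ~ N x -> (fun j => q (k j) x) @ \oo --> D x.
Proof.
move=> kn kc hx Nx; have /is_derive_epsP dx := D_in hx Nx.
apply/cvgrPdist_le => e e0; have [d d0 dP] := dx e e0.
near=> j; have hd : `|k j| < d by near: j; exact: (cvgr0_norm_lt _ kc).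
have kj := kn j.
have := dP _ hd; rewrite distrC /q -ler_pdivrMr ?normr_gt0//.
by rewrite -normf_div mulrBl mulfK.
Unshelve. all: by end_near. Qed.

Let mq (k : R) : `|k| < rad -> measurable_fun `]0, L[%classic (q k).
Proof.
move=> hk; apply: measurable_funM; last exact: measurable_cst.
by apply: measurable_funB; apply: mphi => //; exact: radT.
Qed.

Let mDset : measurable (`]0, L[%classic `\` N : set R).
Proof. by apply: measurableD. Qed.

Lemma Lp_derivative_measurable : measurable_fun setT D.
Proof.
have -> : D = D \_ (`]0, L[%classic `\` N).
  apply/funext => x; rewrite patchE; case: ifPn => // /negP nx.
  by apply: D_out => h; apply: nx; exact/mem_set.
apply/(measurable_restrictT _ _).1 => //.
pose k (j : nat) : R := rad / 2 * j.+1%:R^-1.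
have kn j : k j != 0 by rewrite /k mulf_neq0// gt_eqF// divr_gt0.
have k_rad j : `|k j| < rad.
  rewrite /k normrM (gtr0_norm (divr_gt0 rad0 _))// ger0_norm//.
  apply: (@le_lt_trans _ _ (rad / 2)).
    have h1 : (j.+1%:R^-1 : R) <= 1 by rewrite invf_le1 ?ler1n.
    by rewrite ler_piMr// divr_ge0// ltW.
  by have := rad0; lra.
have kc : k @ \oo --> (0 : R).
  rewrite -[X in _ --> X](mulr0 (rad / 2)).
  by apply: cvgM; [exact: cvg_cst|exact: cvg_harmonic].
apply: (@measurable_fun_cvg _ _ _ _ (fun j => q (k j))).
  by move=> j; apply: measurable_funS (mq (k_rad j)) => // x [].
move=> x [/=]; rewrite in_itv /= => hx Nx; exact: q_cvg.
Qed.

(** Dominated convergence works along sequences, so a failure is first turned into a sequence of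
    increments tending to 0. Quotients and limit are bounded by M, hence the constant majorant (2
    M)^r. *)
Lemma Lp_derivative (e : R) : 0 < e -> exists2 d : R, 0 < d & forall k : R, k != 0 -> `|k| < d ->
  (\int[lam]_(x in `[0%R, L]) (`|(phi (t + k) x - phi t x) / k - D x| `^ r)%:E <= e%:E)%E.
Proof.
move=> e0; apply: contrapT => no.
have bad j : exists k : R, [/\ k != 0, `|k| < rad * j.+1%:R^-1 &
    (e%:E < \int[lam]_(x in `[0%R, L]) (`|q k x - D x| `^ r)%:E)%E].
  apply: contrapT => nk; apply: no; exists (rad * j.+1%:R^-1); first exact: mulr_gt0.
  move=> k k0 kd; rewrite leNgt; apply/negP => h; apply: nk; exists k; split => //.
have [k kP] := choice bad.
have kn j : k j != 0 by case: (kP j).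
have kj j : `|k j| < rad * j.+1%:R^-1 by case: (kP j).
have k_rad j : `|k j| < rad.
  have h1 : (j.+1%:R^-1 : R) <= 1 by rewrite invf_le1 ?ler1n.
  by apply: (lt_le_trans (kj j)); rewrite ler_piMr ?(ltW rad0).
have kc : k @ \oo --> (0 : R).
  apply/cvgr0Pnorm_le => d d0.
  have hc : (fun j : nat => rad * j.+1%:R^-1) @ \oo --> (0 : R).
    rewrite -[X in _ --> X](mulr0 rad).
    by apply: cvgM; [exact: cvg_cst|exact: cvg_harmonic].
  near=> j; apply: (le_trans (ltW (kj j))); apply: (le_trans (ler_norm _)).
  by near: j; exact: (cvgr0_norm_le _ hc).
have qc x : 0 < x < L -> ~ N x -> (fun j => q (k j) x) @ \oo --> D x.
  by move=> hx Nx; exact: q_cvg.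
have DM x : 0 < x < L -> ~ N x -> `|D x| <= M.
  move=> hx Nx; apply/ler_addgt0Pr => d d0; have /cvgrPdist_le/(_ d d0) h := qc x hx Nx.
  near \oo => j; have hj : `|D x - q (k j) x| <= d by near: j.
  rewrite -(subrK (q (k j) x) (D x)) addrC (le_trans (ler_normD _ _))// lerD//.
  exact: qM.
have mI : measurable (`]0, L[%classic : set (measurableTypeR R)) by [].
have mf j : measurable_fun `]0, L[%classic (fun x => (`|q (k j) x - D x| `^ r)%:E).
  apply/measurable_EFinP.
  apply: (measurableT_comp (measurable_powR r)); apply: (measurableT_comp (@normr_measurable _ setT)).
  apply: measurable_funB; first exact: mq.
  by apply: measurable_funTS; exact: Lp_derivative_measurable.
have [|||||_ _] := @dominated_convergence _ _ _ lam `]0, L[%classic mI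
  (fun j x => (`|q (k j) x - D x| `^ r)%:E) (fun=> 0%E) (fun=> ((2 * M) `^ r)%:E).
- exact: mf.
- exact: measurable_cst.
- exists N; split => // x /= xq; apply: contrapT => Nx; apply: xq.
  rewrite in_itv /= => hx; apply: cvg_EFin; first by near=> j.
  apply/cvgr0Pnorm_le => d d0.
  have h : (fun j => q (k j) x - D x) @ \oo --> (0 : R).
    rewrite -[X in _ --> X](subrr (D x)).
    by apply: cvgB; [exact: qc|exact: cvg_cst].
  have d1 : 0 < Num.min 1 d by rewrite lt_min ltr01.
  near=> j; rewrite /= ger0_norm ?powR_ge0//.
  have : `|q (k j) x - D x| <= Num.min 1 d by near: j; exact: (cvgr0_norm_le _ h).
  rewrite le_min => /andP[u1 ud]; apply: le_trans ud.
  by apply: powR_le_self => //; rewrite normr_ge0.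
- apply: (@bounded_fun_integrable _ (measurableTypeR R) R lam _ (cst ((2 * M) `^ r)) `|(2 * M) `^ r|) => //.
  by apply: le_lt_trans (ltry L); rewrite -(lebesgue_itvoo0 L0).
- exists N; split => // x /= xq; apply: contrapT => Nx; apply: xq => j.
  rewrite in_itv /= => hx; rewrite lee_fin ger0_norm ?powR_ge0//.
  apply: powR_le => //; rewrite (le_trans (ler_normB _ _))//.
  rewrite mulr_natl mulr2n lerD//; [exact: qM|exact: DM].
rewrite integral0 => icvg.
have : (e%:E <= 0)%E.
  rewrite -(cvg_lim _ icvg)//; apply: lime_ge; first by apply/cvg_ex; exists 0%E.
  near=> j; case: (kP j) => _ _ /ltW.
  by rewrite integral_cc_oo// => x; rewrite lee_fin powR_ge0.
by rewrite lee_fin leNgt e0.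
Unshelve. all: by end_near. Qed.
End Lp_flow.

(** * The differential equation for chi *)

Lemma BCconstE (R : realType) (n : nat) (mu : R -> {measure set (measurableTypeR R) -> \bar R}) :
  (0 < n)%N -> (mu 0%R setT < +oo)%E ->
  BCconst n mu = Kmass n * Cconst mu + Cconst mu.
Proof.
move=> n1 fin; congr (_ + _); rewrite /Bconst.
by have := kconv_mass fin n1; rewrite /kconv /pfun => ->.
Qed.

(** The integral of u K(x - .) against [mu t] is computed in two coordinates: mass levels give
    [qflux], energy levels give the integral in [hfun]. *)
Lemma hfunE (R : realType) (u : R -> R -> R)
    (mu : R -> {measure set (measurableTypeR R) -> \bar R}) (T Ms M C : R) (n : nat)
    (n1 : (0 < n)%N) (H : flow u mu T Ms M)
    (massC : forall t : R, 0 <= t <= T -> fine (mu t setT) = C) (chie : R -> R -> R)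
    (t : R) (N : set R) :
  0 <= t <= T -> BCconst n mu = Kmass n * C + C ->
  measurable N -> @lebesgue_measure R N = 0%E ->
  (forall eta : R, 0 < eta < Kmass n * C + C -> ~ N eta ->
    is_derive eta 1 (chi n mu t) (chie t eta)) ->
  forall eta : R, hfun n u mu chie t eta =
    u t (chi n mu t eta) * pfun n mu t (chi n mu t eta)
    - qflux u mu C n t (chi n mu t eta).
Proof.
move=> tT BCE mN N0 der eta; rewrite /hfun BCE; congr (_ - _).
set x := chi n mu t eta.
have fin := flow_fin H tT.
have mf : measurable_fun setT (fun y : R => (u t y * Kn n (x - y))%:E).
  apply/measurable_EFinP; apply: measurable_funM; last exact: measurable_Kn_sub.
  by apply: continuous_measurable_fun; exact: (flow_continuous H tT).
have e1 := quantile_image fin mf; have mC := massC t tT.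
rewrite mC in e1.
have -> : qflux u mu C n t x = fine (\int[mu t]_y (u t y * Kn n (x - y))%:E)%E.
  by rewrite e1.
have der' (e : R) : 0 < e < Kmass n * fine (mu t setT) + fine (mu t setT) -> ~ N e ->
    is_derive e 1 (quantile (Gfun n mu t)) (chie t e).
  by rewrite mC; exact: der.
rewrite (energy_image n1 fin (fun y => GfunE n1 H y tT) mN N0 der' mf) mC.
by congr fine; apply: eq_integral => e _; rewrite -EFinM.
Qed.

Theorem theorem5p3 (R : realType) (gamma : R) (n : nat)
    (psip psim : R -> R) (u ux : R -> R -> R)
    (mu : R -> {measure set (measurableTypeR R) -> \bar R})
    (chie : R -> R -> R) (T : R) :
  2 < gamma -> gamma <= n%:R ->
  psi_pair psip psim ->
  weak_conservative_solution psip psim u ux mu ->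
  (\int[mu 0%R]_x ((1 + `|x| `^ gamma)%:E) < +oo)%E ->
  0 < T ->
  (* chie is (a version of) the a.e. derivative chi_eta of chi(t,.) *)
  (forall t, 0 <= t ->
     {ae @lebesgue_measure R, forall eta, 0 < eta < BCconst n mu ->
        is_derive eta 1 (chi n mu t) (chie t eta)}) ->
  (* chi(t,.) belongs to L^gamma([0,B+C]) for t in [0,T] *)
  (forall t, 0 <= t <= T ->
     measurable_fun `[0%R, BCconst n mu]%classic (chi n mu t) /\
     (\int[@lebesgue_measure R]_(eta in `[0%R, BCconst n mu]%classic)
        (`|chi n mu t eta| `^ gamma)%:E < +oo)%E) /\
  (* t |-> chi(t,.) is continuous [0,T] -> L^gamma([0,B+C]) *)
  (forall t, 0 <= t <= T -> forall e : R, 0 < e -> exists d : R, 0 < d /\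
     forall s, 0 <= s <= T -> `|s - t| < d ->
       (\int[@lebesgue_measure R]_(eta in `[0%R, BCconst n mu]%classic)
          (`|chi n mu s eta - chi n mu t eta| `^ gamma)%:E <= e%:E)%E) /\
  (* for a.e. t in [0,T]: chi_t exists in L^gamma and chi_t + h chi_eta = U *)
  {ae @lebesgue_measure R, forall t, 0 < t < T ->
     exists D : R -> R,
       measurable_fun `[0%R, BCconst n mu]%classic D /\
       (forall e : R, 0 < e -> exists d : R, 0 < d /\
          forall k : R, k != 0 -> `|k| < d ->
            (\int[@lebesgue_measure R]_(eta in `[0%R, BCconst n mu]%classic)
               (`|(chi n mu (t + k) eta - chi n mu t eta) / k - D eta| `^ gamma)%:E
             <= e%:E)%E) /\
       {ae @lebesgue_measure R, forall eta, 0 <= eta <= BCconst n mu ->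
          D eta + hfun n u mu chie t eta * chie t eta = Ufun n u mu t eta}}.
Proof.
move=> g2 gn hpsi hsol hmom T0 hchie.
have n2 : (1 < n)%N.
  by apply: ltnW; rewrite -(ltr_nat R); exact: lt_le_trans gn.
have n1 : (0 < n)%N by exact: ltnW.
have g1 : 1 <= gamma by lra.
have g0 : 0 <= gamma by lra.
have [Ms [M H]] := flow_of_solution hpsi hsol T0.
have zT : 0 <= (0 : R) <= T by rewrite lexx ltW.
have massC t : 0 <= t <= T -> fine (mu t setT) = Cconst mu.
  by move=> tT; exact: (mass_const H tT zT).
have BCE := BCconstE n1 (flow_fin H zT).
have C0 : 0 <= Cconst mu by rewrite fine_ge0.
have L0 : 0 <= BCconst n mu by rewrite BCE addr_ge0// mulr_ge0// Kmass_ge0.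
have M0 := flow_M_ge0 H zT.
have mchi t : 0 <= t <= T -> measurable_fun `]0, BCconst n mu[%classic (chi n mu t).
  by move=> tT; rewrite BCE; apply: measurable_quantile; exact: (Gfun_has_quantile n1 H massC tT).
have lip s t eta : 0 <= s <= T -> 0 <= t <= T -> 0 < eta < BCconst n mu ->
    `|chi n mu t eta - chi n mu s eta| <= M * `|t - s|.
  by rewrite BCE; exact: (chi_lip n1 H massC).
have mom0 : (\int[@lebesgue_measure R]_(eta in `]0%R, BCconst n mu[)
    (`|chi n mu 0 eta| `^ gamma)%:E < +oo)%E.
  rewrite BCE.
  exact: (energy_moment g0 gn n2 (flow_fin H zT) hmom (fun x => GfunE n1 H x zT)).
split; [|split].
- move=> t tT; split; first by apply: measurable_cc_oo; exact: mchi.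
  exact: (Lp_moment L0 M0 g1 mchi lip zT tT mom0).
- move=> t tT e e0; have [d d0 dP] := Lp_continuity L0 M0 g1 lip tT e0.
  by exists d.
(* The equation is obtained at every t of ]0, T[; only the exceptional set of eta depends on t. *)
apply: aeW => t tT; have tT' : 0 <= t <= T by case/andP: tT => a b; rewrite !ltW.
have t0 : 0 <= t by case/andP: tT'.
have [N [mN N0 subN]] := hchie t t0.
have der (eta : R) : 0 < eta < BCconst n mu -> ~ N eta ->
    is_derive eta 1 (chi n mu t) (chie t eta).
  by move=> he; apply: contra_notP => nd; apply: subN => /= /(_ he).
have hE (eta : R) : hfun n u mu chie t eta =
    u t (chi n mu t eta) * pfun n mu t (chi n mu t eta)
    - qflux u mu (Cconst mu) n t (chi n mu t eta).
  by apply: (hfunE n1 H massC tT' BCE mN N0) => z; rewrite -BCE; exact: der.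
(* Setting the derivative to 0 on the null set, where [chie] is arbitrary, makes it measurable as a
   limit of difference quotients. *)
pose D := (fun eta => Ufun n u mu t eta - hfun n u mu chie t eta * chie t eta)
  \_ (`]0, BCconst n mu[%classic `\` N).
have Dout x : ~ (`]0, BCconst n mu[%classic `\` N) x -> D x = 0.
  by move=> nx; rewrite /D patchE memNset.
have Din x : 0 < x < BCconst n mu -> ~ N x ->
    is_derive t 1 ((chi n mu) ^~ x) (D x).
  move=> hx Nx; rewrite /D patchE mem_set; last by split => //; rewrite /= in_itv.
  rewrite hE.
  by apply: (chi_time_derivative n1 H massC tT); [rewrite -BCE|exact: der].
exists D; split; [|split].
- apply: measurable_funTS.
  exact: (Lp_derivative_measurable mchi mN tT Dout Din).
- move=> e e0; have [d d0 dP] := Lp_derivative L0 M0 g1 mchi lip mN N0 tT Dout Din e0.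
  by exists d.
exists (N `|` ([set 0] `|` [set BCconst n mu])); split.
- by apply: measurableU => //; exact: measurableU.
- apply: lebesgue_null_setU => //; first exact: measurableU.
  by apply: lebesgue_null_setU => //; exact: lebesgue_measure_set1.
move=> x /=; apply: contra_notP => nx /andP[x0 xL].
have Nx : ~ N x by move=> h; apply: nx; left.
have hx : (`]0, BCconst n mu[%classic `\` N) x.
  split => //; rewrite /= in_itv /= !lt_neqAle x0 xL !andbT.
  by apply/andP; split; apply/eqP => e; apply: nx; right; [left|right].
by rewrite /D patchE mem_set// subrK.
Qed.
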